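(* Let $\alpha>0$. Consider a family of densities $g(x;\theta)$ on $[1,\infty)$ belonging to the class $\mathcal{G}$, with $h(x)=\frac{\partial}{\partial\theta}g(x;\theta)\big|_{\theta=0}$ satisfying $\int_1^\infty x^{\alpha+1}h^2(x)\,dx<\infty$. Then the alternative densities $$g(x;\theta)=\frac{\alpha}{x^{\alpha+1}}+\theta\left(C\frac{\alpha\,\upsilon(x)}{x^{\alpha+1}}+D\frac{\alpha\ln x-1}{x^{\alpha+1}}\right),\quad x\ge 1,\ C>0,\ D\in\mathbb{R},$$ are, for small $\theta$, asymptotically optimal for the test based on $T_n$, i.e. the local asymptotic Bahadur efficiency $e_T=\lim_{\theta\to 0}\frac{c_T(\theta)}{2K(\theta)}$ equals $1$.
   Context: Let $X_1,\dots,X_n$ be i.i.d. with a continuous distribution on $[1,\infty)$. $F_n(t)=\frac1n\sum_{i=1}^n I\{X_i\le t\}$ is the empirical distribution function, and $M_n(t)=\binom{n}{2}^{-1}\sum_{1\le i<j\le n} I\{\max(X_i/X_j,X_j/X_i)\le t\}$, $t\ge1$. The test statistic is $T_n=\int_1^\infty (M_n(t)-F_n(t))\,dF_n(t)$, large values being significant. The null hypothesis is that the distribution is Pareto, $F(x)=1-x^{-\alpha}$, $x\ge1$, for some $\alpha>0$. $\mathcal{G}$ is a class of families of densities $g(x;\theta)$ on $[1,\infty)$, $\theta$ in a neighbourhood of $0$ (with $\theta\ge 0$), such that $g(x;0)=\alpha x^{-\alpha-1}$ and differentiation in $\theta$ under the integral sign is permitted in all integrals appearing. Define $\upsilon(s)=\frac{2}{3}\frac{\alpha\ln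 s}{s^{\alpha}}-\frac16$, $s\ge1$. For a family in $\mathcal{G}$: $b_T(\theta)$ is the limit in probability of $T_n$ when the sample has density $g(\cdot;\theta)$; $G_n(t)=\inf_{\lambda>0}P_\lambda\{T_n<t\}$ where $P_\lambda$ is the Pareto law with parameter $\lambda$; $f(t)=-\lim_{n\to\infty}\frac1n\ln(1-G_n(t))$; the Bahadur exact slope is $c_T(\theta)=2f(b_T(\theta))$; and $K(\theta)=\inf_{\lambda>0}\int_1^\infty \ln\frac{g(x;\theta)}{\lambda x^{-\lambda-1}}\,g(x;\theta)\,dx$ is the Kullback–Leibler information. *)

(* Defs.v *)
From HB Require Import structures.
From mathcomp Require Import all_boot all_order all_algebra.
From mathcomp Require Import all_classical all_reals all_analysis.
Set Implicit Arguments. Unset Strict Implicit. Unset Printing Implicit Defensive.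
Import Order.TTheory GRing.Theory Num.Theory.
Import numFieldNormedType.Exports.
Local Open Scope classical_set_scope.
Local Open Scope ring_scope.

Section Defs.
Variable R : realType.
Local Notation mu := (@lebesgue_measure R).

Definition pareto (lam x : R) : R := lam * x `^ (- (lam + 1)).

Definition upsilon (alpha s : R) : R :=
  (2 / 3) * (alpha * ln s / s `^ alpha) - 1 / 6.

Definition galt (alpha C D theta x : R) : R :=
  alpha / x `^ (alpha + 1) +
  theta * (C * (alpha * upsilon alpha x) / x `^ (alpha + 1)
           + D * ((alpha * ln x - 1) / x `^ (alpha + 1))).

(* h(x) = d/dtheta g(x;theta) at theta = 0 (g is affine in theta) *)
Definition halt (alpha C D x : R) : R :=
  C * (alpha * upsilon alpha x) / x `^ (alpha + 1)
  + D * ((alpha * ln x - 1) / x `^ (alpha + 1)).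

Definition is_density (g : R -> R) : Prop :=
  (forall x, 1 <= x -> 0 <= g x) /\
  (\int[mu]_(x in `[1%R, +oo[) (g x)%:E = 1)%E.

(* E_g^{(n)}[F(X_1,...,X_n)] for X_i i.i.d. with density g on [1,oo),
   as an iterated (Tonelli) integral; the sample is the list [X_1;...;X_n]. *)
Fixpoint iid_int (g : R -> R) (n : nat) (F : seq R -> \bar R) : \bar R :=
  match n with
  | 0 => F [::]
  | n'.+1 => (\int[mu]_(x in `[1%R, +oo[)
               ((g x)%:E * iid_int g n' (fun s => F (x :: s))))%E
  end.

Definition iid_prob (g : R -> R) (n : nat) (E : seq R -> Prop) : R :=
  fine (iid_int g n (fun s => (\1_[set s | E s] s)%:E)).

Definition Fn (s : seq R) (t : R) : R :=
  (size s)%:R^-1 * (count (fun x => x <= t) s)%:R.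

Definition Mn (s : seq R) (t : R) : R :=
  ('C(size s, 2))%:R^-1 *
  \sum_(i < size s) \sum_(j < size s | (i < j)%N)
     (if Num.max (s`_i / s`_j) (s`_j / s`_i) <= t then 1 else 0).

(* T_n = int (M_n - F_n) dF_n  (integral against the empirical measure) *)
Definition Tn (s : seq R) : R :=
  (size s)%:R^-1 * \sum_(x <- s) (Mn s x - Fn s x).

Definition conv_in_prob (g : R -> R) (b : R) : Prop :=
  forall eps : R, 0 < eps ->
    (fun n : nat => iid_prob g n (fun s => eps < `|Tn s - b|)) @ \oo --> (0 : R).

Definition Gn (n : nat) (t : R) : R :=
  inf [set iid_prob (pareto lam) n (fun s => Tn s < t) | lam in `]0, +oo[].

Definition fseq (t : R) : nat -> R :=
  fun n => - ((n%:R)^-1 * ln (1 - Gn n t)).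
Definition fT (t : R) : R := limn (fseq t).

Definition KL (g : R -> R) : R :=
  inf [set Rintegral mu `[1%R, +oo[ (fun x => ln (g x / pareto lam x) * g x)
      | lam in `]0, +oo[].

End Defs.

(* Main.v *)
(* Under a Pareto law of parameter [lambda], [lambda ln X] is standard exponential whatever
   [lambda] is.  Cut its range into [N^2] cells of length [1/N] and an overflow cell: their
   probabilities do not depend on [lambda], and, up to a multiple of the largest cell mass, [T_n]
   is a cubic functional [tau] of the empirical law of the cells.  The method of types and an
   exponential tilting then reduce [f(t)] to the minimum of the relative entropy [kl nu p] over
   [tau nu >= t].  The Donsker-Varadhan inequality bounds this minimum from below, the tilts
   [p (1 + s phi)] by the first-order influence function [phi] of [tau] bound it from above, and
   letting [N] tend to infinity gives [f(t) = t^2 / (2 V) (1 + O(t))], where [V = 5/108] is the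
   variance of the influence function [1 + 2 y exp(-y)] of an exponential variable.
   The alternative has likelihood ratio [1 + theta w], where [w] is [C] times the centred influence
   function over 3 plus a multiple of [Y - 1], the score of [lambda].  The latter is
   uncorrelated with the influence function, so that
   [b_T(theta) = theta C V / 3 + O(theta^2)], and it is absorbed by the infimum over [lambda] in
   [K(theta) = theta^2 C^2 V / 18 + O(theta^3)].  Hence both [f(b_T(theta))] and [K(theta)] are
   [theta^2 C^2 V / 18 + O(theta^3)]. *)
Require Import Defs.
From HB Require Import structures.
From mathcomp Require Import all_boot all_order all_algebra.
From mathcomp Require Import all_classical all_reals all_analysis.
From mathcomp Require Import measurable_realfun ring lra zify.
Import Order.TTheory GRing.Theory Num.Theory.
Import numFieldNormedType.Exports.
Local Open Scope classical_set_scope.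
Local Open Scope ring_scope.

Set Implicit Arguments.
Unset Strict Implicit.
Unset Printing Implicit Defensive.

(** * Entropy inequalities *)

Section elementary.
Variable R : realType.
Implicit Types x u v a b : R.

(** The binning error is governed by the largest mass of the empirical law, not of the reference
    law, and a rare sample could concentrate in one cell. Entropy prevents this: Donsker-Varadhan
    applied to a single cell shows that [kl nu p <= 1] bounds every mass of [nu] by [d] as soon as
    the masses of [p] are below exp(-2/d). So [d] is chosen after the level [t], and the mesh after
    [d]. No minimal entropy is computed exactly. For each tolerance [eta] some mesh puts [fseq t n]
    eventually within [eta] of a number lying in a window around t^2/(2V) that does not depend on
    the mesh; this yields both the existence of the limit and its expansion. Events on real samples
    are never shown measurable: they are enclosed between events on the cells, for which the
    iterated integral is a finite sum. The value V = 5/108 is 62/27 - (3/2)^2, from the exponential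
    moments E[Y e^{-Y}] = 1/4 and E[Y^2 e^{-2Y}] = 2/27. *)

Lemma ge0_derive_le (f df : R -> R) a b : a <= b ->
  (forall x, a <= x <= b -> is_derive x 1 f (df x)) ->
  (forall x, a <= x <= b -> 0 <= df x) -> f a <= f b.
Proof.
move=> ab fd df0.
have fdo x : x \in `]a, b[ -> is_derive x 1 f (df x).
  by rewrite in_itv/= => /andP[/ltW ax /ltW xb]; apply: fd; rewrite ax.
have fc : {within `[a, b], continuous f}.
  apply: derivable_within_continuous => x; rewrite in_itv/= => /fd ?.
  exact: ex_derive.
have [c + fba] := MVT_segment ab fdo fc.
rewrite in_itv/= => /df0 dfc0.
by rewrite -subr_ge0 fba mulr_ge0// subr_ge0.
Qed.

Lemma expR_le_pol2 x : 0 <= x -> expR (- x) <= 1 - x + x ^+ 2 / 2.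
Proof.
move=> x0; rewrite -subr_ge0.
pose f (y : R) : R := 1 - y + y ^+ 2 / 2 - expR (- y).
have -> : 0 = f 0 :> R by rewrite /f oppr0 expR0; ring.
apply: (@ge0_derive_le f (fun y => -1 + y + expR (- y))) => // y /andP[y0 _].
  by apply: is_derive_eq; rewrite /GRing.scale/=; field.
by have := expR_ge1Dx (- y); lra.
Qed.

Lemma expR1_le4 : expR 1 <= 4 :> R.
Proof.
have h : expR (2^-1) <= 2 :> R.
  have := expR_ge1Dx (- 2^-1 : R); rewrite expRN => h.
  by rewrite -[leLHS]invrK invf_ple ?posrE ?invr_gt0 ?expR_gt0//; lra.
have -> : 1 = 2^-1 + 2^-1 :> R by lra.
by rewrite expRD; have := expR_gt0 (2^-1 : R); nra.
Qed.

(** Three successive integrations from 0 of the crude bound 6 for the exponential on [0, 1]; 6 is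
    the third derivative of x^3, so the last step gives coefficient one. *)
Lemma expR_le_pol3 x : 0 <= x <= 1 -> expR x <= 1 + x + x ^+ 2 / 2 + x ^+ 3.
Proof.
move=> /andP[x0 x1].
have e1 (y : R) : 0 <= y <= 1 -> expR y <= 1 + 6 * y.
  move=> /andP[y0 y1]; rewrite -subr_ge0.
  pose f (z : R) : R := 1 + 6 * z - expR z.
  have -> : 0 = f 0 :> R by rewrite /f expR0; ring.
  apply: (@ge0_derive_le f (fun z => 6 - expR z)) => // z /andP[z0 zy].
    by apply: is_derive_eq; rewrite /GRing.scale/=; field.
  have : expR z <= expR 1 by rewrite ler_expR; lra.
  by have := expR1_le4; lra.
have e2 (y : R) : 0 <= y <= 1 -> expR y <= 1 + y + 3 * y ^+ 2.
  move=> /andP[y0 y1]; rewrite -subr_ge0.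
  pose f (z : R) : R := 1 + z + 3 * z ^+ 2 - expR z.
  have -> : 0 = f 0 :> R by rewrite /f expR0; ring.
  apply: (@ge0_derive_le f (fun z => 1 + 6 * z - expR z)) => // z /andP[z0 zy].
    by apply: is_derive_eq; rewrite /GRing.scale/=; field.
  by have := e1 z; lra.
rewrite -subr_ge0.
pose f (z : R) : R := 1 + z + z ^+ 2 / 2 + z ^+ 3 - expR z.
have -> : 0 = f 0 :> R by rewrite /f expR0; ring.
apply: (@ge0_derive_le f (fun z => 1 + z + 3 * z ^+ 2 - expR z)) => // z /andP[z0 zy].
  by apply: is_derive_eq; rewrite /GRing.scale/=; field.
by have := e2 z; lra.
Qed.

Lemma expR_le_norm3 x : `|x| <= 1 -> expR x <= 1 + x + x ^+ 2 / 2 + `|x| ^+ 3.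
Proof.
have [x0 x1|x0 x1] := ger0P x.
  by apply: expR_le_pol3; rewrite x0.
have := @expR_le_pol2 (- x); rewrite opprK => /(_ _)/le_trans; apply; first lra.
have : 0 <= (- x) ^+ 3 by rewrite exprn_ge0; lra.
by lra.
Qed.

Lemma lnN_le v : 0 <= v <= 2^-1 -> - ln (1 - v) <= v + 2 * v ^+ 2.
Proof.
move=> /andP[v0 v1].
have p : 0 < 1 - v by lra.
rewrite -lnV ?posrE//.
have -> : (1 - v)^-1 = 1 + v / (1 - v) by field; lra.
apply: le_trans (le_ln1Dx _) _.
  by rewrite (@lt_le_trans _ _ 0)//; rewrite divr_ge0// ltW.
by rewrite ler_pdivrMr//; nra.
Qed.

(** Each one-sided bound compares derivatives starting from 0, where both sides vanish. For negative
    [u] the functions are reflected, so that the same comparison runs over [0, 1/2], away from the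
    singularity of the logarithm. *)
Lemma xlnx_approx u : - 2^-1 <= u ->
  `|(1 + u) * ln (1 + u) - u - u ^+ 2 / 2| <= `|u| ^+ 3.
Proof.
move=> u1; rewrite ler_norml.
pose G (x : R) : R := (1 + x) * ln (1 + x).
have dG (x : R) : 0 < 1 + x -> is_derive x 1 G (ln (1 + x) + 1).
  move=> x1.
  have ? := is_derive1_ln x1.
  have ? : is_derive x 1 (fun x : R => ln (1 + x)) ((1 + x)^-1).
    have d1 : is_derive x 1 (fun x : R => 1 + x) 1 by apply: is_derive_eq; rewrite add0r mulr1.
    have := @is_derive1_comp _ _ _ x _ _ (is_derive1_ln x1) d1.
    by rewrite mulr1.
  apply: is_derive_eq.
  rewrite /GRing.scale/=; field; lra.
have G0 : G 0 = 0 by rewrite /G addr0 ln1 mulr0.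
have cmp (F dF : R -> R) : F 0 = 0 -> 0 <= u ->
    (forall x, 0 <= x -> is_derive x 1 F (dF x)) ->
    (forall x, 0 <= x -> 0 <= dF x) -> 0 <= F u.
  move=> F0 u0 dFx dFp; rewrite -F0.
  by apply: (@ge0_derive_le F dF) => // x /andP[? ?]; [exact: dFx|exact: dFp].
have dGN (x : R) : 0 < 1 - x -> is_derive x 1 (fun y => G (- y)) (- (ln (1 - x) + 1)).
  move=> x1; have ? := dG (- x) x1.
  have d1 : is_derive x 1 (fun x : R => - x) (-1) by apply: is_derive_eq.
  have := @is_derive1_comp _ _ _ x _ _ (dG (- x) x1) d1.
  by rewrite mulrN1.
have cmpN (F dF : R -> R) : F 0 = 0 -> u <= 0 ->
    (forall x, 0 <= x <= 2^-1 -> is_derive x 1 F (dF x)) ->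
    (forall x, 0 <= x <= 2^-1 -> 0 <= dF x) -> 0 <= F (- u).
  move=> F0 u0 dFx dFp; rewrite -F0.
  by apply: (@ge0_derive_le F dF) => [|x /andP[? ?]|x /andP[? ?]];
    [lra|apply: dFx|apply: dFp]; lra.
have [u0|/ltW u0] := ger0P u.
- pose F1 (x : R) : R := G x - x - x ^+ 2 / 2 + x ^+ 3.
  have h1 : 0 <= F1 u.
    apply: (@cmp F1 (fun x => ln (1 + x) - x + 3 * x ^+ 2)) => [|//|x x0|x x0].
    + by rewrite /F1 G0; field.
    + have ? : is_derive x 1 G (ln (1 + x) + 1) by apply: dG; lra.
      by apply: is_derive_eq; rewrite /GRing.scale/=; field.
    + have x1 : 0 < 1 + x by lra.
      have := @le_ln1Dx R ((1 + x)^-1 - 1); rewrite addrCA subrr addr0 lnV ?posrE//.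
      have -> : (1 + x)^-1 - 1 = - (x / (1 + x)) by field; lra.
      have h : x / (1 + x) <= x by rewrite ler_pdivrMr//; nra.
      have h' : x / (1 + x) < 1 by rewrite ltr_pdivrMr//; nra.
      have h2 : x - x ^+ 2 <= x / (1 + x) by rewrite ler_pdivlMr//; nra.
      by move=> /(_ _); nra.
  pose F2 (x : R) : R := x + x ^+ 2 / 2 - G x.
  have h2 : 0 <= F2 u.
    apply: (@cmp F2 (fun x => x - ln (1 + x))) => [|//|x x0|x x0].
    + by rewrite /F2 G0; field.
    + have ? : is_derive x 1 G (ln (1 + x) + 1) by apply: dG; lra.
      by apply: is_derive_eq; rewrite /GRing.scale/=; field.
    + by rewrite subr_ge0 le_ln1Dx//; lra.
  have : 0 <= u ^+ 3 by rewrite exprn_ge0.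
  by rewrite /F1 /F2 /G in h1 h2; lra.
- pose F3 (x : R) : R := G (- x) + x - x ^+ 2 / 2.
  have h1 : 0 <= F3 (- u).
    apply: (@cmpN F3 (fun x => - ln (1 - x) - x)) => [|//|x /andP[x0 x1]|x /andP[x0 x1]].
    + by rewrite /F3 oppr0 G0; field.
    + have ? := dGN x.
      have ? : is_derive x 1 (fun y => G (- y)) (- (ln (1 - x) + 1)) by apply: dGN; lra.
      by apply: is_derive_eq; rewrite /GRing.scale/=; field.
    + by have := @le_ln1Dx R (- x); move=> /(_ _); lra.
  pose F4 (x : R) : R := x ^+ 2 / 2 - x + x ^+ 3 - G (- x).
  have h2 : 0 <= F4 (- u).
    apply: (@cmpN F4 (fun x => x + 3 * x ^+ 2 + ln (1 - x))) => [|//|x /andP[x0 x1]|x /andP[x0 x1]].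
    + by rewrite /F4 oppr0 G0; field.
    + have ? : is_derive x 1 (fun y => G (- y)) (- (ln (1 - x) + 1)) by apply: dGN; lra.
      by apply: is_derive_eq; rewrite /GRing.scale/=; field.
    + by have := @lnN_le x; rewrite x0 x1 => /(_ isT); nra.
  have : 0 <= (- u) ^+ 3 by rewrite exprn_ge0; lra.
  by rewrite /F3 /F4 !opprK /G in h1 h2; lra.
Qed.

Lemma ln_approx a : - 2^-1 <= a -> `|ln (1 + a) - a + a ^+ 2 / 2| <= 3 * `|a| ^+ 3.
Proof.
move=> a1; have := xlnx_approx a1; set l := ln _ => h.
(* Multiplication by 1 + a turns the claim into [xlnx_approx] with an extra a^3/2; since 1 + a >=
   1/2, the resulting 3/2 becomes the constant 3. *)
rewrite -(@ler_pM2l _ (1 + a)); last lra.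
rewrite -{1}[1 + a]ger0_norm -?normrM; last lra.
have -> : (1 + a) * (l - a + a ^+ 2 / 2) = ((1 + a) * l - a - a ^+ 2 / 2) + a ^+ 3 / 2.
  by field.
apply: le_trans (ler_normD _ _) _.
rewrite normrM normrX [`|2^-1|]ger0_norm; last lra.
have : 0 <= `|a| ^+ 3 by rewrite exprn_ge0.
by nra.
Qed.

End elementary.

Section entropy.
Variables (R : realType) (I : finType).
Implicit Types (nu p q f u : I -> R).

Definition prob nu := (forall i, 0 <= nu i) /\ \sum_i nu i = 1.

(** Points of zero mass contribute 0 whatever [ln] returns at 0, which is the usual convention 0 ln
    0 = 0. *)
Definition kl nu p := \sum_i nu i * ln (nu i / p i).

Definition l1 u := \sum_i `|u i|.

Lemma prob_ge0 nu i : prob nu -> 0 <= nu i. Proof. by case. Qed.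

Lemma prob_le1 nu i : prob nu -> nu i <= 1.
Proof. by case=> n0 <-; rewrite (bigD1 i)//= lerDl sumr_ge0. Qed.

Lemma ler_mean p f (c : R) : prob p -> (forall i, f i <= c) -> \sum_i p i * f i <= c.
Proof.
move=> [p0 p1] fc; apply: (@le_trans _ _ (\sum_i p i * c)).
  by apply: ler_sum => i _; exact: ler_wpM2l.
by rewrite -mulr_suml p1 mul1r.
Qed.

Lemma ger_mean p f (c : R) : prob p -> (forall i, c <= f i) -> c <= \sum_i p i * f i.
Proof.
move=> [p0 p1] fc; apply: (@le_trans _ _ (\sum_i p i * c)).
  by rewrite -mulr_suml p1 mul1r.
by apply: ler_sum => i _; exact: ler_wpM2l.
Qed.

Lemma norm_mean_le p f (c : R) : prob p -> (forall i, `|f i| <= c) ->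
  `|\sum_i p i * f i| <= c.
Proof.
move=> pp fc; rewrite ler_norml; apply/andP; split.
  by apply: ger_mean => // i; have := fc i; rewrite ler_norml => /andP[].
by apply: ler_mean => // i; have := fc i; rewrite ler_norml => /andP[].
Qed.

Lemma l1_ge0 u : 0 <= l1 u.
Proof. by rewrite sumr_ge0. Qed.

Lemma l1_prob nu : prob nu -> l1 nu = 1.
Proof. by case=> n0 <-; apply: eq_bigr => i _; rewrite ger0_norm. Qed.

Lemma l1Z (c : R) u : l1 (fun i => c * u i) = `|c| * l1 u.
Proof. by rewrite /l1 mulr_sumr; apply: eq_bigr => i _; rewrite normrM. Qed.

Lemma l1_sub_prob nu q : prob nu -> prob q -> l1 (fun i => nu i - q i) <= 2.
Proof.
move=> nup qp; rewrite (_ : 2 = l1 nu + l1 q); last by rewrite !l1_prob//; lra.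
by rewrite /l1 -big_split/= ler_sum// => i _; exact: ler_normB.
Qed.

(** Gibbs' inequality against the tilted law p e^f / Z: it reduces to ln x <= x - 1 at x = p e^f /
    (Z nu), averaged under [nu]. *)
Lemma donsker_varadhan nu p f : prob nu -> (forall i, 0 < p i) -> \sum_i p i = 1 ->
  \sum_i nu i * f i <= kl nu p + ln (\sum_i p i * expR (f i)).
Proof.
move=> [n0 n1] p0 p1; set Z := \sum_i p i * expR (f i).
have Z0 : 0 < Z.
  have [i _] : exists i : I, true.
    apply/existsP; apply: contraPT n1 => /existsPn h.
    by rewrite big1 => [/eqP|i _]; [rewrite eq_sym oner_eq0|have := h i].
  rewrite /Z (bigD1 i)//= ltr_pwDl ?mulr_gt0 ?expR_gt0// sumr_ge0// => j _.
  by rewrite mulr_ge0 ?expR_ge0// ltW.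
rewrite -[ln Z]mul1r -n1 mulr_suml /kl -big_split/= -subr_le0 -sumrB.
apply: (@le_trans _ _ (\sum_i (p i * expR (f i) / Z - nu i))).
  apply: ler_sum => i _.
  have [n0i|n0i] := eqVneq (nu i) 0.
    by rewrite n0i !mul0r addr0 subrr subr0 divr_ge0 ?mulr_ge0 ?expR_ge0// ltW.
  have ni : 0 < nu i by rewrite lt0r n0i n0.
  have x0 : 0 < p i * expR (f i) / Z / nu i by rewrite !divr_gt0 ?mulr_gt0 ?expR_gt0.
  have := @le_ln1Dx R (p i * expR (f i) / Z / nu i - 1).
  rewrite addrCA subrr addr0 => /(_ _).
  have -> : ln (p i * expR (f i) / Z / nu i) = f i - ln Z - ln (nu i / p i).
    rewrite !ln_div ?posrE ?divr_gt0 ?mulr_gt0 ?expR_gt0//.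
    by rewrite lnM ?posrE ?expR_gt0// expRK; ring.
  move=> h.
  have {}h : f i - ln Z - ln (nu i / p i) <= p i * expR (f i) / Z / nu i - 1.
    by apply: h; lra.
  have := ler_pM2l ni (f i - ln Z - ln (nu i / p i)) (p i * expR (f i) / Z / nu i - 1).
  rewrite h.
  rewrite [X in _ <= X](_ : _ = p i * expR (f i) / Z - nu i); last first.
    by field; rewrite n0i gt_eqF.
  by move=> {}h; have : true = true by []; rewrite -{1}h => h'; lra.
by rewrite sumrB n1 -mulr_suml divff ?gt_eqF// subrr.
Qed.

Lemma kl_ge0 nu p : prob nu -> (forall i, 0 < p i) -> \sum_i p i = 1 -> 0 <= kl nu p.
Proof.
move=> nup p0 p1; have := @donsker_varadhan nu p (fun=> 0) nup p0 p1.
rewrite big1 ?expR0; last by move=> i _; rewrite mulr0.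
by under eq_bigr do rewrite mulr1; rewrite p1 ln1 addr0.
Qed.

(* The reference measure is centred before the exponential moment is expanded. *)
Lemma kl_lower nu p f : prob nu -> (forall i, 0 < p i) -> \sum_i p i = 1 ->
  \sum_i p i * f i = 0 -> (forall i, `|f i| <= 1) ->
  \sum_i nu i * f i <= kl nu p + \sum_i p i * (f i ^+ 2 / 2 + `|f i| ^+ 3).
Proof.
move=> nup p0 p1 pf f1; apply: le_trans (donsker_varadhan _ nup p0 p1) _.
rewrite lerD2l.
set S := \sum_i p i * (_ + _).
have S0 : 0 <= S.
  apply: sumr_ge0 => i _; rewrite mulr_ge0 ?(ltW (p0 i))// addr_ge0//.
    by rewrite mulr_ge0// sqr_ge0.
apply: le_trans (_ : ln (1 + S) <= _); last by apply: le_ln1Dx; lra.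
have h : \sum_i p i * expR (f i) <= 1 + S.
  have -> : 1 + S = \sum_i (p i + p i * f i + p i * (f i ^+ 2 / 2 + `|f i| ^+ 3)).
    by rewrite !big_split/= p1 pf addr0.
  rewrite ler_sum// => i _.
  have := expR_le_norm3 (f1 i); have := p0 i; nra.
have [le0|gt0] := lerP (\sum_i p i * expR (f i)) 0.
  by rewrite ln0//; apply: ln_ge0; lra.
by rewrite ler_ln ?posrE//; lra.
Qed.

(** Donsker-Varadhan for the centred sign of nu - p, scaled by s, gives s L - 6 s^2 <= kl, and s = L
    / 12 maximises the left side; hence 24 instead of the sharp 2. Only the order of magnitude
    matters later. *)
Lemma pinsker nu p : prob nu -> (forall i, 0 < p i) -> \sum_i p i = 1 ->
  l1 (fun i => nu i - p i) ^+ 2 <= 24 * kl nu p.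
Proof.
move=> nup p0 p1.
have pp : prob p by split=> // i; exact: ltW.
have L2 := l1_sub_prob nup pp; set L := l1 _ in L2 *.
have L0 : 0 <= L by exact: l1_ge0.
pose s := L / 12.
have s0 : 0 <= s by rewrite /s; lra.
have s1 : s <= 6^-1 by rewrite /s; lra.
pose g i := Num.sg (nu i - p i).
pose m := \sum_i p i * g i.
have g1 i : `|g i| <= 1 by rewrite normr_sg; case: (_ == _).
have m1 : `|m| <= 1 by exact: norm_mean_le.
pose f i : R := s * (g i - m).
have h : \sum_i nu i * f i = s * L.
  transitivity (s * \sum_i (nu i - p i) * g i).
    rewrite mulr_sumr /f.
    transitivity (\sum_i (s * (nu i * g i) - nu i * (s * m))).
      by apply: eq_bigr => i _; ring.
    rewrite sumrB -mulr_suml (nup.2) mul1r.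
    transitivity (\sum_i s * (nu i * g i) - \sum_i s * (p i * g i)).
      by rewrite -[X in _ = _ - X]mulr_sumr.
    by rewrite -sumrB; apply: eq_bigr => i _; ring.
  by congr (_ * _); apply: eq_bigr => i _; rewrite mulrC -normrEsg.
have fb i : `|f i| <= 2 * s.
  rewrite normrM (ger0_norm s0) mulrC ler_wpM2r//.
  by apply: le_trans (ler_normB _ _) _; have := g1 i; lra.
have pf : \sum_i p i * f i = 0.
  transitivity (\sum_i (s * (p i * g i) - s * m * p i)).
    by apply: eq_bigr => i _; rewrite /f; ring.
  by rewrite sumrB -!mulr_sumr p1 mulr1 subrr.
have := @kl_lower nu p f nup p0 p1 pf; rewrite h => /(_ _).
have f1 i : `|f i| <= 1 by have := fb i; lra.
move=> /(_ f1).
have : \sum_i p i * (f i ^+ 2 / 2 + `|f i| ^+ 3) <= 6 * s ^+ 2.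
  apply: ler_mean => // i.
  rewrite -[f i ^+ 2]real_normK ?num_real//.
  have := fb i; have := f1 i; have := normr_ge0 (f i); move: (`|f i|) => x x0 xl x1.
  have x2 : x ^+ 2 <= 4 * s ^+ 2 by nra.
  have : x ^+ 3 <= x ^+ 2 by rewrite exprS ler_piMl ?sqr_ge0.
  by lra.
by rewrite /s; nra.
Qed.
End entropy.

(** * Trilinear functionals of a finite law *)

Section trilinear.
Variables (R : realType) (I : finType) (kap : I -> I -> I -> R).
Implicit Types (nu p q f u a b c : I -> R).
Hypothesis kap1 : forall i j k, `|kap i j k| <= 1.

Definition tri a b c := \sum_i \sum_j \sum_k a i * b j * c k * kap i j k.

(** The 1/2 stands for the integral of F_n against itself, which has this value up to ties. *)
Definition tau nu := tri nu nu nu - 1 / 2.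

Lemma tauE nu : tau nu = tri nu nu nu - 1 / 2. Proof. by []. Qed.

(** The gradient of [tau] at [p], with one term per slot of the kernel; up to centring, its
    influence function. *)
Definition proj p k :=
  \sum_i \sum_j p i * p j * (kap k i j + kap i k j + kap i j k).

Lemma eq_tri a b c a' b' c' : a =1 a' -> b =1 b' -> c =1 c' ->
  tri a b c = tri a' b' c'.
Proof.
move=> ea eb ec; apply: eq_bigr => i _; apply: eq_bigr => j _; apply: eq_bigr => k _.
by rewrite ea eb ec.
Qed.

Lemma tri_le a b c : `|tri a b c| <= l1 a * l1 b * l1 c.
Proof.
apply: le_trans (ler_norm_sum _ _ _) _.
rewrite -mulrA {1}/l1 mulr_suml ler_sum// => i _.
apply: le_trans (ler_norm_sum _ _ _) _.
rewrite {1}/l1 mulr_suml mulr_sumr ler_sum// => j _.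
apply: le_trans (ler_norm_sum _ _ _) _.
rewrite mulrA /l1 mulr_sumr ler_sum// => k _.
by rewrite !normrM ler_piMr// !mulr_ge0.
Qed.

Lemma triDl a a' b c : tri (fun i => a i + a' i) b c = tri a b c + tri a' b c.
Proof.
rewrite /tri -big_split; apply: eq_bigr => i _ /=.
rewrite -big_split; apply: eq_bigr => j _ /=.
by rewrite -big_split; apply: eq_bigr => k _ /=; ring.
Qed.

Lemma triDm a b b' c : tri a (fun i => b i + b' i) c = tri a b c + tri a b' c.
Proof.
rewrite /tri -big_split; apply: eq_bigr => i _ /=.
rewrite -big_split; apply: eq_bigr => j _ /=.
by rewrite -big_split; apply: eq_bigr => k _ /=; ring.
Qed.

Lemma triDr a b c c' : tri a b (fun i => c i + c' i) = tri a b c + tri a b c'.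
Proof.
rewrite /tri -big_split; apply: eq_bigr => i _ /=.
rewrite -big_split; apply: eq_bigr => j _ /=.
by rewrite -big_split; apply: eq_bigr => k _ /=; ring.
Qed.

Lemma sum_proj u p :
  \sum_k u k * proj p k = tri u p p + tri p u p + tri p p u.
Proof.
have -> : tri p u p = \sum_j \sum_i \sum_k p i * u j * p k * kap i j k.
  exact: exchange_big.
have -> : tri p p u = \sum_k \sum_i \sum_j p i * p j * u k * kap i j k.
  rewrite [RHS]exchange_big/=; apply: eq_bigr => i _; exact: exchange_big.
rewrite /tri -!big_split/=; apply: eq_bigr => k _.
rewrite /proj mulr_sumr -!big_split/=; apply: eq_bigr => i _.
rewrite mulr_sumr -!big_split/=; apply: eq_bigr => j _.
by ring.
Qed.

Lemma proj_le3 p k : prob p -> `|proj p k| <= 3.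
Proof.
move=> [p0 p1]; rewrite /proj.
rewrite (_ : \sum_i _ = \sum_i p i * (\sum_j p j * (kap k i j + kap i k j + kap i j k))).
  apply: norm_mean_le => // i; apply: norm_mean_le => // j.
  apply: le_trans (ler_normD _ _) _.
  have := ler_normD (kap k i j) (kap i k j).
  by have := kap1 k i j; have := kap1 i k j; have := kap1 i j k; lra.
by apply: eq_bigr => i _; rewrite mulr_sumr; apply: eq_bigr => j _; rewrite mulrA.
Qed.

(** Multilinearity leaves three terms quadratic in [u] and one cubic; l1 u <= 2 turns 3 L^2 + L^3
    into 5 L^2. *)
Lemma tau_expand p u : prob p -> l1 u <= 2 ->
  `|tau (fun i => p i + u i) - tau p - \sum_i u i * proj p i| <= 5 * l1 u ^+ 2.
Proof.
move=> pp u2; rewrite sum_proj /tau !triDl !triDm !triDr.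
have -> : forall x y z w a b c d : R,
  x + y + (z + w) + (a + b + (c + d)) - 1 / 2 - (x - 1/2) - (a + z + y) = w + b + c + d.
  by move=> *; ring.
have := tri_le p u u; have := tri_le u p u; have := tri_le u u p; have := tri_le u u u.
rewrite (l1_prob pp) !(mul1r, mulr1) => h1 h2 h3 h4.
have L0 := l1_ge0 u.
apply: le_trans (ler_normD _ _) _; have := ler_normD (tri p u u + tri u p u) (tri u u p).
have := ler_normD (tri p u u) (tri u p u).
by nra.
Qed.

(** Replacing [p] by [nu] one argument at a time produces six terms, each containing [u] and nu - p
    once and a probability in the third slot. *)
Lemma proj_lipschitz u nu p : prob p -> prob nu ->
  `|\sum_i u i * proj nu i - \sum_i u i * proj p i| <= 6 * l1 u * l1 (fun i => nu i - p i).
Proof.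
move=> pp nup; rewrite !sum_proj.
set d := fun i => nu i - p i.
have e : nu =1 (fun i => p i + d i) by move=> i; rewrite /d addrCA subrr addr0.
have e1 : tri u nu nu = tri u p p + tri u d p + tri u nu d.
  by rewrite (eq_tri (frefl u) (frefl nu) e) triDr (eq_tri (frefl u) e (frefl p)) triDm.
have e2 : tri nu u nu = tri p u p + tri d u p + tri nu u d.
  by rewrite (eq_tri (frefl nu) (frefl u) e) triDr (eq_tri e (frefl u) (frefl p)) triDl.
have e3 : tri nu nu u = tri p p u + tri d p u + tri nu d u.
  by rewrite (eq_tri (frefl nu) e (frefl u)) triDm (eq_tri e (frefl p) (frefl u)) triDl.
have := tri_le u d p; have := tri_le u nu d; have := tri_le d u p.
have := tri_le nu u d; have := tri_le d p u; have := tri_le nu d u.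
rewrite (l1_prob pp) (l1_prob nup) !(mul1r, mulr1).
set D := l1 d; set L := l1 u.
rewrite e1 e2 e3 !ler_norml => /andP[? ?] /andP[? ?] /andP[? ?] /andP[? ?] /andP[? ?] /andP[? ?].
by apply/andP; split; lra.
Qed.

Lemma tau_le nu p : prob p -> prob nu ->
  tau nu <= tau p + \sum_i (nu i - p i) * proj p i + 5 * l1 (fun i => nu i - p i) ^+ 2.
Proof.
move=> pp nup; have := tau_expand pp (l1_sub_prob nup pp).
rewrite (_ : tau (fun i => _) = tau nu); last first.
  by rewrite /tau; congr (_ - _); apply: eq_tri => i; rewrite addrCA subrr addr0.
by rewrite ler_norml => /andP[_]; lra.
Qed.

End trilinear.

(** * Convexity of the relative entropy and control of single masses *)

Section convexity.
Variables (R : realType) (I : finType).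
Implicit Types (nu p q m : I -> R).

(** The gap between the two sides is kl nu m. *)
Lemma cross_entropy_le nu p m : prob nu -> prob m -> (forall i, 0 < p i) ->
  (forall i, 0 < m i) -> \sum_i nu i * ln (m i / p i) <= kl nu p.
Proof.
move=> nup mp p0 m0; have := kl_ge0 nup m0 mp.2.
rewrite -subr_ge0 => h; rewrite -subr_ge0 (le_trans h)// subr0 /kl -sumrB.
apply: ler_sum => i _.
have [->|ni] := eqVneq (nu i) 0; first by rewrite !mul0r subrr.
have n0 : 0 < nu i by rewrite lt0r ni prob_ge0.
by rewrite !ln_div ?posrE//; lra.
Qed.

Lemma prob_mix nu q (e : R) : prob nu -> prob q -> 0 <= e <= 1 ->
  prob (fun i => (1 - e) * nu i + e * q i).
Proof.
move=> [n0 n1] [q0 q1] /andP[e0 e1]; split=> [i|].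
  by rewrite addr_ge0// mulr_ge0//; lra.
by rewrite big_split/= -!mulr_sumr n1 q1; lra.
Qed.

(** The entropy of the mixture splits into two cross entropies against the mixture itself, each at
    most the entropy of its own component. *)
Lemma kl_mix nu q p (e : R) : prob nu -> prob q -> (forall i, 0 < p i) ->
  (forall i, 0 < q i) -> 0 < e <= 1 ->
  kl (fun i => (1 - e) * nu i + e * q i) p <= (1 - e) * kl nu p + e * kl q p.
Proof.
move=> nup qp p0 q0 /andP[e0 e1].
set m := fun i => _.
have mp : prob m by apply: prob_mix => //; rewrite (ltW e0).
have m0 i : 0 < m i.
  by rewrite /m ltr_pwDr ?mulr_gt0// mulr_ge0 ?prob_ge0//; lra.
apply: (@le_trans _ _ ((1 - e) * \sum_i nu i * ln (m i / p i) +
    e * \sum_i q i * ln (m i / p i))).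
  by rewrite !mulr_sumr -big_split/= /kl ler_sum// => i _; rewrite {1}/m; lra.
by rewrite lerD// ler_wpM2l ?cross_entropy_le//; lra.
Qed.

(** Donsker-Varadhan for r times the indicator of one point. With b = exp(-2/d) and r = 2/d, an
    entropy at most 1 forces every mass of [nu] below d. *)
Lemma prob_kl_bound nu p (b r : R) i : prob nu -> (forall i, 0 < p i) -> \sum_i p i = 1 ->
  (forall i, p i <= b) -> r * nu i <= kl nu p + b * expR r.
Proof.
move=> nup p0 p1 pb.
pose f j : R := if j == i then r else 0.
have := @donsker_varadhan _ _ nu p f nup p0 p1.
rewrite (bigD1 i)//= big1 ?addr0 /f; last by move=> j /negbTE ->; rewrite mulr0.
rewrite eqxx mulrC => /le_trans; apply; rewrite lerD2l.
have bp : 0 < b by apply: lt_le_trans (p0 i) (pb i).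
have e0 := expR_gt0 r.
apply: (@le_trans _ _ (ln (1 + b * expR r))); last first.
  by apply: le_ln1Dx; rewrite (@lt_trans _ _ 0)// mulr_gt0.
have Z : 0 < \sum_j p j * expR (if j == i then r else 0).
  by rewrite (bigD1 i)//= ltr_pwDl ?mulr_gt0 ?expR_gt0// sumr_ge0// => j _;
     rewrite mulr_ge0 ?expR_ge0// ltW.
have be : 0 < b * expR r by rewrite mulr_gt0.
rewrite ler_ln ?posrE ?addr_gt0//.
rewrite -p1 (bigD1 i)//= eqxx [in leRHS](bigD1 i)//=.
rewrite (eq_bigr (fun j => p j)); last by move=> j /negbTE ->; rewrite expR0 mulr1.
have : p i * expR r <= b * expR r by rewrite ler_wpM2r.
have := p0 i; set S := \sum_(_ | _) _; lra.
Qed.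

End convexity.

(** * Entropy against first-order gain of the functional near the reference law *)

Section local_rate.
Variables (R : realType) (I : finType) (kap : I -> I -> I -> R) (p : I -> R).
Hypothesis kap1 : forall i j k, `|kap i j k| <= 1.
Hypothesis p0 : forall i, 0 < p i.
Hypothesis p1 : \sum_i p i = 1.
Implicit Types (nu q f u : I -> R) (s e : R).

Let pp : prob p. Proof. by split=> // i; exact: ltW. Qed.

Local Notation tau := (tau kap).
Local Notation proj := (proj kap).

Definition cproj i := proj p i - \sum_j p j * proj p j.

Definition cvar := \sum_i p i * cproj i ^+ 2.

(** A linear tilt, which needs no normalisation because [cproj] has mean zero and agrees with the
    exponential tilt to first order in [s]. *)
Definition tilt s i := p i * (1 + s * cproj i).

Lemma cproj_le i : `|cproj i| <= 6.
Proof.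
apply: le_trans (ler_normB _ _) _.
have := @norm_mean_le _ _ p (proj p) 3 pp (fun i => proj_le3 kap1 i pp).
by have := proj_le3 kap1 i pp; lra.
Qed.

Lemma cproj_mean : \sum_i p i * cproj i = 0.
Proof.
rewrite /cproj; under eq_bigr do rewrite mulrBr.
by rewrite sumrB -mulr_suml p1 mul1r subrr.
Qed.

Lemma cvar_ge0 : 0 <= cvar.
Proof. by rewrite sumr_ge0// => i _; rewrite mulr_ge0 ?sqr_ge0// ltW. Qed.

Lemma cvar_le : cvar <= 36.
Proof.
apply: ler_mean => // i; have := cproj_le i; have := normr_ge0 (cproj i).
by rewrite -[_ ^+ 2]real_normK ?num_real//; nra.
Qed.

(** Since |cproj| <= 6, the range s <= 1/12 keeps the tilting factor between 1/2 and 3/2, where the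
    expansion of x ln x is available. *)
Lemma scproj_le s i : 0 <= s <= 1 / 12 -> `|s * cproj i| <= 1 / 2.
Proof.
move=> /andP[s0 s1]; rewrite normrM ger0_norm//.
by have := cproj_le i; have := normr_ge0 (cproj i); nra.
Qed.

Lemma tilt_gt s i : 0 <= s <= 1 / 12 -> p i / 2 <= tilt s i.
Proof.
move=> /(scproj_le i); rewrite ler_norml => /andP[h _].
by have := p0 i; rewrite /tilt; nra.
Qed.

Lemma tilt_gt0 s i : 0 <= s <= 1 / 12 -> 0 < tilt s i.
Proof. by move=> /(tilt_gt i); apply: lt_le_trans; rewrite divr_gt0. Qed.

Lemma tilt_le s i : 0 <= s <= 1 / 12 -> tilt s i <= 2 * p i.
Proof.
move=> /(scproj_le i); rewrite ler_norml => /andP[_ h].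
by have := p0 i; rewrite /tilt; nra.
Qed.

Lemma prob_tilt s : 0 <= s <= 1 / 12 -> prob (tilt s).
Proof.
move=> s01; split=> [i|]; first exact/ltW/tilt_gt0.
rewrite /tilt; under eq_bigr do rewrite mulrDr mulr1 mulrCA.
by rewrite big_split/= -mulr_sumr cproj_mean p1; lra.
Qed.

Lemma kl_tilt s : 0 <= s <= 1 / 12 -> kl (tilt s) p <= s ^+ 2 * cvar / 2 + 216 * s ^+ 3.
Proof.
move=> s01; have /andP[s0 s1] := s01.
apply: (@le_trans _ _ (\sum_i (s * (p i * cproj i) + s ^+ 2 / 2 * (p i * cproj i ^+ 2)
    + p i * (216 * s ^+ 3)))).
  apply: ler_sum => i _; rewrite /tilt [X in ln X](_ : _ = 1 + s * cproj i).
    2: by rewrite mulrAC mulfV ?gt_eqF// mul1r.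
  have h := scproj_le i s01; have := @xlnx_approx R (s * cproj i).
  have {}h : - 2^-1 <= s * cproj i by move: h; rewrite ler_norml => /andP[]; lra.
  move=> /(_ h); rewrite ler_norml => /andP[_].
  have c3 : `|cproj i| ^+ 3 <= 216.
    rewrite (_ : 216 = 6 ^+ 3); last by rewrite -natrX.
    by rewrite lerXn2r ?nnegrE ?cproj_le.
  have : `|s * cproj i| ^+ 3 <= 216 * s ^+ 3.
    by rewrite normrM (ger0_norm s0) exprMn mulrC ler_wpM2r// exprn_ge0.
  set L := ln _; set c := cproj i => ? ?.
  have h' : (1 + s * c) * L <= s * c + (s * c) ^+ 2 / 2 + 216 * s ^+ 3 by lra.
  by have := ler_wpM2l (ltW (p0 i)) h'; rewrite exprMn; lra.
rewrite !big_split/= -!mulr_sumr -mulr_suml p1 cproj_mean -/cvar.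
by lra.
Qed.

Lemma l1_tilt s : 0 <= s -> l1 (fun i => tilt s i - p i) <= 6 * s.
Proof.
move=> s0; rewrite (_ : l1 _ = \sum_i p i * (s * `|cproj i|)); last first.
  apply: eq_bigr => i _; rewrite (_ : tilt s i - p i = p i * (s * cproj i)).
    by rewrite !normrM (ger0_norm s0) gtr0_norm.
  by rewrite /tilt; ring.
by apply: ler_mean => // i; rewrite mulrC ler_wpM2r// cproj_le.
Qed.

Lemma sum_tilt_proj s : \sum_i (tilt s i - p i) * proj p i = s * cvar.
Proof.
set M := \sum_j p j * proj p j.
have e i : proj p i = cproj i + M by rewrite /cproj subrK.
transitivity (\sum_i (s * (p i * cproj i ^+ 2) + s * M * (p i * cproj i))).
  by apply: eq_bigr => i _; rewrite /tilt e; ring.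
by rewrite big_split/= -!mulr_sumr cproj_mean mulr0 addr0.
Qed.

(** The variance is the derivative of [tau] along the tilt; 180 = 5 * 6^2 comes from the remainder
    of [tau_expand] at l1 distance 6 s. *)
Lemma tau_tilt s : 0 <= s <= 1 / 12 ->
  tau p + s * cvar - 180 * s ^+ 2 <= tau (tilt s).
Proof.
move=> s01; have /andP[s0 s1] := s01.
have := tau_expand kap1 pp (l1_sub_prob (prob_tilt s01) pp).
rewrite sum_tilt_proj (_ : tau (fun i => _) = tau (tilt s)); last first.
  by rewrite !tauE; congr (_ - _); apply: eq_tri => i; rewrite addrCA subrr addr0.
rewrite ler_norml => /andP[+ _].
have := l1_tilt s0; have := l1_ge0 (fun i => tilt s i - p i).
by set L := l1 _ => *; nra.
Qed.

(** Donsker-Varadhan for s * cproj handles the linear part of [tau]; the quadratic remainder 5 L^2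
    is at most 120 kl by [pinsker], hence the factor 1 + 120 s. *)
Lemma rate_lower nu s : prob nu -> 0 <= s <= 1 / 12 ->
  s * (tau nu - tau p) <= kl nu p * (1 + 120 * s) + s ^+ 2 * cvar / 2 + 216 * s ^+ 3.
Proof.
move=> nup s01; have /andP[s0 s1] := s01.
have h1 := tau_le kap1 pp nup; have h2 := pinsker nup p0 p1.
have e : \sum_i (nu i - p i) * proj p i = \sum_i nu i * cproj i.
  rewrite /cproj; under [RHS]eq_bigr do rewrite mulrBr.
  rewrite sumrB -mulr_suml nup.2 mul1r -sumrB.
  by apply: eq_bigr => i _; ring.
have := @kl_lower _ _ nu p (fun i => s * cproj i) nup p0 p1.
have -> : \sum_i p i * (s * cproj i) = 0.
  by under eq_bigr do rewrite mulrCA; rewrite -mulr_sumr cproj_mean mulr0.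
have -> : \sum_i nu i * (s * cproj i) = s * \sum_i nu i * cproj i.
  by rewrite mulr_sumr; apply: eq_bigr => i _; rewrite mulrCA.
have sc1 i : `|s * cproj i| <= 1 by apply: le_trans (scproj_le i s01) _; lra.
move=> /(_ erefl sc1).
have : \sum_i p i * ((s * cproj i) ^+ 2 / 2 + `|s * cproj i| ^+ 3) <=
    s ^+ 2 * cvar / 2 + 216 * s ^+ 3.
  apply: (@le_trans _ _ (\sum_i (s ^+ 2 / 2 * (p i * cproj i ^+ 2)
    + p i * (216 * s ^+ 3)))).
    apply: ler_sum => i _.
    have c3 : `|cproj i| ^+ 3 <= 216.
      rewrite (_ : 216 = 6 ^+ 3); last by rewrite -natrX.
      by rewrite lerXn2r ?nnegrE ?cproj_le.
    have : `|s * cproj i| ^+ 3 <= 216 * s ^+ 3.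
      by rewrite normrM (ger0_norm s0) exprMn mulrC ler_wpM2r// exprn_ge0.
    by have := p0 i; rewrite exprMn; nra.
  rewrite !big_split/= -!mulr_sumr -mulr_suml p1 -/cvar.
  by lra.
rewrite -e; move: (\sum_i (nu i - p i) * _) h1 => S h1 h3 h4.
have : s * (tau nu - tau p) <= s * (S + 120 * kl nu p) by rewrite ler_wpM2l//; lra.
by lra.
Qed.

(** A near-minimiser may sit on the boundary of the constraint and vanish at some points, whereas
    the lower bound for probabilities needs a positive law with room around it. A small mixture with
    the fixed tilt s = 1/12, whose entropy is at most 1, provides both. *)
Lemma rate_perturb nu e : prob nu -> 24 * kl nu p <= (cvar / 144) ^+ 2 -> 0 < e <= 1 ->
  exists q, [/\ prob q, forall i, 0 < q i, kl q p <= kl nu p + e &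
    tau nu + e * cvar / 24 - 20 * e ^+ 2 <= tau q].
Proof.
move=> nup Kn /andP[e0 e1].
have s01 : 0 <= (1 / 12 : R) <= 1 / 12 by apply/andP; split; lra.
set t := tilt (1 / 12).
have tp : prob t by exact: prob_tilt.
have t0 i : 0 < t i by exact: tilt_gt0.
have e01 : 0 < e <= 1 by rewrite e0.
have e01' : 0 <= e <= 1 by rewrite (ltW e0).
exists (fun i => (1 - e) * nu i + e * t i); split.
- exact: prob_mix.
- by move=> i; have := t0 i; have := prob_ge0 i nup; nra.
- apply: le_trans (kl_mix nup tp p0 t0 e01) _.
  have := kl_tilt s01; rewrite -/t; have := kl_ge0 nup p0 p1.
  have := cvar_le; rewrite !expr2 !exprS expr0 !mulr1 => h1 h2 h3.
  have : kl t p <= 1 by lra.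
  by nra.
- pose u i := e * (t i - nu i).
  have lu : l1 u <= 2 * e.
    by rewrite /u l1Z (ger0_norm (ltW e0)) mulrC ler_wpM2r ?(ltW e0) ?l1_sub_prob.
  have u2 : l1 u <= 2 by lra.
  have := tau_expand kap1 nup u2.
  rewrite (_ : tau (fun i => _) = tau (fun i => (1 - e) * nu i + e * t i)); last first.
    by rewrite !tauE; congr (_ - _); apply: eq_tri => i; rewrite /u; ring.
  rewrite ler_norml => /andP[+ _].
  have l0 := l1_ge0 u.
  have -> : \sum_i u i * proj nu i = e * (\sum_i (t i - p i) * proj nu i
      - \sum_i (nu i - p i) * proj nu i).
    by rewrite -sumrB mulr_sumr; apply: eq_bigr => i _; rewrite /u; ring.
  have := proj_lipschitz kap1 (fun i => t i - p i) pp nup.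
  rewrite sum_tilt_proj.
  have := @l1_tilt (1 / 12) ltac:(lra); rewrite -/t => lt.
  have lt0 := l1_ge0 (fun i => t i - p i).
  have h2 := pinsker nup p0 p1.
  set L := l1 _ in h2 *.
  have L0 : 0 <= L by exact: l1_ge0.
  have L1 : L <= cvar / 144.
    rewrite -(@ler_pXn2r _ 2)// ?nnegrE//; last by rewrite divr_ge0 ?cvar_ge0.
    exact: le_trans h2 Kn.
  have : `|\sum_i (nu i - p i) * proj nu i| <= 3 * L.
    apply: le_trans (ler_norm_sum _ _ _) _; rewrite mulr_sumr ler_sum// => i _.
    by rewrite normrM mulrC ler_wpM2r// proj_le3.
  rewrite !ler_norml => /andP[_ h3] /andP[h4 _] h5.
  move: h3 h4 h5; set A := \sum_i _; set B := \sum_i _; set T := tau (fun i => _).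
  move=> h3 h4 h5.
  have h6 : 6 * l1 (fun i => t i - p i) * L <= 3 * L by nra.
  (* The gain per unit of [e] is at least cvar/12 - 6 L: 3 L for the change of gradient between p
     and nu, 3 L for the drift nu - p. As L <= cvar/144, this leaves cvar/24. *)
  have : e * (cvar / 24) <= e * (B - A) by rewrite ler_wpM2l ?(ltW e0)//; lra.
  by nra.
Qed.

End local_rate.

(** * Large deviations of empirical laws on a finite set *)

Section sampling.
Variables (R : realType) (I : finType).
Implicit Types (nu p q f r : I -> R) (F G : seq I -> R) (n : nat) (c : seq I).

(** The recursion mirrors that of [iid_int], so that integrals of binned samples match it step by
    step. *)
Fixpoint ex p n F : R :=
  if n is n'.+1 then \sum_k p k * ex p n' (fun c => F (k :: c)) else F [::].

Definition pr p n (A : pred (seq I)) := ex p n (fun c => (A c)%:R).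

Definition freq c k : R := (count_mem k c)%:R / (size c)%:R.

Lemma ex_le p n F G : (forall k, 0 <= p k) ->
  (forall c, size c = n -> F c <= G c) -> ex p n F <= ex p n G.
Proof.
move=> p0; elim: n F G => [|n IH] F G FG /=; first exact: FG.
apply: ler_sum => k _; apply: ler_wpM2l => //; apply: IH => c cn.
by apply: FG; rewrite /= cn.
Qed.

Lemma eq_ex p n F G : (forall c, size c = n -> F c = G c) -> ex p n F = ex p n G.
Proof.
elim: n F G => [|n IH] F G FG /=; first exact: FG.
apply: eq_bigr => k _; congr (_ * _); apply: IH => c cn.
by apply: FG; rewrite /= cn.
Qed.

Lemma exZ p n F (a : R) : ex p n (fun c => a * F c) = a * ex p n F.
Proof.
elim: n F => [|n IH] F //=; rewrite mulr_sumr; apply: eq_bigr => k _.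
by rewrite IH mulrCA.
Qed.

Lemma ex_sum p n (J : Type) (s : seq J) (F : J -> seq I -> R) :
  ex p n (fun c => \sum_(j <- s) F j c) = \sum_(j <- s) ex p n (F j).
Proof.
elim: n F => [|n IH] F //=.
rewrite exchange_big; apply: eq_bigr => k _.
by rewrite IH mulr_sumr.
Qed.

Lemma exD p n F G : ex p n (fun c => F c + G c) = ex p n F + ex p n G.
Proof.
elim: n F G => [|n IH] F G //=; rewrite -big_split; apply: eq_bigr => k _ /=.
by rewrite IH mulrDr.
Qed.

Lemma ex_cst p n (a : R) : \sum_k p k = 1 -> ex p n (fun=> a) = a.
Proof.
move=> p1; elim: n => [|n IH] //=.
by under eq_bigr do rewrite IH; rewrite -mulr_suml p1 mul1r.
Qed.

Lemma ex_ge0 p n F : (forall k, 0 <= p k) -> (forall c, size c = n -> 0 <= F c) ->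
  0 <= ex p n F.
Proof.
move=> p0; elim: n F => [|n IH] F F0 /=; first exact: F0.
apply: sumr_ge0 => k _; apply: mulr_ge0 => //; apply: IH => c cn.
by apply: F0; rewrite /= cn.
Qed.

(** Change of measure in which [q] may vanish, as it does when it is the empirical law of a sequence
    missing some letters: sequences using such a letter contribute nothing. *)
Lemma ex_change p q r n F : (forall k, q k != 0 -> p k = q k * r k) ->
  (forall c, F c != 0 -> {in c, forall k, q k != 0}) ->
  ex p n F = ex q n (fun c => F c * \prod_(k <- c) r k).
Proof.
move=> pqr; elim: n F => [|n IH] F F0 /=; first by rewrite big_nil mulr1.
apply: eq_bigr => k _.
have [qk|qk] := eqVneq (q k) 0.
  rewrite qk mul0r (_ : ex _ _ _ = 0) ?mulr0//.
  rewrite -[RHS](_ : ex p n (fun c => 0 * F (k :: c)) = 0); last by rewrite exZ mul0r.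
  apply: eq_ex => c _; rewrite mul0r; apply/eqP; apply: contraT => /F0.
  by move=> /(_ k (mem_head _ _)); rewrite qk eqxx.
rewrite IH; last by move=> c /F0 h j jc; apply: h; rewrite inE jc orbT.
rewrite pqr// -mulrA; congr (_ * _); rewrite -exZ; apply: eq_ex => c _.
by rewrite big_cons mulrCA.
Qed.

Lemma sum_count c f : \sum_(x <- c) f x = \sum_k (count_mem k c)%:R * f k.
Proof.
elim: c => [|x c IH]; first by rewrite big_nil big1// => k _; rewrite mul0r.
rewrite big_cons IH (bigD1 x)//= [in RHS](bigD1 x)//= eqxx natrD mulrDl mul1r addrA.
congr (_ + _); apply: eq_bigr => k kx.
by rewrite eq_sym (negbTE kx) add0n.
Qed.

Lemma sum_freq c f : (0 < size c)%N ->
  \sum_(x <- c) f x = (size c)%:R * \sum_k freq c k * f k.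
Proof.
move=> c0; rewrite sum_count mulr_sumr; apply: eq_bigr => k _.
rewrite /freq; field; rewrite pnatr_eq0; lia.
Qed.

Lemma prob_freq c : (0 < size c)%N -> prob (freq c).
Proof.
move=> c0; split=> [k|]; first by rewrite divr_ge0.
have := sum_freq (fun=> 1) c0.
under [in RHS]eq_bigr do rewrite mulr1.
rewrite big_const_seq count_predT iter_addr_0 -mulr_natr mul1r => h.
have s0 : (size c)%:R != 0 :> R by rewrite pnatr_eq0; lia.
by apply: (mulfI s0); rewrite -h mulr1.
Qed.

Lemma freq_gt0 c k : k \in c -> 0 < freq c k.
Proof.
move=> kc; rewrite divr_gt0// ltr0n; first by rewrite -has_count has_pred1.
by case: c kc.
Qed.

Lemma prod_likelihood c nu p : (0 < size c)%N -> (forall k, 0 < p k) ->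
  {in c, forall k, 0 < nu k} ->
  \prod_(k <- c) (p k / nu k) = expR (- (size c)%:R * \sum_k freq c k * ln (nu k / p k)).
Proof.
move=> c0 p0 nc; rewrite mulNr -sum_freq// -sumrN expR_sum big_seq [RHS]big_seq.
apply: eq_bigr => k kc; rewrite -lnV ?posrE ?divr_gt0 ?nc//.
by rewrite lnK ?posrE ?invr_gt0 ?divr_gt0 ?nc// invf_div.
Qed.

(* The method of types: under i.i.d. sampling from [freq c] itself the type class
   of [c] has probability at most one. *)
Lemma pr_type_le p c : (0 < size c)%N -> prob p -> (forall k, 0 < p k) ->
  pr p (size c) (fun c' => perm_eq c c') <=
  expR (- (size c)%:R * kl (freq c) p).
Proof.
move=> c0 pp p0; have fp := prob_freq c0.
rewrite /pr (@ex_change p (freq c) (fun k => p k / freq c k)).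
- rewrite -[leRHS](@ex_cst (freq c) (size c)) ?fp.2//.
  apply: ex_le => [k|c' c'n]; first by case: fp.
  have [pc|] := boolP (perm_eq c c'); last by rewrite mul0r expR_ge0.
  rewrite mul1r -(perm_big _ pc)/= prod_likelihood//.
  by move=> k kc; exact: freq_gt0.
- by move=> k fk; rewrite mulrC divfK.
- move=> c'; case: (boolP (perm_eq c c')) => [pc _ k kc'|_]; last by rewrite eqxx.
  by rewrite gt_eqF// freq_gt0// (perm_mem pc).
Qed.

(** There are at most (n+1)^|I| count vectors, and each type class that meets the event has
    probability at most exp(-n a) by [pr_type_le]. *)
Lemma pr_le_card p n (A : pred (seq I)) (a : R) : (0 < n)%N -> prob p -> (forall k, 0 < p k) ->
  (forall c, size c = n -> A c -> a <= kl (freq c) p) ->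
  pr p n A <= n.+1%:R ^+ #|I| * expR (- n%:R * a).
Proof.
move=> n0 pp p0 Aa.
pose cnt c : {ffun I -> 'I_n.+1} := [ffun k => inord (count_mem k c)].
have cnt_perm c c' : size c = n -> size c' = n -> cnt c = cnt c' -> perm_eq c c'.
  move=> cn c'n /ffunP h; apply/allP => k _ /=.
  have := congr1 val (h k); rewrite /cnt !ffunE /= !inordK ?ltnS.
  - by move=> ->.
  - by rewrite -c'n count_size.
  - by rewrite -cn count_size.
pose T (N : {ffun I -> 'I_n.+1}) c := (A c && (cnt c == N)).
apply: (@le_trans _ _ (ex p n (fun c => \sum_(N : {ffun I -> 'I_n.+1}) (T N c)%:R))).
  apply: ex_le => [k|c cn]; first by case: pp.
  rewrite (bigD1 (cnt c))//= /T eqxx andbT lerDl sumr_ge0// => N _.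
rewrite ex_sum.
apply: (@le_trans _ _ (\sum_(N : {ffun I -> 'I_n.+1}) expR (- n%:R * a))); last first.
  rewrite sumr_const card_ffun card_ord.
  by rewrite -[leLHS]mulr_natl natrX.
apply: ler_sum => N _.
have [[c [cn Ac cN]]|nex] := pselect (exists c, [/\ size c = n, A c & cnt c = N]).
  apply: (@le_trans _ _ (expR (- (size c)%:R * kl (freq c) p))); last first.
    by rewrite ler_expR cn !mulNr lerN2 ler_wpM2l// Aa.
  apply: le_trans (pr_type_le _ pp p0); last by rewrite cn.
  rewrite /pr cn; apply: ex_le => [k|c' c'n]; first by case: pp.
  rewrite /T; case: (A c') => //=; case: eqP => //= e.
  by rewrite (cnt_perm c c')// cN.
rewrite (@le_trans _ _ 0) ?expR_ge0//.
rewrite -(_ : ex p n (fun c => 0 * 1) = 0); last by rewrite exZ mul0r.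
apply: ex_le => [k|c cn]; first by case: pp.
rewrite mul0r /T; case: (boolP (A c)) => //= Ac; case: eqP => //= e.
by exfalso; apply: nex; exists c.
Qed.

(** The shift [a] lets the induction close: the first letter is absorbed into it. *)
Lemma ex_sqr_sum p n f (a : R) : \sum_k p k = 1 -> \sum_k p k * f k = 0 ->
  ex p n (fun c => (a + \sum_(x <- c) f x) ^+ 2) = a ^+ 2 + n%:R * \sum_k p k * f k ^+ 2.
Proof.
move=> p1 pf; elim: n a => [|n IH] a /=; first by rewrite big_nil addr0 mul0r addr0.
transitivity (\sum_k (p k * a ^+ 2 + 2 * a * (p k * f k) + p k * f k ^+ 2
    + p k * (n%:R * \sum_k p k * f k ^+ 2))).
  apply: eq_bigr => k _.
  rewrite (_ : ex _ _ _ = (a + f k) ^+ 2 + n%:R * \sum_k p k * f k ^+ 2); first by ring.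
  by rewrite -IH; apply: eq_ex => c _; rewrite big_cons addrA.
by rewrite !big_split/= -!mulr_suml -mulr_sumr pf p1 -natr1; ring.
Qed.

(** Chebyshev's inequality in each cell, then a union bound; the second moment of a centred
    indicator is at most 1. *)
Lemma pr_freq_far p n (e : R) : (0 < n)%N -> prob p -> 0 < e ->
  pr p n (fun c => ~~ [forall k, `|freq c k - p k| <= e]) <= #|I|%:R / (n%:R * e ^+ 2).
Proof.
move=> n0 pp e0.
have n0' : 0 < n%:R :> R by rewrite ltr0n.
pose f k j : R := (j == k)%:R - p k.
have fs k c : size c = n -> \sum_(x <- c) f k x = n%:R * (freq c k - p k).
  move=> cn; rewrite /f sumrB big_const_seq count_predT iter_addr_0 cn.
  rewrite (_ : \sum_(x <- c) _ = (count_mem k c)%:R).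
    by rewrite /freq cn -mulr_natr; field; rewrite gt_eqF.
  elim: c {cn} => [|x c IH]; first by rewrite big_nil.
  by rewrite big_cons IH /= natrD.
have pk k : \sum_j p j * (j == k)%:R = p k.
  rewrite (bigD1 k)//= eqxx mulr1 big1 ?addr0// => j /negbTE ->.
  by rewrite mulr0.
have pf k : \sum_j p j * f k j = 0.
  by rewrite /f; under eq_bigr do rewrite mulrBr; rewrite sumrB -mulr_suml pp.2 mul1r pk subrr.
apply: (@le_trans _ _ (ex p n (fun c => \sum_k (n%:R * e) ^- 2 *
    (0 + \sum_(x <- c) f k x) ^+ 2))).
  apply: ex_le => [k|c cn]; first by case: pp.
  have t0 k : 0 <= (n%:R * e) ^- 2 * (0 + \sum_(x <- c) f k x) ^+ 2.
    by rewrite mulr_ge0 ?sqr_ge0// invr_ge0 sqr_ge0.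
  have [_|/fintype.forallPn[k]] := boolP [forall k, `|freq c k - p k| <= e]; first by rewrite /= sumr_ge0.
  rewrite -ltNge => ek; rewrite (bigD1 k)//= -[leLHS]addr0 lerD ?sumr_ge0//.
  rewrite add0r fs// !exprMn invfM mulrACA mulVf ?sqrf_eq0 ?gt_eqF// mul1r.
  rewrite -[(_ - _) ^+ 2]real_normK ?num_real// mulrC ler_pdivlMr ?exprn_gt0// mul1r.
  by rewrite lerXn2r// ?nnegrE ltW.
rewrite ex_sum.
under eq_bigr do rewrite exZ ex_sqr_sum ?pp.2//.
apply: (@le_trans _ _ (\sum_(k : I) (n%:R * e ^+ 2)^-1)); last first.
  by rewrite sumr_const -[leLHS]mulr_natl.
apply: ler_sum => k _.
have h : \sum_j p j * f k j ^+ 2 <= 1.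
  apply: ler_mean => // j; have := prob_ge0 k pp; have := prob_le1 k pp.
  by rewrite /f; case: (j == k) => /= *; nra.
apply: (@le_trans _ _ ((n%:R * e) ^- 2 * n%:R)).
  apply: ler_wpM2l; first by rewrite invr_ge0 sqr_ge0.
  by rewrite expr0n/= add0r ler_piMr// ltW.
rewrite le_eqVlt; apply/orP; left; apply/eqP; field; rewrite !gt_eqF//.
Qed.

Lemma pr_le p n (A B : pred (seq I)) : prob p ->
  (forall c, size c = n -> A c -> B c) -> pr p n A <= pr p n B.
Proof.
move=> pp AB; apply: ex_le => [k|c cn]; first by case: pp.
by case: (boolP (A c)) => [/(AB _ cn) ->|].
Qed.

Lemma prC p n (A : pred (seq I)) : prob p -> pr p n A = 1 - pr p n (fun c => ~~ A c).
Proof.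
move=> pp; rewrite -(@ex_cst p n 1 pp.2) -mulN1r -exZ -exD; apply: eq_ex => c _.
by case: (A c) => /=; lra.
Qed.

Lemma pr_ge0 p n (A : pred (seq I)) : prob p -> 0 <= pr p n A.
Proof. by move=> pp; apply: ex_ge0 => // k; case: pp. Qed.

(** Change of measure to [nu], under which the frequencies are near [nu] with probability at least
    1/2. The event is quantified after [n], since its inclusion of a neighbourhood of [nu] is itself
    known only for large [n]. *)
Lemma pr_ge_tilted nu p (eta e : R) : prob nu -> prob p -> (forall k, 0 < p k) ->
  (forall k, 0 < nu k) -> 0 < eta -> 0 < e ->
  \forall n \near \oo, forall A : pred (seq I),
    (forall c, size c = n -> (forall k, `|freq c k - nu k| <= e) -> A c) ->
    expR (- n%:R * (kl nu p + eta)) <= pr p n A.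
Proof.
move=> nup pp p0 n0 eta0 e0.
pose L := \sum_k `|ln (nu k / p k)|.
have L0 : 0 <= L by rewrite sumr_ge0.
(* Within this radius the normalised log-likelihood differs from kl nu p by at most eta/2; the other
   eta/2 absorbs the factor 1/2. *)
pose d := Num.min e (eta / (2 * (L + 1))).
have d0 : 0 < d by rewrite lt_min e0 divr_gt0//; lra.
have dL : d * L <= eta / 2.
  apply: (@le_trans _ _ (eta / (2 * (L + 1)) * L)).
    by rewrite ler_wpM2r// ge_min lexx orbT.
  by rewrite mulrAC ler_pdivrMr; nra.
near=> n; move=> A hA.
have n1 : (0 < n)%N by near: n; exact: nbhs_infty_gt.
have n1' : 0 < n%:R :> R by rewrite ltr0n.
pose B c := [forall k, `|freq c k - nu k| <= d].
have BA : pr p n B <= pr p n A.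
  apply: pr_le => // c cn /forallP h; apply: hA => // k.
  by apply: le_trans (h k) _; rewrite ge_min lexx.
apply: le_trans BA.
have Bnu : 1 / 2 <= pr nu n B.
  rewrite prC//; have := pr_freq_far n1 nup d0.
  have : #|I|%:R / (n%:R * d ^+ 2) <= 1 / 2.
    rewrite invfM mulrCA mulrC ler_pdivrMr//.
    have : 2 * (#|I|%:R / d ^+ 2) <= n%:R.
      by near: n; exact: nbhs_infty_ger.
    by lra.
  by rewrite /B; lra.
have E2 : expR (- n%:R * (eta / 2)) <= 1 / 2.
  rewrite mulNr expRN invf_ple ?posrE ?expR_gt0 ?divr_gt0// (_ : (1 / 2)^-1 = 2); last by field.
  apply: le_trans (expR_ge1Dx _).
  have : 2 / eta <= n%:R by near: n; exact: nbhs_infty_ger.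
  by rewrite ler_pdivrMr//; lra.
apply: (@le_trans _ _ (expR (- n%:R * (kl nu p + eta / 2)) * pr nu n B)).
  rewrite (_ : - n%:R * (kl nu p + eta) =
    - n%:R * (kl nu p + eta / 2) + - n%:R * (eta / 2)); last by field.
  by rewrite expRD ler_wpM2l ?expR_ge0//; lra.
rewrite /pr (@ex_change p nu (fun k => p k / nu k)); last 2 first.
- by move=> k _; rewrite mulrC divfK// gt_eqF.
- by move=> c _ k _; rewrite gt_eqF.
rewrite -exZ; apply: ex_le => [k|c cn]; first by case: nup.
have [/forallP Bc|_] := boolP (B c); last by rewrite mul0r mulr0.
rewrite mulr1 mul1r prod_likelihood ?cn//.
rewrite ler_expR !mulNr lerN2 ler_wpM2l ?(ltW n1')//.
rewrite -lerBlDl /kl -sumrB; apply: le_trans dL; rewrite /L mulr_sumr ler_sum// => k _.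
rewrite -mulrBl; apply: le_trans (ler_norm _) _; rewrite normrM.
by rewrite ler_wpM2r.
Unshelve. all: by end_near. Qed.

End sampling.

(** * Binning the sample on the logarithmic scale *)

Lemma natdist_le (i j k : nat) : k != (i - j + (j - i))%N -> (i - j + (j - i) <= k)%N ->
  (i.+1 <= j + k)%N /\ (j.+1 <= i + k)%N.
Proof. by move=> *; lia. Qed.

Lemma natdist_gt (i j k : nat) : k.+1 != (i - j + (j - i))%N ->
  (k < i - j + (j - i))%N -> (j + k.+2 <= i)%N \/ (i + k.+2 <= j)%N.
Proof. by move=> *; lia. Qed.

Section binning.
Variables (R : realType) (N : nat) (lam : R).
Hypothesis N0 : (0 < N)%N.
Hypothesis lam0 : 0 < lam.
Local Notation I := 'I_(N ^ 2).+1.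
Implicit Types (x y z b : R) (i j k : I) (s : seq R) (nu : I -> R).

Definition bin x : I := inord (minn (N ^ 2) (Num.truncn (N%:R * (lam * ln x)))).

Lemma binE x : bin x = inord (minn (N ^ 2) (Num.truncn (N%:R * (lam * ln x)))). Proof. by []. Qed.

Definition kernel x y z : bool := Num.max (x / y) (y / x) <= z.

Definition dist i j : nat := (i - j) + (j - i).

Definition bkernel i j k : R := (dist i j <= k)%N%:R.

(* [ord_max] is the unbounded last cell, which carries no information on ratios. *)
Definition undetermined i j k : bool :=
  [|| i == ord_max, j == ord_max, k == ord_max, k == dist i j :> nat
    | k.+1 == dist i j :> nat].

Lemma bkernel_le1 i j k : `|bkernel i j k| <= 1.
Proof. by rewrite /bkernel; case: leq; rewrite ?normr0 ?normr1. Qed.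

Lemma bin_itv x : 1 <= x -> bin x != ord_max ->
  (bin x)%:R <= N%:R * (lam * ln x) < (bin x)%:R + 1.
Proof.
move=> x1; rewrite -(inj_eq val_inj) /= /bin inordK ?ltnS ?geq_minl// => h.
have -> : minn (N ^ 2) (Num.truncn (N%:R * (lam * ln x))) =
    Num.truncn (N%:R * (lam * ln x)) by lia.
rewrite natr1; apply: Num.Theory.truncn_itv.
by rewrite mulr_ge0// mulr_ge0 ?ln_ge0// ltW.
Qed.

Lemma kernelE x y z : 0 < x -> 0 < y -> 0 < z ->
  kernel x y z = (ln x - ln y <= ln z) && (ln y - ln x <= ln z).
Proof.
move=> x0 y0 z0; rewrite /kernel ge_max.
by rewrite -!ln_div ?posrE// !ler_ln ?posrE ?divr_gt0.
Qed.

(** On the scale N lam ln, the difference of two variables lies strictly within 1 of the difference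
    of their cell indices. The comparison with the third variable is therefore decided unless its
    index is the cell distance or one less. *)
Lemma kernel_bin x y z : 1 <= x -> 1 <= y -> 1 <= z ->
  ~~ undetermined (bin x) (bin y) (bin z) ->
  (kernel x y z)%:R = bkernel (bin x) (bin y) (bin z).
Proof.
move=> x1 y1 z1; rewrite !negb_or => /and5P[ix iy iz d1 d2].
have := bin_itv x1 ix; have := bin_itv y1 iy; have := bin_itv z1 iz.
have p0 : 0 < N%:R * lam by rewrite mulr_gt0// ltr0n.
rewrite /bkernel kernelE ?(lt_le_trans _ x1) ?(lt_le_trans _ y1) ?(lt_le_trans _ z1)//.
move: d1 d2; rewrite /dist; move: (nat_of_ord (bin x)) (nat_of_ord (bin y)) (nat_of_ord (bin z)).
move=> i j k d1 d2 /andP[z2 z3] /andP[y2 y3] /andP[x2 x3].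
congr (nat_of_bool _)%:R.
rewrite -(ler_pM2l p0) -(ler_pM2l p0 (ln y - _)) !mulrBr -!mulrA.
move: (N%:R * (lam * ln x)) (N%:R * (lam * ln y)) (N%:R * (lam * ln z)) z2 z3 y2 y3 x2 x3.
move=> X Y Z z2 z3 y2 y3 x2 x3.
have [le|gt] := leqP (i - j + (j - i)) k.
  have [] := natdist_le d1 le; rewrite -!(ler_nat R) !natrD -!natr1 => h1 h2.
  by apply/andP; split; lra.
apply/negbTE; rewrite negb_and -!ltNge; apply/orP.
have [h|h] := natdist_gt d2 gt.
- by left; move: h; rewrite -(ler_nat R) natrD -!natr1 => h; lra.
- by right; move: h; rewrite -(ler_nat R) natrD -!natr1 => h; lra.
Qed.

Lemma kernel_bin_dist x y z : 1 <= x -> 1 <= y -> 1 <= z ->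
  `|(kernel x y z)%:R - bkernel (bin x) (bin y) (bin z)| <=
  (undetermined (bin x) (bin y) (bin z))%:R.
Proof.
move=> x1 y1 z1; have [_|/(kernel_bin x1 y1 z1) ->] := boolP (undetermined _ _ _);
  last by rewrite subrr normr0.
rewrite /bkernel; case: kernel; case: leq => /=; rewrite ?subrr ?normr0// ?subr0 ?normr1//.
by rewrite sub0r normrN normr1.
Qed.

(** Union bound over five coincidences: with the other two indices fixed, each allows at most one
    value of the remaining index, hence mass at most b. *)
Lemma undetermined_le nu b : prob nu -> (forall k, nu k <= b) ->
  \sum_i \sum_j \sum_k nu i * nu j * nu k * (undetermined i j k)%:R <= 5 * b.
Proof.
move=> nup nub.
have n0 i : 0 <= nu i by exact: prob_ge0.
have b0 : 0 <= b by exact: le_trans (n0 ord0) (nub ord0).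
have pick (P : pred I) : (forall j k, P j -> P k -> j = k) -> \sum_k nu k * (P k)%:R <= b.
  move=> Pu; have [k Pk|P0] := pickP P.
    rewrite (bigD1 k)//= Pk mulr1 big1 ?addr0// => j jk.
    by case: (boolP (P j)) jk => [Pj|_ _]; [rewrite (Pu j k)// eqxx|rewrite mulr0].
  by rewrite big1// => k _; rewrite P0 mulr0.
have -> : \sum_i \sum_j \sum_k nu i * nu j * nu k * (undetermined i j k)%:R =
   \sum_i nu i * \sum_j nu j * \sum_k nu k * (undetermined i j k)%:R.
  apply: eq_bigr => i _; rewrite mulr_sumr; apply: eq_bigr => j _.
  by rewrite !mulr_sumr; apply: eq_bigr => k _; rewrite !mulrA.
have um i : \sum_j nu j * (j == i)%:R <= b by apply: pick => ? ? /eqP-> /eqP->.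
apply: (@le_trans _ _ (\sum_i nu i * ((i == ord_max)%:R +
   \sum_j nu j * ((j == ord_max)%:R + 3 * b)))).
  apply: ler_sum => i _; apply: ler_wpM2l => //.
  apply: (@le_trans _ _ (\sum_j nu j * ((i == ord_max)%:R + ((j == ord_max)%:R + 3 * b)))).
    apply: ler_sum => j _; apply: ler_wpM2l => //.
    apply: (@le_trans _ _ (\sum_k nu k * (((i == ord_max)%:R + (j == ord_max)%:R) +
       ((k == ord_max)%:R + (k == dist i j :> nat)%:R + (k.+1 == dist i j :> nat)%:R)))).
      apply: ler_sum => k _; apply: ler_wpM2l => //; rewrite /undetermined.
      by case: (i == _); case: (j == _); case: (k == ord_max); case: (_ == dist _ _);
        case: (_ == dist _ _) => /=; lra.
    under eq_bigr do rewrite mulrDr.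
    rewrite big_split/= -mulr_suml nup.2 mul1r [leRHS]addrA lerD2l.
    under eq_bigr do rewrite !mulrDr.
    rewrite !big_split/=.
    have h1 := um ord_max.
    have h2 : \sum_k nu k * (k == dist i j :> nat)%:R <= b.
      by apply: pick => k k' /eqP h /eqP h'; apply: val_inj; rewrite /= h h'.
    have h3 : \sum_k nu k * (k.+1 == dist i j :> nat)%:R <= b.
      by apply: pick => k k' /eqP h /eqP h'; apply: val_inj => /=; lia.
    by lra.
  by under eq_bigr do rewrite mulrDr; rewrite big_split/= -mulr_suml nup.2 mul1r.
under eq_bigr do rewrite mulrDr.
rewrite big_split/= -mulr_suml nup.2 mul1r.
under [X in _ + X]eq_bigr do rewrite mulrDr.
rewrite big_split/= -mulr_suml nup.2 mul1r.
by have := um ord_max; lra.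
Qed.

End binning.

(** * From the statistic to the cubic functional of the cell frequencies *)

Section statistic.
Variables (R : realType).

(** Passes from the pairs i < j of [Mn] to all ordered pairs; there the diagonal terms are 1 because
    x / x = 1 never exceeds a threshold z >= 1. *)
Lemma sum_ord_sym n (K : 'I_n -> 'I_n -> R) : (forall i j, K i j = K j i) ->
  (forall i, K i i = 1) ->
  \sum_i \sum_j K i j = 2 * (\sum_(i < n) \sum_(j < n | (i < j)%N) K i j) + n%:R.
Proof.
move=> Ks K1.
have -> : \sum_i \sum_j K i j =
    \sum_(i < n) (\sum_(j < n | (i < j)%N) K i j + \sum_(j < n | (j < i)%N) K i j + 1).
  apply: eq_bigr => i _; rewrite (bigD1 i)//= K1 addrC; congr (_ + _).
  rewrite (bigID (fun j : 'I_n => (i < j)%N))/=; congr (_ + _); apply: eq_bigl => j;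
    rewrite -(inj_eq val_inj)/=; lia.
rewrite !big_split/= sumr_const card_ord; congr (_ + _).
rewrite mulr2n mulrDl mul1r; congr (_ + _).
rewrite (exchange_big_dep xpredT)//=; apply: eq_bigr => i _; apply: eq_bigr => j _.
exact: Ks.
Qed.

Variables (N : nat) (lam : R).
Hypothesis N0 : (0 < N)%N.
Hypothesis lam0 : 0 < lam.
Local Notation bin := (@bin R N lam).
Local Notation bkernel := (@bkernel R N).
Local Notation I := 'I_(N ^ 2).+1.

Section sample.
Variables (s : seq R) (b : R).
Hypothesis s2 : (2 <= size s)%N.
Hypothesis s1 : {in s, forall x, 1 <= x}.
Let c := map bin s.
Let n : R := (size s)%:R.
Let nu : I -> R := freq R c.
Hypothesis nub : forall k, nu k <= b.

Let n2 : 2 <= n. Proof. by rewrite ler_nat. Qed.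

Let csz : (0 < size c)%N. Proof. by rewrite size_map (leq_trans _ s2). Qed.

Let nup : prob nu. Proof. exact: prob_freq. Qed.

Let sum_bin (F : I -> R) : \sum_(x <- s) F (bin x) = n * \sum_k nu k * F k.
Proof. by have := sum_freq F csz; rewrite big_map size_map. Qed.

Let sum_bin3 (F : I -> I -> I -> R) :
  \sum_(z <- s) \sum_(x <- s) \sum_(y <- s) F (bin x) (bin y) (bin z) =
  n ^+ 3 * \sum_i \sum_j \sum_k nu i * nu j * nu k * F i j k.
Proof.
rewrite exchange_big/=.
under eq_bigr do rewrite exchange_big/=.
transitivity (\sum_(x <- s) \sum_(y <- s) n * \sum_k nu k * F (bin x) (bin y) k).
  by apply: eq_bigr => x _; apply: eq_bigr => y _; exact: sum_bin.
transitivity (\sum_(x <- s) n * \sum_j nu j * (n * \sum_k nu k * F (bin x) j k)).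
  apply: eq_bigr => x _.
  exact: (sum_bin (fun j => n * \sum_k nu k * F (bin x) j k)).
rewrite (sum_bin (fun i => n * \sum_j nu j * (n * \sum_k nu k * F i j k))).
rewrite !mulr_sumr; apply: eq_bigr => i _.
rewrite !mulr_sumr; apply: eq_bigr => j _.
rewrite !mulr_sumr; apply: eq_bigr => k _; ring.
Qed.

(** The V-statistic: the mean of the kernel under the cube of the empirical law, repetitions
    included. *)
Let V := n ^- 3 * \sum_(z <- s) \sum_(x <- s) \sum_(y <- s) (kernel x y z)%:R.

Let V_tri : `|V - tri bkernel nu nu nu| <= 5 * b.
Proof.
have n3 : 0 < n ^+ 3 by rewrite exprn_gt0//; have := n2; lra.
have -> : tri bkernel nu nu nu = n ^- 3 * \sum_(z <- s) \sum_(x <- s) \sum_(y <- s)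
    bkernel (bin x) (bin y) (bin z).
  by rewrite sum_bin3 mulKf ?gt_eqF.
rewrite -mulrBr -sumrB normrM gtr0_norm ?invr_gt0// mulrC ler_pdivrMr//.
apply: (@le_trans _ _ (\sum_(z <- s) \sum_(x <- s) \sum_(y <- s)
    (undetermined (bin x) (bin y) (bin z))%:R)).
  apply: le_trans (ler_norm_sum _ _ _) _; rewrite big_seq [leRHS]big_seq ler_sum// => z zs.
  rewrite -sumrB; apply: le_trans (ler_norm_sum _ _ _) _.
  rewrite big_seq [leRHS]big_seq ler_sum// => x xs.
  rewrite -sumrB; apply: le_trans (ler_norm_sum _ _ _) _.
  rewrite big_seq [leRHS]big_seq ler_sum// => y ys.
  exact: (kernel_bin_dist N0 lam0 (s1 xs) (s1 ys) (s1 zs)).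
rewrite (sum_bin3 (fun i j k => (undetermined i j k)%:R)) mulrC ler_wpM2r ?(ltW n3)//.
exact: undetermined_le.
Qed.

Let V01 : 0 <= V <= 1.
Proof.
have n3 : 0 < n ^+ 3 by rewrite exprn_gt0//; have := n2; lra.
apply/andP; split.
  rewrite mulr_ge0 ?invr_ge0 ?(ltW n3)//.
  by rewrite sumr_ge0// => z _; rewrite sumr_ge0// => x _; rewrite sumr_ge0.
rewrite /V mulrC ler_pdivrMr// mul1r.
have cst (F : R) : \sum_(x <- s) F = n * F.
  by rewrite big_const_seq count_predT iter_addr_0 -mulr_natl.
rewrite (_ : n ^+ 3 = \sum_(z <- s) \sum_(x <- s) \sum_(y <- s) 1); last first.
  by rewrite !cst; ring.
by do 3! (apply: ler_sum => ? _); rewrite lern1 leq_b1.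
Qed.

Let sumMn : n^-1 * \sum_(z <- s) Mn s z = (n * V - 1) / (n - 1).
Proof.
have bin2E : n * (n - 1) = 2 * ('C(size s, 2))%:R.
  have := congr1 (fun k : nat => k%:R : R) (mul_bin_diag (size s) 1).
  rewrite bin1 !natrM -/n => <-; congr (_ * _).
  by rewrite -subn1 natrB//; exact: leq_trans s2.
have n0 : n != 0 by rewrite gt_eqF//; have := n2; lra.
have n10 : n - 1 != 0 by rewrite gt_eqF//; have := n2; lra.
have cst (F : R) : \sum_(x <- s) F = n * F.
  by rewrite big_const_seq count_predT iter_addr_0 -mulr_natl.
have MnE z : z \in s -> Mn s z =
    ((\sum_(x <- s) \sum_(y <- s) (kernel x y z)%:R) - n) / (n * (n - 1)).
  move=> zs; have z1 := s1 zs.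
  rewrite (big_nth 0) big_mkord.
  under [X in X - _]eq_bigr do rewrite (big_nth 0) big_mkord.
  rewrite (@sum_ord_sym (size s) (fun i j => (kernel s`_i s`_j z)%:R)).
  - rewrite /Mn bin2E addrK -mulf_div divff ?mul1r ?pnatr_eq0// mulrC.
    congr (_ * _); apply: eq_bigr => i _; apply: eq_bigr => j _.
    by rewrite /kernel; case: ifP.
  - by move=> i j; rewrite /kernel maxC.
  - move=> i; rewrite /kernel maxxx divff ?z1// gt_eqF// (lt_le_trans _ (s1 _))//.
    by rewrite mem_nth.
rewrite big_seq (eq_bigr _ MnE) -big_seq -mulr_suml sumrB cst /V.
by field; apply/andP; split.
Qed.

(** The number of pairs with y <= x is (n^2 + E) / 2, where E counts tied ordered pairs. Tied points
    share a cell, so E <= n^2 b; this holds for every list, with no appeal to almost sure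
    distinctness. *)
Let sumFn : `|n^-1 * \sum_(x <- s) Fn s x - 1 / 2| <= b / 2.
Proof.
have n0 : 0 < n by have := n2; lra.
pose E := \sum_(x <- s) \sum_(y <- s) (x == y)%:R : R.
have cst (F : R) : \sum_(x <- s) F = n * F.
  by rewrite big_const_seq count_predT iter_addr_0 -mulr_natl.
have cnt x : (count (fun y => y <= x) s)%:R = \sum_(y <- s) (y <= x)%R%:R :> R.
  by rewrite -sum1_count natr_sum big_mkcond; apply: eq_bigr => y _; case: (y <= x).
have FnE : n^-1 * \sum_(x <- s) Fn s x =
    n ^- 2 * \sum_(x <- s) \sum_(y <- s) (y <= x)%R%:R.
  rewrite /Fn -mulr_sumr mulrA -invfM -expr2; congr (_ * _).
  by apply: eq_bigr => x _; exact: cnt.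
have two : 2 * \sum_(x <- s) \sum_(y <- s) (y <= x)%R%:R = n ^+ 2 + E.
  rewrite mulrDl mul1r [X in _ + X]exchange_big /= -!big_split/= /E.
  rewrite (_ : n ^+ 2 = \sum_(x <- s) \sum_(y <- s) 1); last by rewrite !cst; ring.
  rewrite -big_split/=; apply: eq_bigr => x _; rewrite -!big_split/=.
  by apply: eq_bigr => y _; case: (ltgtP x y) => /= _; rewrite ?addr0 ?add0r.
have E0 : 0 <= E by rewrite sumr_ge0// => x _; rewrite sumr_ge0.
have Eb : E <= n ^+ 2 * b.
  apply: (@le_trans _ _ (\sum_(x <- s) \sum_(y <- s) (bin y == bin x)%:R)).
    apply: ler_sum => x _; apply: ler_sum => y _; case: eqP => [->|_] /=.
      by rewrite eqxx.
    by rewrite ler0n.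
  apply: (@le_trans _ _ (\sum_(x <- s) n * b)); last by rewrite cst; lra.
  apply: ler_sum => x _; rewrite (sum_bin (fun k => (k == bin x)%:R)).
  rewrite ler_wpM2l ?(ltW n0)// (bigD1 (bin x))//= eqxx mulr1 big1 ?addr0//.
  by move=> j /negbTE ->; rewrite mulr0.
have n0' : n != 0 by rewrite gt_eqF.
have -> : n^-1 * \sum_(x <- s) Fn s x - 1 / 2 = E / (2 * n ^+ 2).
  rewrite FnE; move: two; set S := \sum_(x <- s) _ => two.
  have -> : S = (n ^+ 2 + E) / 2 by rewrite -two; field.
  by field.
rewrite ger0_norm; last by rewrite divr_ge0// mulr_ge0// sqr_ge0.
by rewrite ler_pdivrMr ?mulr_gt0 ?exprn_gt0//; have := n2; lra.
Qed.

(** The budget is 5 b for undetermined triples, b / 2 for ties and (n - 1)^-1 for the passage from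
    U-statistic to V-statistic. *)
Lemma Tn_tau : `|Tn s - tau bkernel nu| <= 6 * b + (n - 1)^-1.
Proof.
have -> : Tn s = n^-1 * \sum_(z <- s) Mn s z - n^-1 * \sum_(x <- s) Fn s x.
  by rewrite /Tn sumrB mulrBr.
rewrite sumMn /tau.
have n10 : 0 < n - 1 by have := n2; lra.
have -> : (n * V - 1) / (n - 1) = V - (1 - V) * (n - 1)^-1.
  by field; rewrite gt_eqF.
have i0 : 0 < (n - 1)^-1 by rewrite invr_gt0.
have := sumFn; have := V_tri; rewrite !ler_norml => /andP[h1 h2] /andP[h3 h4].
have /andP[v0 v1] := V01.
have b0 : 0 <= b by exact: le_trans (prob_ge0 ord0 nup) (nub ord0).
by apply/andP; split; nra.
Qed.

End sample.
End statistic.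

(** * Iterated integrals of functions of the cells as finite sums *)

Section iid.
Variable R : realType.
Local Notation mu := (@lebesgue_measure R).
Local Notation D := (`[1%R, +oo[%classic : set R).
Implicit Types (f g : R -> R).

(* Unlike [ge0_le_integral], no measurability is required: the integral of a
   nonnegative function is a supremum over the simple functions below it. *)
Lemma le_integral_nonneg (A : set R) (f g : R -> \bar R) :
  (forall x, A x -> 0 <= f x)%E -> (forall x, A x -> f x <= g x)%E ->
  (\int[mu]_(x in A) f x <= \int[mu]_(x in A) g x)%E.
Proof.
move=> f0 fg; rewrite !ge0_integralE//; last by move=> x Ax; exact: le_trans (f0 x Ax) (fg x Ax).
apply: ereal_sup_le => _ [h hf <-]; exists h => // x.
apply: le_trans (hf x) _; rewrite /patch; case: ifPn => // /set_mem; exact: fg.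
Qed.

Definition sample n (s : seq R) := size s = n /\ {in s, forall x, 1 <= x}.

Lemma iid_int_ge0 g n (F : seq R -> \bar R) : (forall x, 1 <= x -> 0 <= g x) ->
  (forall s, sample n s -> 0 <= F s)%E -> (0 <= iid_int g n F)%E.
Proof.
move=> g0; elim: n F => [|n IH] F F0 /=; first by apply: F0; split.
apply: integral_ge0 => x /=; rewrite in_itv/= andbT => x1.
rewrite mule_ge0 ?lee_fin ?g0//; apply: IH => s [sn s1]; apply: F0; split=> /=.
  by rewrite sn.
by move=> y; rewrite inE => /orP[/eqP->|/s1].
Qed.

Lemma iid_int_le g n (F G : seq R -> \bar R) : (forall x, 1 <= x -> 0 <= g x) ->
  (forall s, sample n s -> 0 <= F s)%E ->
  (forall s, sample n s -> F s <= G s)%E ->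
  (iid_int g n F <= iid_int g n G)%E.
Proof.
move=> g0; elim: n F G => [|n IH] F G F0 FG /=; first by apply: FG; split.
have cons x s : 1 <= x -> sample n s -> sample n.+1 (x :: s).
  move=> x1 [sn s1]; split; first by rewrite /= sn.
  by move=> y; rewrite inE => /orP[/eqP->|/s1].
apply: le_integral_nonneg => x /=; rewrite in_itv/= andbT => x1.
  by rewrite mule_ge0 ?lee_fin ?g0// iid_int_ge0// => s /(cons x s x1)/F0.
rewrite lee_wpmul2l ?lee_fin ?g0//; apply: IH => s /(cons x s x1); [exact: F0|exact: FG].
Qed.

Section cells.
Variables (I : finType) (B : R -> I).
Hypothesis mB : forall k, measurable_fun D (fun x => (B x == k)%:R : R).

Definition cell g k := Rintegral mu D (fun x => g x * (B x == k)%:R).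

Lemma integrable_cell g k : mu.-integrable D (EFin \o g) ->
  mu.-integrable D (EFin \o (fun x => g x * (B x == k)%:R)).
Proof.
move=> ig; apply: (le_integrable _ _ _ ig) => //.
- apply/measurable_EFinP; apply: measurable_funM; last exact: mB.
  by apply/measurable_EFinP; case/integrableP: ig.
- move=> x Dx; rewrite /comp !abse_EFin lee_fin normrM.
  by case: eqP => _; rewrite ?normr1 ?normr0 ?mulr1// mulr0.
Qed.

Lemma integral_bin g (H : I -> R) : mu.-integrable D (EFin \o g) ->
  (\int[mu]_(x in D) (g x * H (B x))%:E = (\sum_k cell g k * H k)%:E)%E.
Proof.
move=> ig.
transitivity (\int[mu]_(x in D)
    (\sum_k (H k)%:E * (EFin \o (fun x => g x * (B x == k)%:R)%R) x))%E.
  apply: eq_integral => x _ /=; rewrite sumEFin; congr EFin.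
  rewrite (bigD1 (B x))//= eqxx mulr1 big1 ?addr0 1?mulrC// => k.
  by rewrite eq_sym => /negbTE ->; rewrite !mulr0.
rewrite integral_sum//; last first.
  by move=> k; apply: integrableZl => //; exact: integrable_cell.
rewrite -sumEFin; apply: eq_bigr => k _.
rewrite integralZl//; last exact: integrable_cell.
rewrite EFinM muleC; congr (_ * _)%E.
by rewrite /cell /Rintegral fineK//; apply: integrable_fin_num => //; exact: integrable_cell.
Qed.

Lemma Rintegral_bin g (H : I -> R) : mu.-integrable D (EFin \o g) ->
  Rintegral mu D (fun x => g x * H (B x)) = \sum_k cell g k * H k.
Proof. by move=> ig; rewrite /Rintegral integral_bin. Qed.

Lemma iid_int_bin g n (F : seq I -> R) : mu.-integrable D (EFin \o g) ->
  iid_int g n (fun s => (F (map B s))%:E) = (ex (cell g) n F)%:E.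
Proof.
move=> ig; elim: n F => [|n IH] F //=.
rewrite -(integral_bin (fun k => ex (cell g) n (fun c => F (k :: c))) ig).
by apply: eq_integral => x _; rewrite (IH (fun c => F (B x :: c))) EFinM.
Qed.

Lemma cell_ge0 g k : (forall x, 1 <= x -> 0 <= g x) -> 0 <= cell g k.
Proof.
move=> g0; apply: Rintegral_ge0 => x /=; rewrite in_itv/= andbT => x1.
by rewrite mulr_ge0// g0.
Qed.

Lemma prob_cell g : mu.-integrable D (EFin \o g) -> is_density g -> prob (cell g).
Proof.
move=> ig [g0 g1]; split=> [k|]; first exact: cell_ge0.
have := integral_bin (fun=> 1) ig.
under eq_integral do rewrite mulr1.
rewrite g1 => -[->]; apply: eq_bigr => k _; rewrite mulr1//.
Qed.

(** Monotonicity of the iterated integral encloses an arbitrary set of samples between two sets of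
    cell sequences; the finite bounds also ensure that [fine] returns the true value. *)
Lemma iid_prob_bounds g n (A B' : pred (seq I)) (E : seq R -> Prop) :
  mu.-integrable D (EFin \o g) -> is_density g ->
  (forall s, sample n s -> A (map B s) -> E s) ->
  (forall s, sample n s -> E s -> B' (map B s)) ->
  pr (cell g) n A <= iid_prob g n E <= pr (cell g) n B'.
Proof.
move=> ig gd AE EB.
have [g0 g1] := gd.
have h1 : ((pr (cell g) n A)%:E <= iid_int g n (fun s => (\1_[set s | E s] s)%:E))%E.
  rewrite -(iid_int_bin n (fun c => (A c)%:R) ig); apply: iid_int_le => // s ss.
  rewrite lee_fin indicE; case: (boolP (A _)) => //= /(AE _ ss) Es.
  by rewrite mem_set.
have h2 : (iid_int g n (fun s => (\1_[set s | E s] s)%:E) <= (pr (cell g) n B')%:E)%E.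
  rewrite -(iid_int_bin n (fun c => (B' c)%:R) ig); apply: iid_int_le => // s ss.
  rewrite lee_fin indicE; case: (boolP (s \in _)) => //= /set_mem /(EB _ ss) ->.
  by [].
rewrite /iid_prob; case: (iid_int _ _ _) h1 h2 => [r| |] //=; rewrite ?lee_fin => -> //.
Qed.

End cells.
End iid.

(** * The truncated geometric law *)

Section truncated_geometric.
Variable R : realType.
Implicit Types (r : R) (m d i k n : nat).

(** The law of the integer part of an exponential variable capped at [m]: its survival function is
    r^k. *)
Definition tgeo r m k : R := if (k < m)%N then r ^+ k - r ^+ k.+1 else r ^+ k.

Lemma sum_tgeo r m (F : nat -> R) :
  \sum_(k < m.+1) tgeo r m k * F k =
  (1 - r) * \sum_(k < m) r ^+ k * F k + r ^+ m * F m.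
Proof.
rewrite big_ord_recr /= /tgeo ltnn; congr (_ + _).
by rewrite mulr_sumr; apply: eq_bigr => k _; rewrite ltn_ord exprS; ring.
Qed.

Lemma sum_tgeo_tail r m d : (d <= m)%N ->
  \sum_(k < m.+1) tgeo r m k * (d <= k)%N%:R = r ^+ d.
Proof.
move=> dm; rewrite (sum_tgeo _ _ (fun k => (d <= k)%N%:R)) dm mulr1.
suff: forall l, (1 - r) * \sum_(k < d + l) r ^+ k * (d <= k)%N%:R = r ^+ d - r ^+ (d + l).
  by move=> /(_ (m - d)%N); rewrite subnKC// => ->; rewrite subrK.
elim=> [|l IH].
  rewrite addn0 subrr big1 ?mulr0// => k _.
  by rewrite leqNgt ltn_ord mulr0.
by rewrite addnS big_ord_recr /= mulrDr IH leq_addr mulr1 exprS; ring.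
Qed.

Lemma sum_tgeo1 r m : \sum_(k < m.+1) tgeo r m k = 1.
Proof.
by have := @sum_tgeo_tail r m 0 isT; under eq_bigr do rewrite mulr1.
Qed.

Lemma tgeo_gt0 r m k : 0 < r < 1 -> 0 < tgeo r m k.
Proof.
move=> /andP[r0 r1]; rewrite /tgeo; case: ifP => _; last exact: exprn_gt0.
by rewrite exprS -{1}[r ^+ k]mul1r -mulrBl mulr_gt0 ?exprn_gt0// subr_gt0.
Qed.

Lemma tgeo_le r m k : 0 < r < 1 -> (k <= m)%N -> tgeo r m k <= 1 - r + r ^+ m.
Proof.
move=> /andP[r0 r1] km; rewrite /tgeo; have [km'|mk] := ltnP k m.
  have := exprn_ge0 m (ltW r0); have := exprn_ge0 k (ltW r0).
  have := exprn_ile1 k (ltW r0) (ltW r1); rewrite exprS; nra.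
by rewrite (_ : k = m); [lra|lia].
Qed.

(** Discrete form of E exp(-|y - Y|) = y exp(-y) + exp(-y) / 2 for an exponential Y. The factor 1 +
    r clears the denominator of the geometric sum, and the last term is the effect of the cap. *)
Lemma sum_tgeo_dist r m i : (i <= m)%N -> 0 < r < 1 ->
  (1 + r) * \sum_(j < m.+1) tgeo r m j * r ^+ ((i - j) + (j - i)) =
  (1 + r) * (i%:R * (1 - r) * r ^+ i) + r ^+ i + r * r ^+ (m + (m - i)).
Proof.
move=> im /andP[r0 r1].
rewrite (sum_tgeo _ _ (fun j => r ^+ ((i - j) + (j - i)))).
(* Below [i] every summand equals r^i, which is the base case; at distance l beyond [i] it is r^(i +
   2 l), summed by induction. *)
suff h : forall l, (1 + r) * ((1 - r) * \sum_(k < i + l) r ^+ k * r ^+ ((i - k) + (k - i))) =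
    (1 + r) * (i%:R * (1 - r) * r ^+ i) + r ^+ i - r ^+ (i + l + l).
  rewrite mulrDr; have := h (m - i)%N; rewrite subnKC// => ->.
  rewrite (_ : (i - m = 0)%N); last lia.
  by rewrite add0n exprD; ring.
elim=> [|l IH].
  rewrite !addn0 addrK (eq_bigr (fun=> r ^+ i)).
    by rewrite sumr_const card_ord -[_ *+ i]mulr_natl; ring.
  move=> k _; rewrite -exprD; congr (_ ^+ _); have := ltn_ord k; lia.
rewrite addnS big_ord_recr /= !mulrDr IH.
rewrite (_ : (i - (i + l) = 0)%N); last lia.
rewrite (_ : (i + l - i = l)%N); last lia.
rewrite (_ : ((i + l).+1 + l.+1 = i + l + l + 2)%N); last lia.
by rewrite add0n !exprD; ring.
Qed.

End truncated_geometric.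

Lemma natdist_cases (i j k : nat) :
  ((i - j + (j - i) <= k)%N + (i + k.+1 <= j)%N + (j + k.+1 <= i)%N = 1)%N.
Proof. lia. Qed.

(** * The binned exponential law and its projection *)

Section geometric_model.
Variables (R : realType) (N : nat).
Hypothesis N0 : (0 < N)%N.
Local Notation I := 'I_(N ^ 2).+1.
Local Notation m := (N ^ 2)%N.
Let h : R := N%:R^-1.
Let r : R := expR (- h).

Definition geo (k : I) : R := tgeo r m k.

Let h0 : 0 < h. Proof. by rewrite invr_gt0 ltr0n. Qed.

Let h1 : h <= 1. Proof. by rewrite invf_le1 ?ler1n ?ltr0n. Qed.

Let r01 : 0 < r < 1. Proof. by rewrite expR_gt0 expR_lt1 oppr_lt0. Qed.

Let r1h : 0 <= 1 - r <= h.
Proof. by have /andP[? ?] := r01; have := expR_ge1Dx (- h); rewrite -/r => ?; apply/andP; split; lra. Qed.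

Let r1h2 : h - h ^+ 2 / 2 <= 1 - r.
Proof. by have := expR_le_pol2 (ltW h0); rewrite -/r; lra. Qed.

Let rXE k : r ^+ k = expR (- (k%:R * h)).
Proof. by rewrite /r -expRM_natl mulrN. Qed.

(** The cells reach y = N, so the overflow mass is exp(-N). *)
Let rm : 0 <= r ^+ m <= h.
Proof.
have /andP[rr0 _] := r01; rewrite exprn_ge0 ?(ltW rr0)//= rXE.
rewrite natrX expr2 -mulrA /h divff ?mulr1 ?pnatr_eq0; last lia.
rewrite expRN lef_pV2 ?posrE ?expR_gt0 ?ltr0n//.
by apply: le_trans (expR_ge1Dx _); rewrite lerDr.
Qed.

Lemma geo_gt0 k : 0 < geo k. Proof. exact: tgeo_gt0. Qed.

Lemma sum_geo : \sum_k geo k = 1. Proof. exact: sum_tgeo1. Qed.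

Lemma geo_le k : geo k <= 2 / N%:R.
Proof.
apply: le_trans (tgeo_le r01 _) _; first by rewrite -ltnS.
by have /andP[_ ?] := r1h; have /andP[_ ?] := rm; rewrite -/h; lra.
Qed.

Let geo_dist (i : I) : `|\sum_j geo j * r ^+ dist i j - ((i%:R * h) * r ^+ i + r ^+ i / 2)|
  <= 2 * h.
Proof.
have im : (i <= m)%N by rewrite -ltnS.
have := sum_tgeo_dist im r01; rewrite -/geo.
have /andP[rr0 rr1] := r01; have /andP[u0 u1] := r1h; have /andP[v0 v1] := rm.
set S := \sum_(j < _) _ => hS.
have q0 : 0 <= r ^+ i by rewrite exprn_ge0// ltW.
have q1 : r ^+ i <= 1 by rewrite exprn_ile1// ltW.
have w0 : 0 <= r ^+ (m - i) by rewrite exprn_ge0// ltW.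
have w1 : r ^+ (m - i) <= 1 by rewrite exprn_ile1// ltW.
have y1 : i%:R * h * r ^+ i <= 1.
  rewrite rXE expRN ler_pdivrMr ?expR_gt0// mul1r.
  by apply: le_trans (expR_ge1Dx _); rewrite lerDr.
have y0 : 0 <= i%:R * h * r ^+ i by rewrite !mulr_ge0// ltW.
rewrite exprD in hS.
have e1 : i%:R * h * r ^+ i * (1 - h / 2) <= i%:R * (1 - r) * r ^+ i.
  rewrite (_ : _ * (1 - h / 2) = i%:R * (h - h ^+ 2 / 2) * r ^+ i); last by field.
  by rewrite ler_wpM2r// ler_wpM2l.
have e2 : i%:R * (1 - r) * r ^+ i <= i%:R * h * r ^+ i.
  by rewrite ler_wpM2r// ler_wpM2l.
move: hS e1 e2 y0 y1; set y := i%:R * h * r ^+ i; set y' := i%:R * (1 - r) * r ^+ i.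
move=> hS e1 e2 y0 y1.
have e3 : y - h / 2 <= y' by nra.
have x0 : 0 <= r * (r ^+ m * r ^+ (m - i)) by rewrite !mulr_ge0// ltW.
have x1 : r * (r ^+ m * r ^+ (m - i)) <= h.
  apply: le_trans v1; rewrite mulrCA ler_piMr//.
  by apply: mulr_ile1 => //; apply: ltW.
have {}hS : (1 + r) * (S - (y + r ^+ i / 2)) =
  (1 + r) * (y' - y) + r ^+ i * (1 - r) / 2 + r * (r ^+ m * r ^+ (m - i)) by lra.
rewrite -(@ler_pM2l _ (1 + r)); last lra.
rewrite -{1}[1 + r]ger0_norm -?normrM; last lra.
rewrite hS ler_norml; apply/andP; split; nra.
Qed.

Let geo_tail (d : nat) : `|\sum_k geo k * (d <= k)%N%:R - r ^+ d| <= h.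
Proof.
have /andP[rr0 rr1] := r01; have /andP[v0 v1] := rm.
have [dm|md] := leqP d m.
  by rewrite /geo sum_tgeo_tail// subrr normr0 ltW.
rewrite big1 ?sub0r ?normrN.
  rewrite ger0_norm ?exprn_ge0 ?(ltW rr0)//; apply: le_trans v1.
  by apply: ler_wiXn2l; rewrite ?(ltW rr0) ?(ltW rr1)// ltnW.
by move=> k _; rewrite leqNgt (leq_trans (ltn_ord k) md) mulr0.
Qed.

Lemma geo_prob : prob geo.
Proof. by split; [move=> k; apply/ltW/geo_gt0|exact: sum_geo]. Qed.

Let dist_le (i j : I) : (dist i j <= m)%N.
Proof.
by move: (ltn_ord i) (ltn_ord j); rewrite /dist !ltnS; move: (nat_of_ord i) (nat_of_ord j);
   clear; move=> *; lia.
Qed.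

Let sum_dist_kernel (i j : I) : \sum_k geo k * bkernel R i j k = r ^+ dist i j.
Proof.
rewrite /geo /bkernel sum_tgeo_tail//; exact: dist_le.
Qed.

(** By symmetry of the kernel in its first two slots, the projection is 2 E r^|k - J| + P(|I - J| <=
    k), close to (2 y e^{-y} + e^{-y}) + (1 - e^{-y}) at y = k / N; the lone exponentials cancel. *)
Lemma proj_geo (k : I) :
  `|proj (@bkernel R N) geo k - (1 + 2 * (k%:R / N%:R) * expR (- (k%:R / N%:R)))| <= 20 / N%:R.
Proof.
rewrite -/h.
have gp := geo_prob.
have B0 : `|\sum_j geo j * r ^+ j - 1 / 2| <= 2 * h.
  have := geo_dist ord0; rewrite mul0r mul0r add0r expr0.
  by under eq_bigr do rewrite /dist/= sub0n subn0 add0n.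
have Bk := geo_dist k; have hb := ltW h0.
have /andP[rr0 rr1] := r01; have /andP[u0 u1] := r1h.
have q0 : 0 <= r ^+ k by rewrite exprn_ge0// ltW.
have q1 : r ^+ k <= 1 by rewrite exprn_ile1// ltW.
pose A := \sum_i \sum_j geo i * geo j * bkernel R i j k.
(* One of the two equally likely ways for two independent cells to be more than k apart, hence A = 1
   - 2 T. *)
pose T := \sum_j geo j * \sum_i geo i * (j + k.+1 <= i)%N%:R.
have AT : A = 1 - 2 * T.
  have -> : A = \sum_i \sum_j (geo i * geo j - geo i * (geo j * (i + k.+1 <= j)%N%:R)
     - geo j * (geo i * (j + k.+1 <= i)%N%:R)).
    apply: eq_bigr => i _; apply: eq_bigr => j _; rewrite /bkernel /dist.
    have := natdist_cases i j k.
    move=> /(congr1 (fun n => n%:R : R)); rewrite !natrD.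
    set a := (_ <= k)%N%:R; set b := (_ <= j)%N%:R; set c := (_ <= i)%N%:R => e.
    have -> : a = 1 - b - c by lra.
    by ring.
  transitivity ((\sum_i geo i) * (\sum_j geo j) - T - T); last by rewrite sum_geo; ring.
  under eq_bigr do rewrite !sumrB.
  rewrite !sumrB; congr (_ - _ - _).
  - by rewrite mulr_suml; apply: eq_bigr => i _; rewrite mulr_sumr.
  - by apply: eq_bigr => i _; rewrite mulr_sumr.
  - by rewrite exchange_big /=; apply: eq_bigr => i _; rewrite mulr_sumr.
have Tb : `|T - r ^+ k / 2| <= 4 * h.
  have T1 : `|T - r ^+ k.+1 * \sum_j geo j * r ^+ j| <= h.
    rewrite (_ : _ - _ = \sum_j geo j * (\sum_i geo i * (j + k.+1 <= i)%N%:R - r ^+ (j + k.+1))).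
      by apply: norm_mean_le => // j; exact: geo_tail.
    rewrite mulr_sumr -sumrB; apply: eq_bigr => j _.
    by rewrite exprD; ring.
  move: T1 B0; set B := \sum_j geo j * r ^+ j => T1 B0.
  have : `|r ^+ k.+1 * B - r ^+ k / 2| <= 3 * h.
    rewrite (_ : _ - _ = r ^+ k * (r * B - 1 / 2)); last by rewrite exprS; field.
    rewrite normrM (ger0_norm q0); apply: (@le_trans _ _ `|r * B - 1 / 2|).
      by rewrite ler_piMl.
    by move: B0; rewrite !ler_norml => /andP[? ?]; apply/andP; split; nra.
  by move: T1; rewrite !ler_norml => /andP[? ?] /andP[? ?]; apply/andP; split; lra.
have projE : proj (@bkernel R N) geo k = 2 * (\sum_j geo j * r ^+ dist k j) + A.
  rewrite /A /proj mulrDl mul1r -!big_split/=; apply: eq_bigr => i _.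
  rewrite -(sum_dist_kernel k i) mulr_sumr -!big_split/=; apply: eq_bigr => j _.
  have -> : bkernel R i k j = bkernel R k i j by rewrite /bkernel /dist addnC.
  by ring.
rewrite projE AT -rXE.
move: Bk Tb; rewrite !ler_norml => /andP[? ?] /andP[? ?]; apply/andP; split; lra.
Qed.

End geometric_model.

(** * Integrals against Pareto laws *)

Section pareto_tail.
Variable R : realType.
Local Notation mu := (@lebesgue_measure R).
Implicit Types (a x y alpha c : R).

(** From 1 + y <= 3 exp(y / 3), cubed. *)
Lemma pol2_expRN_le y : 0 <= y -> (1 + y) ^+ 2 * expR (- y) <= 27 / (1 + y).
Proof.
move=> y0; have h := expR_ge1Dx (y / 3).
have e : expR y = expR (y / 3) ^+ 3.
  by rewrite -expRM_natl; congr expR; field.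
rewrite expRN ler_pdivrMr ?expR_gt0// mulrAC ler_pdivlMr; last lra.
rewrite -exprSr e.
have : (1 + y) ^+ 3 <= (3 * expR (y / 3)) ^+ 3.
  by apply: lerXn2r; rewrite ?nnegrE; have := expR_gt0 (y / 3); lra.
by rewrite exprMn; lra.
Qed.

Lemma paretoE alpha x : 1 <= x -> pareto alpha x = alpha / x * expR (- (alpha * ln x)).
Proof.
move=> x1; have x0 : 0 < x by lra.
rewrite /pareto opprD powRD ?(gt_eqF x0) ?implybT//.
rewrite -mulrA [X in _ = _ * X]mulrC; congr (_ * (_ * _)).
  by rewrite /powR gt_eqF// mulNr.
by rewrite powR_inv1// ltW.
Qed.

(** The incomplete gamma integral of (A v^2 + B v + C) exp(-c v) over v >= y. *)
Definition gamma2 (A B C c y : R) : R :=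
  expR (- (c * y)) * (A * (y ^+ 2 / c + 2 * y / c ^+ 2 + 2 / c ^+ 3)
    + B * (y / c + 1 / c ^+ 2) + C / c).

Lemma gamma2_bound A B C c y : 0 <= A -> 0 <= B -> 0 <= C -> 1 <= c -> 0 <= y ->
  0 <= gamma2 A B C c y <= (2 * A + B + C) * (27 / (1 + y)).
Proof.
move=> A0 B0 C0 c1 y0; have c0 : 0 < c by lra.
have i1 : c^-1 <= 1 by rewrite invf_le1.
have i0 : 0 <= c^-1 by rewrite invr_ge0 ltW.
have i2 : c ^- 2 <= 1 by rewrite -exprVn exprn_ile1.
have i3 : c ^- 3 <= 1 by rewrite -exprVn exprn_ile1.
have i20 : 0 <= c ^- 2 by rewrite -exprVn exprn_ge0.
have i30 : 0 <= c ^- 3 by rewrite -exprVn exprn_ge0.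
have y2 := sqr_ge0 y.
have a0 : 0 <= y ^+ 2 / c + 2 * y / c ^+ 2 + 2 / c ^+ 3.
  by rewrite !addr_ge0// !mulr_ge0.
have b0 : 0 <= y / c + 1 / c ^+ 2 by rewrite !addr_ge0// !mulr_ge0.
have a1 : y ^+ 2 / c + 2 * y / c ^+ 2 + 2 / c ^+ 3 <= 2 * (1 + y) ^+ 2.
  have ? : y ^+ 2 / c <= y ^+ 2 by rewrite ler_piMr.
  have ? : 2 * y / c ^+ 2 <= 2 * y by rewrite ler_piMr// mulr_ge0.
  by have ? : 2 / c ^+ 3 <= 2 := ler_piMr (ler0n _ 2) i3; lra.
have b1 : y / c + 1 / c ^+ 2 <= (1 + y) ^+ 2.
  have ? : y / c <= y by rewrite ler_piMr.
  by lra.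
have d1 : C / c <= C * (1 + y) ^+ 2.
  by rewrite ler_wpM2l//; have : c^-1 <= (1 + y) ^+ 2 by lra.
have {}a1 := ler_wpM2l A0 a1; have {}b1 := ler_wpM2l B0 b1.
have {}a0 := mulr_ge0 A0 a0; have {}b0 := mulr_ge0 B0 b0.
have d0 : 0 <= C / c by rewrite mulr_ge0.
rewrite /gamma2; apply/andP; split; first by rewrite mulr_ge0 ?expR_ge0 ?addr_ge0.
apply: (@le_trans _ _ (expR (- y) * ((2 * A + B + C) * (1 + y) ^+ 2))); last first.
  by rewrite mulrCA ler_wpM2l 1?mulrC ?pol2_expRN_le//; lra.
apply: ler_pM; rewrite ?expR_ge0 ?addr_ge0//; last by lra.
by rewrite ler_expR lerN2 ler_peMl.
Qed.

(** With v = alpha ln x the Pareto density becomes exp(-v), and [- gamma2] composed with v is an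
    antiderivative. Nonnegative coefficients give the sign required by the fundamental theorem on a
    half-line; signed combinations come later by linearity. *)
Lemma integral_pareto_pol2 alpha (A B C c a : R) : 0 < alpha -> 1 <= c -> 1 <= a ->
  0 <= A -> 0 <= B -> 0 <= C ->
  (\int[mu]_(x in `[a, +oo[) ((A * (alpha * ln x) ^+ 2 + B * (alpha * ln x) + C)
     * expR (- ((c - 1) * (alpha * ln x))) * pareto alpha x)%:E
   = (gamma2 A B C c (alpha * ln a))%:E)%E.
Proof.
move=> al0 c1 a1 A0 B0 C0.
pose f x : R := (A * (alpha * ln x) ^+ 2 + B * (alpha * ln x) + C)
     * expR (- (c * (alpha * ln x))) * (alpha / x).
pose F x : R := - gamma2 A B C c (alpha * ln x).
have Y0 x : 1 <= x -> 0 <= alpha * ln x by move=> x1; rewrite mulr_ge0 ?ln_ge0// ltW.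
have dF x : a <= x -> is_derive x 1 F (f x).
  move=> ax; have x0 : 0 < x by lra.
  have ? := is_derive1_ln x0.
  rewrite /F /gamma2; apply: is_derive_eq; rewrite /f /GRing.scale/=.
  by field; rewrite !gt_eqF//; lra.
have df x : a <= x -> derivable f x 1.
  move=> ax; have x0 : 0 < x by lra.
  have ? := is_derive1_ln x0.
  have ? : is_derive x 1 (fun x : R => x^-1) (- x ^- 2 * 1).
    apply: is_deriveV; rewrite gt_eqF//.
  exact: ex_derive.
transitivity (\int[mu]_(x in `[a, +oo[) (f x)%:E)%E.
  apply: eq_integral => x; rewrite inE/= in_itv/= andbT => ax.
  have x1 : 1 <= x by lra.
  rewrite paretoE// /f; congr EFin.
  rewrite (_ : - (c * _) = - ((c - 1) * (alpha * ln x)) + - (alpha * ln x)); last by ring.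
  by rewrite expRD; ring.
have -> : (gamma2 A B C c (alpha * ln a))%:E = (0%:E - (F a)%:E)%E.
  by rewrite /F -EFinN opprK add0e.
apply: ge0_continuous_FTC2y.
- move=> x ax; have y0 : 0 <= alpha * ln x by apply: Y0; lra.
  rewrite /f; apply: mulr_ge0; last by rewrite divr_ge0; lra.
  apply: mulr_ge0; last exact: expR_ge0.
  by rewrite !addr_ge0// mulr_ge0// sqr_ge0.
- have h : {in `[a, +oo[, forall x, derivable f x 1} by move=> x; rewrite in_itv/= andbT; exact: df.
  exact: (derivable_within_continuous h).
- apply/cvgrPdist_le => e e0.
  pose K := 2 * A + B + C + 1.
  have K0 : 0 < K by rewrite /K; lra.
  near=> x.
  have xa : expR (27 * K / e / alpha) <= x by near: x; exact: nbhs_pinfty_ge.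
  have x1 : 1 <= x.
    apply: le_trans xa; rewrite -[leLHS]expR0 ler_expR.
    exact: divr_ge0 (divr_ge0 (mulr_ge0 (ler0n R 27) (ltW K0)) (ltW e0)) (ltW al0).
  have Yx : 27 * K / e <= alpha * ln x.
    have : 27 * K / e / alpha <= ln x by rewrite -ler_expR lnK ?posrE//; lra.
    by rewrite ler_pdivrMr// [alpha * _]mulrC.
  set y := alpha * ln x in Yx *; have y0 : 0 <= y by exact: Y0.
  rewrite sub0r normrN /F normrN -/y.
  have /andP[g0 gK] := gamma2_bound A0 B0 C0 c1 y0.
  rewrite ger0_norm//; apply: le_trans gK _.
  apply: (@le_trans _ _ (K * (27 / (1 + y)))).
    by rewrite ler_wpM2r ?divr_ge0 ?addr_ge0// /K; lra.
  rewrite mulrA ler_pdivrMr; last lra.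
  by move: Yx; rewrite ler_pdivrMr//; nra.
- move=> x ax; have ? := dF x (ltW ax); exact: ex_derive.
- apply: cvg_at_right_filter; apply: differentiable_continuous.
  by apply/derivable1_diffP; have ? := dF a (lexx _); exact: ex_derive.
- move=> x; rewrite in_itv/= andbT => ax; have ? := dF x (ltW ax).
  by rewrite derive1E derive_val.
Unshelve. all: by end_near. Qed.

End pareto_tail.

(** * Cell probabilities of the Pareto laws *)

Section pareto_cells.
Variables (R : realType).
Local Notation mu := (@lebesgue_measure R).
Local Notation D := (`[1%R, +oo[%classic : set R).
Implicit Types (x a lam : R).

Lemma measurable_pareto lam : measurable_fun D (pareto lam).
Proof.
by apply: measurable_funM => //; apply: measurable_funTS; exact: measurable_powR.
Qed.

Lemma measurable_lnD : measurable_fun D (@ln R).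
Proof. by apply: measurable_funTS; exact: measurable_ln. Qed.

Lemma measurable_tail a : measurable_fun D (fun x => (a <= x)%R%:R : R).
Proof.
apply: (eq_measurable_fun (\1_(`[a, +oo[%classic : set R) : R -> R)).
  by move=> x _; rewrite indicE mem_setE/= in_itv/= andbT.
exact: measurable_indic.
Qed.

Lemma pareto_ge0 lam x : 0 < lam -> 0 <= pareto lam x.
Proof. by move=> l0; rewrite mulr_ge0 ?powR_ge0// ltW. Qed.

Lemma integral_pareto_tail lam a : 0 < lam -> 1 <= a ->
  (\int[mu]_(x in `[a, +oo[) (pareto lam x)%:E = (expR (- (lam * ln a)))%:E)%E.
Proof.
move=> l0 a1; have := @integral_pareto_pol2 R lam 0 0 1 1 a l0 (lexx _) a1 (lexx _) (lexx _) ler01.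
rewrite /gamma2 !mul0r !add0r mul1r divr1 mulr1 => <-.
by apply: eq_integral => x _; rewrite subrr !mul0r !add0r oppr0 expR0 !mul1r.
Qed.

Lemma pareto_integrable lam : 0 < lam -> mu.-integrable D (EFin \o pareto lam).
Proof.
move=> l0; apply/integrableP; split.
  by apply/measurable_EFinP; exact: measurable_pareto.
under eq_integral do rewrite /comp abse_EFin ger0_norm ?pareto_ge0//.
by rewrite integral_pareto_tail// ltey.
Qed.

Lemma Rintegral_pareto_tail lam a : 0 < lam -> 1 <= a ->
  Rintegral mu D (fun x => pareto lam x * (a <= x)%R%:R) = expR (- (lam * ln a)).
Proof.
move=> l0 a1; rewrite /Rintegral -[RHS]/(fine (_%:E)) -integral_pareto_tail//; congr fine.
rewrite (_ : `[a, +oo[%classic = D `&` `[a, +oo[%classic); last first.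
  apply/seteqP; split => x /=; rewrite !in_itv/= !andbT; last by case.
  by move=> ax; split => //; exact: le_trans ax.
rewrite integral_mkcondr; apply: eq_integral => x _.
rewrite /patch mem_setE/= in_itv/= andbT; case: ifP => _; first by rewrite mulr1.
by rewrite mulr0.
Qed.

Variables (N : nat) (lam : R).
Hypothesis N0 : (0 < N)%N.
Hypothesis lam0 : 0 < lam.
Local Notation I := 'I_(N ^ 2).+1.
Local Notation bin := (@bin R N lam).

(** Superlevel sets of the cell index are half-lines; this yields the measurability of the cells and
    their masses as differences of tails. *)
Lemma bin_ge x (j : nat) : 1 <= x -> (j <= N ^ 2)%N ->
  (j <= bin x)%N = (expR (j%:R / (N%:R * lam)) <= x).
Proof.
move=> x1 jm; rewrite binE inordK ?ltnS ?geq_minl// leq_min jm /=.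
have n0 : 0 < N%:R :> R by rewrite ltr0n.
rewrite truncn_ge_nat ?mulr_ge0 ?ln_ge0// ?(ltW lam0)//.
rewrite mulrA mulrC -ler_pdivrMr ?mulr_gt0//.
by rewrite -[in RHS](@lnK _ x) ?ler_expR// posrE; lra.
Qed.

Lemma bin_eqE x (k : I) : (bin x == k)%:R = (k <= bin x)%N%:R - (k < bin x)%N%:R :> R.
Proof.
rewrite -(inj_eq val_inj) /= eq_sym; case: ltngtP => /=; rewrite ?subr0 ?subrr//.
Qed.

Lemma bin_gt_max x : ((N ^ 2)%N < bin x)%N = false.
Proof. by apply/negbTE; rewrite -leqNgt -ltnS. Qed.

Lemma measurable_bin (k : I) : measurable_fun D (fun x => (bin x == k)%:R : R).
Proof.
have m1 (j : nat) : (j <= N ^ 2)%N -> measurable_fun D (fun x => (j <= bin x)%N%:R : R).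
  move=> jm; apply: eq_measurable_fun (measurable_tail (expR (j%:R / (N%:R * lam)))).
  by move=> x; rewrite inE/= in_itv/= andbT => x1; rewrite bin_ge.
apply: (eq_measurable_fun (fun x => (k <= bin x)%N%:R - (k < bin x)%N%:R : R)).
  by move=> x _; rewrite bin_eqE.
apply: measurable_funB; first by apply: m1; rewrite -ltnS.
have [km|mk] := ltnP k (N ^ 2); first exact: m1.
have -> : (k : nat) = (N ^ 2)%N by apply/eqP; rewrite eqn_leq mk -ltnS ltn_ord.
apply: (eq_measurable_fun (cst 0 : R -> R)) => // x _.
by rewrite bin_gt_max.
Qed.

(** Cells are cut on the scale of [lam], so the tail from cell j on is exp(-j/N) for every [lam].
    This is what makes the infimum in [Gn] harmless. *)
Lemma cell_pareto : cell bin (pareto lam) =1 @geo R N.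
Proof.
move=> k; have n0 : 0 < N%:R :> R by rewrite ltr0n.
have Q (j : nat) : (j <= N ^ 2)%N ->
    Rintegral mu D (fun x => pareto lam x * (j <= bin x)%N%:R) = expR (- N%:R^-1) ^+ j.
  move=> jm; transitivity (Rintegral mu D (fun x =>
    pareto lam x * (expR (j%:R / (N%:R * lam)) <= x)%R%:R)).
    by apply: eq_Rintegral => x; rewrite inE/= in_itv/= andbT => x1; rewrite bin_ge.
  rewrite Rintegral_pareto_tail//; last first.
    by rewrite -expR0 ler_expR divr_ge0 ?mulr_ge0// ltW.
  by rewrite expRK -expRM_natl; congr expR; field; rewrite !gt_eqF.
have iQ (j : nat) : (j <= N ^ 2)%N ->
    mu.-integrable D (EFin \o (fun x => pareto lam x * (j <= bin x)%N%:R)).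
  move=> jm; apply: (le_integrable _ _ _ (pareto_integrable lam0)) => //.
    apply/measurable_EFinP; apply: measurable_funM; first exact: measurable_pareto.
    apply: eq_measurable_fun (measurable_tail (expR (j%:R / (N%:R * lam)))).
    by move=> x; rewrite inE/= in_itv/= andbT => x1; rewrite bin_ge.
  move=> x _; rewrite /comp !abse_EFin lee_fin normrM.
  by case: (j <= _)%N; rewrite ?normr1 ?normr0 ?mulr1// mulr0.
rewrite /cell /geo /tgeo.
have [km|mk] := ltnP k (N ^ 2).
  rewrite -(Q k (ltnW km)) -(Q _ km) -RintegralB//; [|exact: iQ (ltnW _)|exact: iQ].
  by apply: eq_Rintegral => x _; rewrite bin_eqE mulrBr.
have kE : (k : nat) = (N ^ 2)%N by apply/eqP; rewrite eqn_leq mk -ltnS ltn_ord.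
rewrite kE -(Q _ (leqnn _)); apply: eq_Rintegral => x _.
by rewrite bin_eqE kE bin_gt_max subr0.
Qed.

End pareto_cells.

(** * Functions of polynomial growth in the exponential variable *)

Section pareto_mean.
Variables (R : realType) (alpha : R).
Hypothesis al0 : 0 < alpha.
Local Notation mu := (@lebesgue_measure R).
Local Notation D := (`[1%R, +oo[%classic : set R).
Implicit Types (f g : R -> R) (x c K : R) (d e : nat).

Definition lscale x := alpha * ln x.

Definition mean f := Rintegral mu D (fun x => f x * pareto alpha x).

Definition summable f := mu.-integrable D (EFin \o (fun x => f x * pareto alpha x)).

(** A class closed under sums and products in which integrability can be read off the degree, so
    that each later side condition is a degree count. *)
Definition tame d f := measurable_fun D f /\
  exists2 K, 0 <= K & forall x, 1 <= x -> `|f x| <= K * (1 + lscale x) ^+ d.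

Lemma lscale_ge0 x : 1 <= x -> 0 <= lscale x.
Proof. by move=> x1; rewrite mulr_ge0 ?ln_ge0// ltW. Qed.

Lemma tame_lscale : tame 1 lscale.
Proof.
split; first by apply: measurable_funM => //; exact: measurable_lnD.
exists 1 => // x x1; have y0 := lscale_ge0 x1.
by rewrite ger0_norm// mul1r expr1; lra.
Qed.

Lemma tame_cst c d : tame d (fun=> c).
Proof.
split => //; exists `|c| => // x x1; rewrite ler_peMr// exprn_ege1//.
by have := lscale_ge0 x1; lra.
Qed.

Lemma tame_expRN c : 0 <= c -> tame 0 (fun x => expR (- (c * lscale x))).
Proof.
move=> c0; split.
  apply: measurableT_comp; first exact: measurable_expR.
  apply: measurable_funN; apply: measurable_funM => //.
  by case: tame_lscale.
exists 1 => // x x1; rewrite expr0 mulr1 ger0_norm ?expR_ge0//.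
by rewrite -expR0 ler_expR oppr_le0 mulr_ge0// lscale_ge0.
Qed.

Lemma tameM d e f g : tame d f -> tame e g -> tame (d + e) (fun x => f x * g x).
Proof.
move=> [mf [K K0 fK]] [mg [L L0 gL]]; split; first exact: measurable_funM.
exists (K * L); first exact: mulr_ge0.
move=> x x1; rewrite normrM exprD mulrACA; apply: ler_pM => //; [exact: fK|exact: gL].
Qed.

Lemma tameD d f g : tame d f -> tame d g -> tame d (fun x => f x + g x).
Proof.
move=> [mf [K K0 fK]] [mg [L L0 gL]]; split; first exact: measurable_funD.
exists (K + L); first exact: addr_ge0.
move=> x x1; rewrite mulrDl; apply: le_trans (ler_normD _ _) _.
by apply: lerD; [exact: fK|exact: gL].
Qed.

Lemma tameZ d c f : tame d f -> tame d (fun x => c * f x).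
Proof. by move=> tf; exact: tameM (tame_cst c 0) tf. Qed.

Lemma tame_le d e f : (d <= e)%N -> tame d f -> tame e f.
Proof.
move=> de [mf [K K0 fK]]; split => //; exists K => // x x1.
apply: le_trans (fK x x1) _; rewrite ler_wpM2l// ler_weXn2l//.
by have := lscale_ge0 x1; lra.
Qed.

Lemma tame_dom d f g : measurable_fun D f -> tame d g ->
  (forall x, 1 <= x -> `|f x| <= `|g x|) -> tame d f.
Proof.
move=> mf [_ [K K0 gK]] fg; split => //; exists K => // x x1.
exact: le_trans (fg x x1) (gK x x1).
Qed.

Lemma tame_norm d f : tame d f -> tame d (fun x => `|f x|).
Proof.
move=> tf; apply: (tame_dom _ tf) => [|x _]; last by rewrite normr_id.
by case: tf => mf _; exact: measurableT_comp.
Qed.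

Lemma tame_bin (I : finType) (B : R -> I) (H : I -> R) :
  (forall k, measurable_fun D (fun x => (B x == k)%:R : R)) -> tame 0 (fun x => H (B x)).
Proof.
move=> mB; split.
  apply: (eq_measurable_fun (fun x => \sum_k H k * (B x == k)%:R)).
    move=> x _; rewrite (bigD1 (B x))//= eqxx mulr1 big1 ?addr0// => k.
    by rewrite eq_sym => /negbTE ->; rewrite mulr0.
  by apply: measurable_sum => k; apply: measurable_funM.
exists (\sum_k `|H k|); first by rewrite sumr_ge0.
move=> x _; rewrite expr0 mulr1 (bigD1 (B x))//= lerDl sumr_ge0//.
Qed.

Lemma pol4_expR : exists2 M : R, 0 <= M & forall y : R, 0 <= y ->
  (1 + y) ^+ 4 <= M * expR (y / 2).
Proof.
exists (8 ^+ 4) => [|y y0]; first exact: exprn_ge0.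
have e8 := expR_ge1Dx (y / 8).
have -> : y / 2 = 4%:R * (y / 8) by field.
by rewrite expRM_natl -exprMn lerXn2r ?nnegrE//; lra.
Qed.

(** Half of the exponential decay absorbs the fourth power; the other half leaves a multiple of the
    Pareto density of parameter alpha / 2. *)
Lemma tame_summable f : tame 4 f -> summable f.
Proof.
move=> [mf [K K0 fK]]; have [M M0 hM] := pol4_expR.
have a20 : 0 < alpha / 2 by rewrite divr_gt0.
have i2 : mu.-integrable D
    (fun x => (K * M * 2)%:E * (EFin \o pareto (alpha / 2)) x)%E.
  by apply: integrableZl => //; exact: pareto_integrable.
apply: (le_integrable _ _ _ i2) => //.
  by apply/measurable_EFinP; apply: measurable_funM => //; exact: measurable_pareto.
move=> x /=; rewrite in_itv/= andbT => x1.
have y0 := lscale_ge0 x1.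
have pg := pareto_ge0 x al0; have pg2 := pareto_ge0 x a20.
rewrite lee_fin normrM (ger0_norm pg).
rewrite [leRHS]ger0_norm; last by apply: mulr_ge0 pg2; rewrite !mulr_ge0.
rewrite !paretoE//.
set y := lscale x in y0 *.
have -> : alpha / 2 * ln x = y / 2 by rewrite /y /lscale; field.
have -> : expR (- (alpha * ln x)) = expR (- (y / 2)) * expR (- (y / 2)).
  by rewrite -expRD; congr expR; rewrite /y /lscale; field.
have h := hM y y0.
have ax : 0 <= alpha / x by rewrite divr_ge0; lra.
have e0 := expR_ge0 (- (y / 2)).
have hK : `|f x| * expR (- (y / 2)) <= K * M.
  rewrite expRN ler_pdivrMr ?expR_gt0//; apply: le_trans (fK x x1) _.
  by rewrite -/y -mulrA ler_wpM2l.
have -> : `|f x| * (alpha / x * (expR (- (y / 2)) * expR (- (y / 2)))) =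
  (`|f x| * expR (- (y / 2))) * (alpha / x * expR (- (y / 2))) by ring.
have -> : K * M * 2 * (alpha / 2 / x * expR (- (y / 2))) =
  (K * M) * (alpha / x * expR (- (y / 2))) by field; lra.
by rewrite ler_wpM2r// mulr_ge0.
Qed.

Lemma meanD f g : summable f -> summable g -> mean (fun x => f x + g x) = mean f + mean g.
Proof.
move=> sf sg; rewrite /mean -RintegralD//.
by apply: eq_Rintegral => x _; rewrite mulrDl.
Qed.

Lemma meanZ c f : summable f -> mean (fun x => c * f x) = c * mean f.
Proof.
move=> sf; rewrite /mean -RintegralZl//.
by apply: eq_Rintegral => x _; rewrite mulrA.
Qed.

Lemma eq_mean f g : (forall x, 1 <= x -> f x = g x) -> mean f = mean g.
Proof.
move=> fg; apply: eq_Rintegral => x; rewrite inE/= in_itv/= andbT => x1.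
by rewrite fg.
Qed.

Lemma mean_le f g : summable f -> summable g -> (forall x, 1 <= x -> f x <= g x) ->
  mean f <= mean g.
Proof.
move=> sf sg fg; apply: le_Rintegral => // x /=; rewrite in_itv/= andbT => x1.
by rewrite ler_wpM2r ?pareto_ge0// fg.
Qed.

Lemma mean_moment (A B C c : R) : 0 <= A -> 0 <= B -> 0 <= C -> 0 <= c ->
  mean (fun x => (A * lscale x ^+ 2 + B * lscale x + C) * expR (- (c * lscale x))) =
  gamma2 A B C (c + 1) 0.
Proof.
move=> A0 B0 C0 c0; have c1 : 1 <= c + 1 by lra.
have := @integral_pareto_pol2 R alpha A B C (c + 1) 1 al0 c1 (lexx _) A0 B0 C0.
by rewrite ln1 mulr0 addrK /mean /Rintegral => ->.
Qed.

End pareto_mean.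

(** * The score of the alternatives *)

Section score.
Variables (R : realType) (alpha : R).
Hypothesis al0 : 0 < alpha.
Local Notation mu := (@lebesgue_measure R).
Local Notation D := (`[1%R, +oo[%classic : set R).
Local Notation Y := (lscale alpha).
Local Notation mean := (mean alpha).
Local Notation summable := (summable alpha).
Local Notation tame := (tame alpha).
Implicit Types (x c : R).

Definition influence x := 1 + 2 * (Y x * expR (- Y x)).

(** The direction of the alternative relative to the Pareto density, in the exponential variable and
    with E = D / alpha. *)
Definition score (C E : R) x := C * (2 / 3 * (Y x * expR (- Y x)) - 1 / 6) + E * (Y x - 1).

Lemma tame_Yexp : tame 1 (fun x => Y x * expR (- Y x)).
Proof.
have := tameM (tame_lscale al0) (tame_expRN al0 ler01).
by under eq_fun do rewrite mul1r.
Qed.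

Lemma tame_influence : tame 1 influence.
Proof. by apply: tameD => //; [exact: tame_cst|apply: tameZ => //; exact: tame_Yexp]. Qed.

Lemma tame_score C E : tame 1 (score C E).
Proof.
apply: tameD => //; apply: tameZ => //; apply: tameD => //; last 2 first.
- exact: tame_lscale.
- exact: tame_cst.
- by apply: tameZ => //; exact: tame_Yexp.
- exact: tame_cst.
Qed.

(** The span of the products of any two among 1, Y and Y e^{-Y}, so that all first and second
    moments below are instances of one formula. *)
Definition poly6 (a0 a1 a2 b1 b2 c2 : R) x :=
  (a0 + a1 * Y x + a2 * Y x ^+ 2) + (b1 * (Y x * expR (- Y x)) +
   b2 * (Y x ^+ 2 * expR (- Y x)) + c2 * (Y x * expR (- Y x)) ^+ 2).

Lemma mean_poly6 a0 a1 a2 b1 b2 c2 :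
  mean (poly6 a0 a1 a2 b1 b2 c2) = a0 + a1 + 2 * a2 + b1 / 4 + b2 / 4 + 2 * c2 / 27.
Proof.
have tY := tame_lscale al0.
have t4 (d : nat) (f : R -> R) : (d <= 4)%N -> tame d f -> summable f.
  by move=> d4 /(tame_le al0 d4) /(tame_summable al0).
have tY2 : tame 2 (fun x => Y x ^+ 2) by have := tameM tY tY.
have te1 : tame 0 (fun x => expR (- Y x)).
  by have := tame_expRN al0 ler01; under eq_fun do rewrite mul1r.
have tYe2 : tame 2 (fun x => Y x ^+ 2 * expR (- Y x)) := tameM tY2 te1.
have tYee : tame 2 (fun x => (Y x * expR (- Y x)) ^+ 2) := tameM tame_Yexp tame_Yexp.
have tc (c : R) : tame 2 (fun=> c) := tame_cst al0 c 2.
have tY' : tame 2 Y := tame_le al0 (isT : (1 <= 2)%N) tY.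
have tYe' : tame 2 (fun x => Y x * expR (- Y x)) := tame_le al0 (isT : (1 <= 2)%N) tame_Yexp.
have s2 (f : R -> R) : tame 2 f -> summable f := @t4 2 f isT.
have tZ (c : R) (f : R -> R) : tame 2 f -> tame 2 (fun x => c * f x).
  exact: tameZ.
have tD (f g : R -> R) : tame 2 f -> tame 2 g -> tame 2 (fun x => f x + g x).
  exact: tameD.
rewrite /poly6 meanD; last 2 first.
- exact: s2 _ (tD _ _ (tD _ _ (tc _) (tZ a1 _ tY')) (tZ a2 _ tY2)).
- exact: s2 _ (tD _ _ (tD _ _ (tZ b1 _ tYe') (tZ b2 _ tYe2)) (tZ c2 _ tYee)).
rewrite meanD; last 2 first.
- exact: s2 _ (tD _ _ (tc _) (tZ a1 _ tY')).
- exact: s2 _ (tZ a2 _ tY2).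
rewrite meanD; last 2 first.
- exact: s2.
- exact: s2 _ (tZ a1 _ tY').
rewrite meanD; last 2 first.
- exact: s2 _ (tD _ _ (tZ b1 _ tYe') (tZ b2 _ tYe2)).
- exact: s2 _ (tZ c2 _ tYee).
rewrite meanD; last 2 first.
- exact: s2 _ (tZ b1 _ tYe').
- exact: s2 _ (tZ b2 _ tYe2).
rewrite (meanZ a1 (s2 _ tY')) (meanZ a2 (s2 _ tY2)) (meanZ b1 (s2 _ tYe')).
rewrite (meanZ b2 (s2 _ tYe2)) (meanZ c2 (s2 _ tYee)).
have mm (f : R -> R) (A B C c v : R) : 0 <= A -> 0 <= B -> 0 <= C -> 0 <= c ->
    (forall x, f x = (A * Y x ^+ 2 + B * Y x + C) * expR (- (c * Y x))) ->
    gamma2 A B C (c + 1) 0 = v -> mean f = v.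
  move=> A0 B0 C0 c0 fE <-; rewrite -(mean_moment al0)//.
  by apply: eq_mean => x _; rewrite fE.
have L0 : 0 <= 0 :> R by [].
have L1 : 0 <= 1 :> R by [].
have L2 : 0 <= 2 :> R by [].
have g2 (A B C c : R) : gamma2 A B C c 0 = A * (2 / c ^+ 3) + B * (1 / c ^+ 2) + C / c.
  by rewrite /gamma2 mulr0 oppr0 expR0 expr0n/=; ring.
have a0E : a0 = a0 * 1 by rewrite mulr1.
have -> : mean (fun=> a0) = a0 * mean (fun=> 1).
  rewrite -meanZ; last exact: s2 _ (tc 1).
  by apply: eq_mean => x _; rewrite mulr1.
have m1 : mean (fun=> 1) = 1.
  apply: (@mm _ 0 0 1 0 1 L0 L0 L1 L0) => [x|].
    rewrite !mul0r oppr0 expR0; ring.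
  by rewrite g2 add0r; field.
have m2 : mean (fun x => Y x) = 1.
  apply: (@mm _ 0 1 0 0 1 L0 L1 L0 L0) => [x|].
    rewrite !mul0r oppr0 expR0; ring.
  by rewrite g2 add0r; field.
have m3 : mean (fun x => Y x ^+ 2) = 2.
  apply: (@mm _ 1 0 0 0 2 L1 L0 L0 L0) => [x|].
    rewrite !mul0r oppr0 expR0; ring.
  by rewrite g2 add0r; field.
have m4 : mean (fun x => Y x * expR (- Y x)) = 1 / 4.
  apply: (@mm _ 0 1 0 1 (1 / 4) L0 L1 L0 L1) => [x|].
    rewrite [1 * Y x]mul1r; ring.
  by rewrite g2; field.
have m5 : mean (fun x => Y x ^+ 2 * expR (- Y x)) = 1 / 4.
  apply: (@mm _ 1 0 0 1 (1 / 4) L1 L0 L0 L1) => [x|].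
    rewrite [1 * Y x]mul1r; ring.
  by rewrite g2; field.
have m6 : mean (fun x => (Y x * expR (- Y x)) ^+ 2) = 2 / 27.
  apply: (@mm _ 1 0 0 2 (2 / 27) L1 L0 L0 L2) => [x|].
    rewrite (_ : - (2 * Y x) = - Y x + - Y x); last by ring.
    by rewrite expRD; ring.
  by rewrite g2; field.
rewrite m1 m2 m3 m4 m5 m6.
by field.
Qed.

End score.

Section score_moments.
Variables (R : realType) (alpha : R).
Hypothesis al0 : 0 < alpha.
Local Notation Y := (lscale alpha).
Local Notation mean := (mean alpha).
Local Notation score := (score alpha).
Local Notation influence := (influence alpha).
Implicit Types (x y C E theta : R).

Lemma galt_score C D theta x : 1 <= x ->
  galt alpha C D theta x = (1 + theta * score C (D / alpha) x) * pareto alpha x.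
Proof.
move=> x1; have x0 : 0 < x by lra.
have xa : x `^ alpha = expR (Y x) by rewrite /powR gt_eqF.
rewrite /galt /upsilon /pareto powRN xa /score -/(Y x) expRN.
have ? := expR_gt0 (Y x); have ? := powR_gt0 (alpha + 1) x0.
by field; rewrite !gt_eqF.
Qed.

Lemma mean_score C E : mean (score C E) = 0.
Proof.
rewrite (@eq_mean _ _ _ (poly6 alpha (- C / 6 - E) E 0 (2 * C / 3) 0 0)).
  by rewrite mean_poly6//; field.
by move=> x _; rewrite /score /poly6; field.
Qed.

(** The part of the score along [upsilon] is orthogonal to Y: 2/3 E[Y^2 e^{-Y}] = 1/6 E[Y]. *)
Lemma mean_score_lscale C E : mean (fun x => score C E x * Y x) = E.
Proof.
rewrite (@eq_mean _ _ _ (poly6 alpha 0 (- C / 6 - E) E 0 (2 * C / 3) 0)).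
  by rewrite mean_poly6//; field.
by move=> x _; rewrite /score /poly6; field.
Qed.

Lemma mean_score_sqr C E : mean (fun x => score C E x ^+ 2) = 5 * C ^+ 2 / 972 + E ^+ 2.
Proof.
rewrite (@eq_mean _ _ _ (poly6 alpha (C ^+ 2 / 36 + C * E / 3 + E ^+ 2)
  (- C * E / 3 - 2 * E ^+ 2) (E ^+ 2) (- 2 * C ^+ 2 / 9 - 4 * C * E / 3)
  (4 * C * E / 3) (4 * C ^+ 2 / 9))).
  by rewrite mean_poly6//; field.
by move=> x _; rewrite /score /poly6; field.
Qed.

Lemma mean_score_influence C E : mean (fun x => score C E x * influence x) = 5 * C / 324.
Proof.
rewrite (@eq_mean _ _ _ (poly6 alpha (- C / 6 - E) E 0 (C / 3 - 2 * E) (2 * E) (4 * C / 3))).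
  by rewrite mean_poly6//; field.
by move=> x _; rewrite /score /influence /poly6; field.
Qed.

Lemma mean_influence : mean influence = 3 / 2.
Proof.
rewrite (@eq_mean _ _ _ (poly6 alpha 1 0 0 2 0 0)).
  by rewrite mean_poly6//; field.
by move=> x _; rewrite /influence /poly6; field.
Qed.

Lemma mean_influence_sqr : mean (fun x => influence x ^+ 2) = 62 / 27.
Proof.
rewrite (@eq_mean _ _ _ (poly6 alpha 1 0 0 4 0 4)).
  by rewrite mean_poly6//; field.
by move=> x _; rewrite /influence /poly6; field.
Qed.

Lemma yexp_ge0_le1 y : 0 <= y -> 0 <= y * expR (- y) <= 1.
Proof.
move=> y0; rewrite mulr_ge0 ?expR_ge0//= expRN ler_pdivrMr ?expR_gt0// mul1r.
by have := expR_ge1Dx y; lra.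
Qed.

Lemma yexp_lipschitz (a b : R) : 0 <= a -> a <= b ->
  `|a * expR (- a) - b * expR (- b)| <= b - a.
Proof.
move=> a0 ab; have b0 : 0 <= b by lra.
have ea : expR (- a) <= 1 by rewrite -expR0 ler_expR; lra.
have eb : expR (- b) <= 1 by rewrite -expR0 ler_expR; lra.
have ea0 := expR_ge0 (- a); have eb0 := expR_ge0 (- b).
have e1 : expR (- b) = expR (- a) * expR (- (b - a)) by rewrite -expRD; congr expR; ring.
have e2 := expR_ge1Dx (- (b - a)).
have /andP[_ y1] := yexp_ge0_le1 a0.
have le : expR (- a) - expR (- b) <= expR (- a) * (b - a) by rewrite e1; nra.
have ge : 0 <= expR (- a) - expR (- b) by rewrite subr_ge0 ler_expR; lra.
have h1 : a * (expR (- a) - expR (- b)) <= b - a.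
  apply: (@le_trans _ _ (a * expR (- a) * (b - a))).
    by rewrite -mulrA ler_wpM2l.
  by rewrite ler_piMl// subr_ge0.
have h2 : (b - a) * expR (- b) <= b - a by rewrite ler_piMr// subr_ge0.
have h3 : 0 <= a * (expR (- a) - expR (- b)) by rewrite mulr_ge0.
have h4 : 0 <= (b - a) * expR (- b) by rewrite mulr_ge0// subr_ge0.
by rewrite ler_norml; apply/andP; split; lra.
Qed.

Lemma yexp_tail y : 0 < y -> 0 <= y * expR (- y) <= 2 / y.
Proof.
move=> y0; rewrite mulr_ge0 ?expR_ge0 ?(ltW y0)//= expRN ler_pdivrMr ?expR_gt0//.
have := @expR_ge1Dxn R y 1 (ltW y0); rewrite (_ : 2`!%:R = 2)// => h.
by rewrite mulrAC ler_pdivlMr//; lra.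
Qed.

End score_moments.

(** * Limits of the binned quantities as the mesh is refined *)

Section limits.
Variables (R : realType) (alpha : R).
Hypothesis al0 : 0 < alpha.
Local Notation D := (`[1%R, +oo[%classic : set R).
Local Notation Y := (lscale alpha).
Local Notation mean := (mean alpha).
Local Notation influence := (influence alpha).
Variable N : nat.
Hypothesis N0 : (0 < N)%N.
Local Notation I := 'I_(N ^ 2).+1.
Local Notation bin := (@bin R N alpha).
Local Notation gproj := (proj (@bkernel R N) (@geo R N)).
Implicit Types (x : R) (k : I).

Let n0 : 0 < N%:R :> R. Proof. by rewrite ltr0n. Qed.

Lemma influence_bnd x : 1 <= x -> 1 <= influence x <= 3.
Proof.
move=> x1; have := yexp_ge0_le1 (lscale_ge0 al0 x1); rewrite /influence => /andP[? ?].
by apply/andP; split; lra.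
Qed.

Lemma proj_influence x : 1 <= x -> `|gproj (bin x) - influence x| <= 28 / N%:R.
Proof.
move=> x1; have := proj_geo R N0 (bin x).
set q := (bin x)%:R / N%:R => h.
have y0 := lscale_ge0 al0 x1.
suff : `|q * expR (- q) - Y x * expR (- Y x)| <= 4 / N%:R.
  move: h; rewrite /influence !ler_norml => /andP[? ?] /andP[? ?].
  by apply/andP; split; lra.
(* In a bounded cell the two arguments differ by at most 1/N and y exp(-y) is 1-Lipschitz; in the
   overflow cell both are at least N, where y exp(-y) <= 2/y. *)
have [xm|xm] := eqVneq (bin x) ord_max; last first.
  have /andP[b1 b2] := bin_itv N0 al0 x1 xm.
  have qy : q <= Y x by rewrite /q ler_pdivrMr// mulrC.
  have yq : Y x <= q + 1 / N%:R.
    by rewrite /q -mulrDl ler_pdivlMr// mulrC ltW.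
  have q0 : 0 <= q by rewrite divr_ge0.
  apply: le_trans (yexp_lipschitz q0 qy) _.
  have : 0 <= 1 / N%:R :> R by rewrite divr_ge0.
  by lra.
have qE : q = N%:R.
  by rewrite /q xm /= natrX expr2 mulfK// gt_eqF.
have yN : N%:R <= Y x.
  have := bin_ge N0 al0 x1 (leqnn (N ^ 2)); rewrite xm leqnn => /esym.
  rewrite natrX expr2 -mulrA -{1}(@lnK _ x) ?posrE ?ler_expR; last lra.
  rewrite invfM (mulrA N%:R N%:R^-1) divff ?gt_eqF// mul1r ler_pdivrMr//.
  by rewrite mulrC.
have /andP[a1 a2] := yexp_tail n0.
have /andP[b1 b2] := yexp_tail (lt_le_trans n0 yN).
have : 2 / Y x <= 2 / N%:R by rewrite ler_pM2l// lef_pV2 ?posrE ?(lt_le_trans n0 yN).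
by rewrite qE ler_norml => ?; apply/andP; split; lra.
Qed.

End limits.

Section geometric_limits.
Variables (R : realType) (alpha : R).
Hypothesis al0 : 0 < alpha.
Local Notation mu := (@lebesgue_measure R).
Local Notation D := (`[1%R, +oo[%classic : set R).
Local Notation Y := (lscale alpha).
Local Notation mean := (mean alpha).
Local Notation summable := (summable alpha).
Local Notation tame := (tame alpha).
Local Notation influence := (influence alpha).
Implicit Types (f g : R -> R).

Lemma summableZ (c : R) f : summable f -> summable (fun x => c * f x).
Proof.
move=> sf; have : mu.-integrable D
    (fun x => c%:E * (EFin \o (fun x => f x * pareto alpha x)%R) x)%E.
  exact: integrableZl.
by apply: eq_integrable => // x _; rewrite /comp -EFinM mulrA.
Qed.

Lemma summableD f g : summable f -> summable g -> summable (fun x => f x + g x).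
Proof.
move=> sf sg; have : mu.-integrable D ((EFin \o (fun x => f x * pareto alpha x)%R)
    \+ (EFin \o (fun x => g x * pareto alpha x)%R))%E.
  exact: integrableD.
by apply: eq_integrable => // x _; rewrite /= -EFinD mulrDl.
Qed.

Lemma mean_norm_le f g : summable f -> summable g -> (forall x, 1 <= x -> `|f x| <= g x) ->
  `|mean f| <= mean g.
Proof.
move=> sf sg fg; rewrite ler_norml -mulN1r -meanZ//; apply/andP; split; apply: mean_le => //.
- exact: summableZ.
- by move=> x x1; rewrite mulN1r lerNl; have := fg x x1; rewrite ler_norml => /andP[]; lra.
- by move=> x x1; have := fg x x1; rewrite ler_norml => /andP[].
Qed.

Lemma mean_dist_le f g (c : R) : summable f -> summable g ->
  (forall x, 1 <= x -> `|f x - g x| <= c) -> `|mean f - mean g| <= c.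
Proof.
move=> sf sg fg.
have s1 (d : R) : summable (fun=> d) by apply: tame_summable => //; exact: tame_cst.
have m1 (d : R) : mean (fun=> d) = d.
  rewrite (@eq_mean _ _ _ (poly6 alpha d 0 0 0 0 0)); first by rewrite mean_poly6//; field.
  by move=> x _; rewrite /poly6; ring.
have sgd (d : R) : summable (fun x => g x + d).
  exact: summableD.
have h1 : mean f <= mean g + c.
  rewrite -[X in _ + X](m1 c) -meanD//; apply: mean_le => // x /fg.
  by rewrite ler_norml => /andP[]; lra.
have h2 : mean g + (- c) <= mean f.
  rewrite -[X in _ + X](m1 (- c)) -meanD//; apply: mean_le => // x /fg.
  by rewrite ler_norml => /andP[]; lra.
by rewrite ler_norml; apply/andP; split; lra.
Qed.

Variable N : nat.
Hypothesis N0 : (0 < N)%N.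
Local Notation I := 'I_(N ^ 2).+1.
Local Notation bin := (@bin R N alpha).
Local Notation geo := (@geo R N).
Local Notation tau := (tau (@bkernel R N)).
Local Notation gproj := (proj (@bkernel R N) geo).
Implicit Types (x : R) (k : I) (H : I -> R).

Let n0 : 0 < N%:R :> R. Proof. by rewrite ltr0n. Qed.

Let mB := measurable_bin N0 al0.

Let gp : prob geo := geo_prob R N0.

Lemma tame_binE H : tame 0 (fun x => H (bin x)).
Proof. exact: tame_bin. Qed.

Definition wcell (C E : R) k := cell bin (fun x => score alpha C E x * pareto alpha x) k.

Lemma sum_geo_mean H : \sum_k geo k * H k = mean (fun x => H (bin x)).
Proof.
transitivity (\sum_k cell bin (pareto alpha) k * H k).
  by apply: eq_bigr => k _; rewrite cell_pareto.
rewrite -(Rintegral_bin mB H (pareto_integrable al0)).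
by apply: eq_Rintegral => x _; rewrite mulrC.
Qed.

Lemma summable_score C E : summable (score alpha C E).
Proof. by apply: tame_summable => //; apply: tame_le (tame_score al0 C E). Qed.

Lemma sum_wcell_mean C E H : \sum_k wcell C E k * H k =
  mean (fun x => score alpha C E x * H (bin x)).
Proof.
rewrite /wcell -(Rintegral_bin mB H (summable_score C E)).
by apply: eq_Rintegral => x _; rewrite mulrAC.
Qed.

Let tame_s4 (d : nat) f : (d <= 4)%N -> tame d f -> summable f.
Proof. by move=> d4 tf; apply: tame_summable => //; exact: tame_le tf. Qed.

Lemma cell_galt C E theta k :
  cell bin (galt alpha C E theta) k = geo k + theta * wcell C (E / alpha) k.
Proof.
have ind (w : I -> R) : w k = \sum_j w j * (j == k)%:R.
  rewrite (bigD1 k)//= eqxx mulr1 big1 ?addr0// => j /negbTE ->.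
  by rewrite mulr0.
rewrite (ind geo) sum_geo_mean (ind (wcell _ _)) sum_wcell_mean -meanZ//; last first.
  apply: (@tame_s4 1) => //.
  exact: tameM (tame_score al0 _ _) (tame_binE (fun j => (j == k)%:R)).
rewrite -meanD.
- apply: eq_Rintegral => x; rewrite inE/= in_itv/= andbT => x1.
  by rewrite galt_score//; ring.
- by apply: (@tame_s4 0) => //; exact: (tame_binE (fun j => (j == k)%:R)).
- apply: (@tame_s4 1) => //; apply: tameZ => //.
  exact: tameM (tame_score al0 _ _) (tame_binE (fun j => (j == k)%:R)).
Qed.

Let mean_proj : `|\sum_k geo k * gproj k - 3 / 2| <= 28 / N%:R.
Proof.
rewrite sum_geo_mean -(mean_influence al0); apply: mean_dist_le.
- exact: tame_s4 (tame_binE _).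
- exact: tame_s4 (tame_influence al0).
- by move=> x x1; exact: proj_influence.
Qed.

(** Euler's identity for a cubic form: the mean projection is three times [tri] on the diagonal, and
    it is close to the mean 3/2 of the influence function. *)
Lemma tau_geo : `|tau geo| <= 28 / N%:R.
Proof.
have := mean_proj; rewrite sum_proj tauE; set t := tri _ _ _ _.
have : 0 <= 28 / N%:R :> R by rewrite divr_ge0.
by rewrite !ler_norml => ? /andP[? ?]; apply/andP; split; lra.
Qed.

Lemma cvar_geo : `|cvar (@bkernel R N) geo - 5 / 108| <= 336 / N%:R.
Proof.
pose M := \sum_k geo k * gproj k.
have -> : cvar (@bkernel R N) geo = \sum_k geo k * gproj k ^+ 2 - M ^+ 2.
  rewrite /cvar (eq_bigr (fun k => geo k * gproj k ^+ 2 +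
    (- (2 * M) * (geo k * gproj k) + M ^+ 2 * geo k))).
    rewrite !big_split/= -!mulr_sumr gp.2 -/M; ring.
  by move=> k _; rewrite /cproj -/M; ring.
have h1 := mean_proj; rewrite -/M in h1.
have pr3 k : `|gproj k| <= 3 by apply: proj_le3 => // *; exact: bkernel_le1.
have M3 : `|M| <= 3 by exact: norm_mean_le.
have h2 : `|\sum_k geo k * gproj k ^+ 2 - 62 / 27| <= 168 / N%:R.
  rewrite (sum_geo_mean (fun k => gproj k ^+ 2)) -(mean_influence_sqr al0).
  apply: mean_dist_le.
  - exact: tame_s4 (tame_binE (fun k => gproj k ^+ 2)).
  - exact: tame_s4 (tameM (tame_influence al0) (tame_influence al0)).
  - move=> x x1; have := proj_influence al0 N0 x1; have /andP[i1 i3] := influence_bnd al0 x1.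
    have := pr3 (bin x); rewrite subr_sqr normrM.
    move=> p3 d; rewrite (_ : 168 / N%:R = 28 / N%:R * 6); last by field; rewrite gt_eqF.
    apply: ler_pM => //; apply: le_trans (ler_normD _ _) _.
    by rewrite [X in _ + X]ger0_norm; lra.
have h3 : `|M ^+ 2 - 9 / 4| <= 168 / N%:R.
  rewrite (_ : 9 / 4 = (3 / 2) ^+ 2); last by field.
  rewrite subr_sqr normrM (_ : 168 / N%:R = 28 / N%:R * 6); last by field; rewrite gt_eqF.
  apply: ler_pM => //; apply: le_trans (ler_normD _ _) _.
  by rewrite [X in _ + X]ger0_norm; lra.
have e : 336 / N%:R = 168 / N%:R + 168 / N%:R :> R by field; rewrite gt_eqF.
move: h2 h3; rewrite e !ler_norml => /andP[? ?] /andP[? ?]; apply/andP; split; lra.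
Qed.

(** The derivative of [tau] along the alternative, hence the slope of b_T at 0; 5 C / 324 is C V /
    3. *)
Lemma wcell_proj C E : `|\sum_k wcell C E k * gproj k - 5 * C / 324| <=
  28 / N%:R * mean (fun x => `|score alpha C E x|).
Proof.
have ts := tame_score al0 C E; have tn := tame_norm ts.
rewrite sum_wcell_mean -(mean_score_influence al0 C E).
have t1 : tame 1 (fun x => score alpha C E x * gproj (bin x)).
  exact: tameM ts (tame_binE gproj).
have t2 : tame 2 (fun x => score alpha C E x * influence x).
  exact: tameM ts (tame_influence al0).
rewrite -meanZ; last exact: tame_s4 tn.
rewrite -[X in _ - X]mul1r -mulNr -meanZ; last exact: tame_s4 t2.
rewrite -meanD.
- apply: mean_norm_le.
  + by apply: (@tame_s4 2) => //; apply: tameD; [exact: tame_le t1|exact: tameZ].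
  + by apply: (@tame_s4 1) => //; apply: tameZ.
  + move=> x x1; have := proj_influence al0 N0 x1.
    by move=> h; rewrite mulN1r -mulrBr normrM [leRHS]mulrC ler_wpM2l.
- exact: tame_s4 t1.
- by apply: (@tame_s4 2) => //; apply: tameZ.
Qed.

Lemma wcell_l1 C E : l1 (wcell C E) <= mean (fun x => `|score alpha C E x|).
Proof.
have ts := tame_score al0 C E; have tn := tame_norm ts.
have -> : l1 (wcell C E) = \sum_k wcell C E k * Num.sg (wcell C E k).
  by apply: eq_bigr => k _; rewrite mulrC -normrEsg.
rewrite sum_wcell_mean; apply: (mean_le al0).
- apply: (@tame_s4 1) => //.
  exact: tameM ts (tame_binE (fun k => Num.sg (wcell C E k))).
- exact: tame_s4 tn.
- move=> x _; apply: le_trans (ler_norm _) _; rewrite normrM ler_piMr//.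
  by rewrite normr_sg; case: (_ == _).
Qed.

(** From |w| <= L + w^2 / L. The score may be unbounded, so the masses of [geo] alone do not control
    those of the alternative; a large L followed by a fine mesh makes both terms small. *)
Lemma wcell_le C E (L : R) k : 0 < L ->
  `|wcell C E k| <= L * geo k + mean (fun x => score alpha C E x ^+ 2) / L.
Proof.
move=> L0; have ts := tame_score al0 C E; have tn := tame_norm ts.
have ind (w : I -> R) : w k = \sum_j w j * (j == k)%:R.
  rewrite (bigD1 k)//= eqxx mulr1 big1 ?addr0// => j /negbTE ->.
  by rewrite mulr0.
have ti := tame_binE (fun j => (j == k)%:R).
have ts2 : tame 2 (fun x => score alpha C E x ^+ 2) := tameM ts ts.
rewrite (ind (wcell C E)) (ind geo) sum_geo_mean sum_wcell_mean.
have -> : mean (fun x => score alpha C E x ^+ 2) / L =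
    mean (fun x => L^-1 * score alpha C E x ^+ 2).
  by rewrite meanZ; [rewrite mulrC|exact: tame_s4 ts2].
rewrite -meanZ; last exact: tame_s4 ti.
rewrite -meanD; last 2 first.
- by apply: (@tame_s4 0) => //; exact: tameZ.
- by apply: (@tame_s4 2) => //; exact: tameZ.
apply: mean_norm_le.
- by apply: (@tame_s4 1) => //; exact: tameM ts ti.
- apply: (@tame_s4 2) => //; apply: tameD; last exact: tameZ.
  by apply: (tame_le al0 (isT : (0 <= 2)%N)); exact: tameZ.
- move=> x _; rewrite normrM -[_ ^+ 2]real_normK ?num_real//.
  have : `|score alpha C E x| <= L + L^-1 * `|score alpha C E x| ^+ 2.
    rewrite -(ler_pM2l L0) mulrDr mulVKf ?gt_eqF//.
    by have := normr_ge0 (score alpha C E x); nra.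
  have : 0 <= L^-1 * `|score alpha C E x| ^+ 2 by rewrite mulr_ge0 ?invr_ge0 ?sqr_ge0// ltW.
  by case: (_ == k); rewrite ?normr0 ?normr1 ?mulr0 ?mulr1; lra.
Qed.

End geometric_limits.

(** * Local expansion of the rate function *)

Section maximum.
Variables (R : realType) (I : finType).
Implicit Types nu : I -> R.

Definition fmax nu : R := \big[Num.max/0]_k nu k.

Lemma le_fmax nu k : nu k <= fmax nu.
Proof. exact: le_bigmax. Qed.

Lemma fmax_le nu (b : R) : 0 <= b -> (forall k, nu k <= b) -> fmax nu <= b.
Proof. by move=> b0 nb; apply/bigmax_leP; split. Qed.

Lemma fmax_ge0 nu : 0 <= fmax nu.
Proof. by rewrite /fmax; elim/big_rec : _ => // k x _ x0; rewrite le_max x0 orbT. Qed.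

End maximum.

Section small_deviations.
Variables (R : realType) (V : R).
Hypothesis V0 : 0 < V.
Let a := V^-1.
Let b := 2 * a.
(** Second-order correction of the tilt: s = a t + M t^2 gives s V = t + (180 b^2 + 1) t^2, which
    pays for the loss 180 s^2 <= 180 b^2 t^2 in [tau_tilt] and leaves a margin t^2. *)
Let M := a * (180 * b ^+ 2 + 1).

(** A common constant for the cubic errors of [rate_attained] and [rate_bound]; it depends on V
    only, not on the mesh. *)
Definition rate_const := 2 * M + 8 * b + 61 * b ^+ 2 + 216 * b ^+ 3.

(** After the range of [t]: the corrected tilt is at most b t, it is admissible, the entropies
    concerned stay well below 1, and [rate_perturb] applies with the variance bounded below by V /
    2. *)
Definition small_level (t : R) :=
  [/\ 0 < t <= 1, M * t <= a, b * t <= 1 / 12, a * t ^+ 2 / 2 + rate_const * t ^+ 3 <= 1 / 2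
   & 24 * (a * t ^+ 2 / 2 + rate_const * t ^+ 3) <= (V / 288) ^+ 2 / 2].

Let a0 : 0 < a. Proof. by rewrite invr_gt0. Qed.
Let aV : a * V = 1. Proof. by rewrite mulVf ?gt_eqF. Qed.
Let b0 : 0 < b. Proof. by rewrite mulr_gt0 ?a0. Qed.
Let M0 : 0 < M.
Proof.
apply: mulr_gt0; first exact: a0.
by have : 0 < b ^+ 2 by [rewrite exprn_gt0 ?b0]; lra.
Qed.

Lemma rate_const_gt0 : 0 < rate_const.
Proof.
have h2 : 0 < b ^+ 2 by rewrite exprn_gt0 ?b0.
have h3 : 0 < b ^+ 3 by rewrite exprn_gt0 ?b0.
by rewrite /rate_const; have := M0; have := b0; lra.
Qed.

Lemma small_level_near : exists2 t0, 0 < t0 & forall t, 0 < t < t0 -> small_level t.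
Proof.
have c0 := rate_const_gt0; have a0' := a0; have M0' := M0; have b0' := b0.
set C := rate_const in c0 *.
pose k := (V / 288) ^+ 2 / 2.
have k0 : 0 < k := divr_gt0 (exprn_gt0 2 (divr_gt0 V0 (ltr0Sn R 287))) (ltr0Sn R 1).
pose t0 := Num.min 1 (Num.min (a / M) (Num.min ((12 * b)^-1) (Num.min ((2 * (a / 2 + C))^-1)
  (k / (24 * (a / 2 + C)))))).
have d0 : 0 < 24 * (a / 2 + C) by rewrite mulr_gt0// addr_gt0// divr_gt0.
have e1 : 0 < a / M by exact: divr_gt0.
have e2 : 0 < (12 * b)^-1 by rewrite invr_gt0 mulr_gt0.
have e3 : 0 < (2 * (a / 2 + C))^-1 by rewrite invr_gt0 mulr_gt0// addr_gt0// divr_gt0.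
have e4 : 0 < k / (24 * (a / 2 + C)) by exact: divr_gt0.
exists t0; first by rewrite /t0 !lt_min ltr01 e1 e2 e3 e4.
move=> t /andP[t0'].
rewrite /t0 !lt_min => /andP[t1] /andP[tM] /andP[ta] /andP[ta2 tk].
have t2 : t ^+ 2 <= t by rewrite expr2 ler_piMl// ltW.
have t3 : t ^+ 3 <= t by rewrite exprS -[leRHS]mulr1 ler_pM2l//; lra.
split.
- by rewrite t0' ltW.
- by rewrite mulrC -ler_pdivlMr// ltW.
- by move: ta; rewrite -[(12 * b)^-1]mul1r ltr_pdivlMr ?mulr_gt0//; lra.
- have : t * (2 * (a / 2 + C)) < 1.
    by rewrite -ltr_pdivlMr ?mul1r// mulr_gt0// addr_gt0// divr_gt0.
  have : a * t ^+ 2 <= a * t by rewrite ler_pM2l.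
  have : C * t ^+ 3 <= C * t by rewrite ler_pM2l.
  by rewrite -/C; lra.
- have : t * (24 * (a / 2 + C)) < k by rewrite -ltr_pdivlMr.
  have : a * t ^+ 2 <= a * t by rewrite ler_pM2l.
  have : C * t ^+ 3 <= C * t by rewrite ler_pM2l.
  by rewrite -/C -/k; lra.
Qed.

Variables (I : finType) (kap : I -> I -> I -> R) (p : I -> R).
Hypothesis kap1 : forall i j k, `|kap i j k| <= 1.
Hypothesis p0 : forall i, 0 < p i.
Hypothesis p1 : \sum_i p i = 1.
Variables (t d : R).
Hypothesis ts : small_level t.
Hypothesis d0 : 0 < d.
Hypothesis dt : 30 * d <= t ^+ 2.
Hypothesis dV : 2 * d <= V.
Hypothesis taup : `|tau kap p| <= d.
Hypothesis cvarp : `|cvar kap p - V| <= d.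
Hypothesis pd : forall i, p i <= expR (- (2 / d)).

Lemma prob_kl_le nu i : prob nu -> kl nu p <= 1 -> nu i <= d.
Proof.
move=> nup K1; have := @prob_kl_bound _ _ nu p _ (2 / d) i nup p0 p1 pd.
rewrite -expRD addNr expR0 => h; have d0' := d0.
have : 2 / d * nu i <= 2 by lra.
by rewrite mulrAC ler_pdivrMr//; lra.
Qed.

Lemma rate_attained : exists q, [/\ prob q, forall i, 0 < q i,
  kl q p <= a * t ^+ 2 / 2 + rate_const * t ^+ 3, forall i, q i <= 2 * d &
  t + 15 * d <= tau kap q].
Proof.
have [/andP[t0 t1] Mt at1 at2 _] := ts.
have a0' := a0; have b0' := b0; have M0' := M0; have aV' := aV.
have d0' := d0; have dt' := dt; have dV' := dV.
have bt0 : 0 < b * t by rewrite mulr_gt0.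
pose s := a * t + M * t ^+ 2.
have t20 : 0 < t ^+ 2 by rewrite exprn_gt0.
have s0 : 0 < s by rewrite addr_gt0// mulr_gt0.
have s2 : s <= b * t.
  have : M * t * t <= a * t by rewrite ler_wpM2r// ltW.
  by rewrite /s expr2 /b; lra.
have s01 : 0 <= s <= 1 / 12 by rewrite (ltW s0)/=; lra.
have c36 := cvar_le kap1 p0 p1; have c0 := cvar_ge0 kap p0.
have pds i : p i <= d.
  apply: le_trans (pd i) _; rewrite expRN -[leRHS]invrK lef_pV2 ?posrE ?invr_gt0 ?expR_gt0//.
  by apply: le_trans (expR_ge1Dx _); have : 0 < d^-1 by [rewrite invr_gt0]; lra.
exists (tilt kap p s); split.
- exact: prob_tilt.
- by move=> i; exact: tilt_gt0.
- apply: le_trans (kl_tilt kap1 p0 p1 s01) _.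
  have t3 : 0 < t ^+ 3 by rewrite exprn_gt0.
  have h1 : s ^+ 2 * cvar kap p / 2 <= s ^+ 2 * (V + d) / 2.
    rewrite ler_pM2r// ler_pM2l ?exprn_gt0//.
    by move: cvarp; rewrite ler_norml => /andP[]; lra.
  have h2 : s ^+ 2 <= b ^+ 2 * t ^+ 2.
    rewrite (_ : b ^+ 2 * t ^+ 2 = (b * t) ^+ 2); last by ring.
    by rewrite lerXn2r ?nnegrE// ltW.
  have h3 : s ^+ 3 <= b ^+ 3 * t ^+ 3.
    rewrite (_ : b ^+ 3 * t ^+ 3 = (b * t) ^+ 3); last by ring.
    by rewrite lerXn2r ?nnegrE// ltW.
  have h4 : s ^+ 2 * d <= b ^+ 2 * t ^+ 3.
    apply: (@le_trans _ _ (b ^+ 2 * t ^+ 2 * t ^+ 2)).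
      apply: ler_pM => //; [exact: sqr_ge0|exact: ltW|lra].
    have t4 : t ^+ 2 * t ^+ 2 <= t ^+ 3 by rewrite -exprD (exprS t 3) ler_piMl// ltW.
    by rewrite -mulrA ler_pM2l ?exprn_gt0.
  have h5 : s ^+ 2 * V <= a * t ^+ 2 + 3 * M * t ^+ 3.
    have -> : s ^+ 2 * V = (a * V) * (a * t ^+ 2 + 2 * M * t ^+ 3) + M * V * (M * t * t ^+ 3).
      by rewrite /s; ring.
    have : M * V * (M * t * t ^+ 3) <= M * V * (a * t ^+ 3).
      apply: ler_wpM2l; first by rewrite mulr_ge0 ?(ltW V0) ?(ltW M0').
      by apply: ler_wpM2r; rewrite ?(ltW t3).
    have -> : M * V * (a * t ^+ 3) = (a * V) * (M * t ^+ 3) by ring.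
    by rewrite aV' !mul1r; lra.
  have a2 : 0 < b ^+ 2 * t ^+ 3 by rewrite mulr_gt0 ?exprn_gt0.
  have a3 : 0 < b ^+ 3 * t ^+ 3 by rewrite mulr_gt0 ?exprn_gt0.
  have a1 : 0 < b * t ^+ 3 by rewrite mulr_gt0.
  have a4 : 0 < M * t ^+ 3 by rewrite mulr_gt0.
  by rewrite /rate_const; lra.
- by move=> i; apply: le_trans (tilt_le kap1 p0 p1 i s01) _; have := pds i; lra.
(* The margin t^2 >= 30 d left by [M] covers the error d in tau p and the error s d from the
   variance. *)
- apply: le_trans (tau_tilt kap1 p0 p1 s01).
  have h2 : s ^+ 2 <= b ^+ 2 * t ^+ 2.
    rewrite (_ : b ^+ 2 * t ^+ 2 = (b * t) ^+ 2); last by ring.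
    by rewrite lerXn2r ?nnegrE// ltW.
  have h1 : s * V = t + (180 * b ^+ 2 + 1) * t ^+ 2.
    rewrite (_ : s * V = (a * V) * (t + (180 * b ^+ 2 + 1) * t ^+ 2)); last by rewrite /s /M; ring.
    by rewrite aV' mul1r.
  have h3 : s * (V - d) <= s * cvar kap p.
    by rewrite ler_pM2l//; move: cvarp; rewrite ler_norml => /andP[]; lra.
  have h4 : s * d <= d by rewrite ler_piMl// ?ltW//; lra.
  by move: taup; rewrite ler_norml => /andP[]; lra.
Qed.

(** [rate_lower] at s = a t, the maximiser of s t - s^2 V / 2. The term 120 s kl is cubic in [t]
    once kl <= a t^2 / 2; otherwise the claim is immediate. *)
Lemma rate_bound nu : prob nu -> t - d <= tau kap nu + 6 * fmax nu ->
  a * t ^+ 2 / 2 - rate_const * t ^+ 3 <= kl nu p.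
Proof.
move=> nup tn; have [/andP[t0 t1] Mt at1 at2 _] := ts.
have a0' := a0; have b0' := b0; have M0' := M0; have aV' := aV.
have d0' := d0; have dt' := dt; have dV' := dV; have C0 := rate_const_gt0.
have t3 : 0 < t ^+ 3 by rewrite exprn_gt0.
have C3 : 0 < rate_const * t ^+ 3 by rewrite mulr_gt0.
have [K1|K1] := ltP 1 (kl nu p); first by lra.
have nd : fmax nu <= d by apply: fmax_le => [|k]; [exact: ltW|exact: prob_kl_le].
have K0 := kl_ge0 nup p0 p1.
pose s := a * t.
have s0 : 0 < s by rewrite mulr_gt0.
have s01 : 0 <= s <= 1 / 12 by rewrite ltW//=; move: at1; rewrite /s /b; lra.
have h := rate_lower kap1 p0 p1 nup s01.
have h1 : s * (t - 8 * d) <= s * (tau kap nu - tau kap p).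
  by rewrite ler_pM2l//; move: taup; rewrite ler_norml => /andP[]; lra.
have h2 : s ^+ 2 * cvar kap p <= s ^+ 2 * (V + d).
  by rewrite ler_pM2l ?exprn_gt0//; move: cvarp; rewrite ler_norml => /andP[]; lra.
have h3 : s ^+ 2 * V = a * t ^+ 2.
  transitivity ((a * V) * (a * t ^+ 2)); first by rewrite /s; ring.
  by rewrite aV' mul1r.
have h4 : s * d <= s * t ^+ 2 by rewrite ler_pM2l//; lra.
have h5 : s * t ^+ 2 = a * t ^+ 3 by rewrite /s; ring.
have h6 : s ^+ 2 * d <= a ^+ 2 * t ^+ 3.
  apply: (@le_trans _ _ (s ^+ 2 * t ^+ 2)).
    by rewrite ler_pM2l ?exprn_gt0//; lra.
  rewrite /s exprMn -mulrA ler_pM2l ?exprn_gt0//.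
  by rewrite -exprD (exprS t 3) ler_piMl// ltW.
have h7 : s ^+ 3 = a ^+ 3 * t ^+ 3 by rewrite /s exprMn.
have h8 : s * t = a * t ^+ 2 by rewrite /s; ring.
have a2 : 0 < a ^+ 2 * t ^+ 3 by rewrite mulr_gt0 ?exprn_gt0.
have a3 : 0 < a ^+ 3 * t ^+ 3 by rewrite mulr_gt0 ?exprn_gt0.
have a1 : 0 < a * t ^+ 3 by rewrite mulr_gt0.
have a4 : 0 < M * t ^+ 3 by rewrite mulr_gt0.
have CE : rate_const * t ^+ 3 = 2 * (M * t ^+ 3) + 16 * (a * t ^+ 3)
    + 244 * (a ^+ 2 * t ^+ 3) + 216 * 8 * (a ^+ 3 * t ^+ 3).
  by rewrite /rate_const /b; ring.
have [Kl|Kl] := lerP (a * t ^+ 2 / 2) (kl nu p); first by lra.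
have h9 : kl nu p * s <= a ^+ 2 * t ^+ 3 / 2.
  rewrite (_ : a ^+ 2 * t ^+ 3 / 2 = (a * t ^+ 2 / 2) * s); last by rewrite /s; field.
  by rewrite ler_pM2r// ltW.
by rewrite CE; lra.
Qed.

Lemma rate_near nu (e : R) : prob nu -> t - d <= tau kap nu + 6 * fmax nu ->
  kl nu p <= a * t ^+ 2 / 2 + rate_const * t ^+ 3 + e ->
  0 < e -> 4 * e <= 1 -> 24 * e <= (V / 288) ^+ 2 / 2 -> 96 * (20 * e) <= V ->
  96 * (20 * d) <= e * V ->
  exists q, [/\ prob q, forall i, 0 < q i, kl q p <= kl nu p + e,
    forall i, q i <= d & t + 10 * d <= tau kap q].
Proof.
move=> nup tn Kn e0 e1 e2 e3 e4; have [/andP[t0 t1] Mt at1 at2 at3] := ts.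
have d0' := d0; have dV' := dV; have V0' := V0.
have nd : fmax nu <= d.
  by apply: fmax_le => [|k]; [exact: ltW|apply: prob_kl_le => //; lra].
have cv : V / 2 <= cvar kap p by move: cvarp; rewrite ler_norml => /andP[]; lra.
have K24 : 24 * kl nu p <= (cvar kap p / 144) ^+ 2.
  apply: (@le_trans _ _ ((V / 288) ^+ 2)); first by lra.
  by apply: lerXn2r; rewrite ?nnegrE; lra.
have e01 : 0 < e <= 1 by rewrite e0/=; lra.
have [q [qp q0 qK qt]] := rate_perturb kap1 p0 p1 nup K24 e01.
exists q; split => //.
  by move=> i; apply: prob_kl_le => //; lra.
(* The gain e V / 48 is at least twice the loss 20 e^2, and the remaining e V / 96 is at least 20 d:
   enough to make up the 7 d by which [nu] may miss t and to leave 10 d. *)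
have : e * (V / 2) <= e * cvar kap p by rewrite ler_pM2l.
have : e ^+ 2 * (96 * 20) <= e * V by rewrite expr2 -mulrA ler_pM2l//; lra.
by lra.
Qed.

End small_deviations.

(** * Tail probabilities of the statistic under the null hypothesis *)

Section rate_function.
Variable R : realType.
Local Notation mu := (@lebesgue_measure R).
Local Notation D := (`[1%R, +oo[%classic : set R).
Implicit Types (t lam : R) (n N : nat).

Lemma pareto_density lam : 0 < lam -> is_density (pareto lam).
Proof.
move=> l0; split=> [x _|]; first exact: pareto_ge0.
by rewrite integral_pareto_tail// ln1 mulr0 oppr0 expR0.
Qed.

(** Necessary for the statistic to reach [t], as [stat_lower] is sufficient; both see the sample
    only through its cells. *)
Definition stat_upper N t (c : seq 'I_(N ^ 2).+1) : bool :=
  t <= tau (@bkernel R N) (freq R c) + 6 * fmax (freq R c) + ((size c)%:R - 1)^-1.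

Definition stat_lower N t (c : seq 'I_(N ^ 2).+1) : bool :=
  t <= tau (@bkernel R N) (freq R c) - 6 * fmax (freq R c) - ((size c)%:R - 1)^-1.

Lemma Tn_bounds N lam s : (0 < N)%N -> 0 < lam -> (2 <= size s)%N ->
  {in s, forall x, 1 <= x} ->
  `|Tn s - tau (@bkernel R N) (freq R (map (@bin R N lam) s))| <=
  6 * fmax (freq R (map (@bin R N lam) s)) + ((size s)%:R - 1)^-1.
Proof. by move=> N0 l0 s2 s1; apply: Tn_tau => // k; exact: le_fmax. Qed.

(** The binned Pareto law is [geo] for every parameter, so the same two bounds enclose each
    probability in the infimum and therefore the infimum. *)
Lemma Gn_bounds N n t : (0 < N)%N -> (2 <= n)%N ->
  pr (@geo R N) n (@stat_lower N t) <= 1 - Gn n t <= pr (@geo R N) n (@stat_upper N t).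
Proof.
move=> N0 n2.
have key lam : 0 < lam -> 1 - pr (@geo R N) n (@stat_upper N t) <=
    iid_prob (pareto lam) n (fun s => Tn s < t) <= 1 - pr (@geo R N) n (@stat_lower N t).
  move=> l0; have gp := geo_prob R N0.
  have cC (A : pred (seq 'I_(N ^ 2).+1)) :
      1 - pr (@geo R N) n A = pr (@geo R N) n (fun c => ~~ A c).
    by rewrite (prC n A gp); ring.
  rewrite !cC.
  have cE : cell (@bin R N lam) (pareto lam) = @geo R N.
    by apply/funext; exact: cell_pareto.
  rewrite -cE; apply: iid_prob_bounds.
  - exact: measurable_bin.
  - exact: pareto_integrable.
  - exact: pareto_density.
  - move=> s [sn s1]; rewrite /stat_upper size_map -ltNge.
    have := @Tn_bounds N lam s N0 l0 _ s1; rewrite sn => /(_ n2).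
    by rewrite ler_norml => /andP[_ h1] h2; lra.
  - move=> s [sn s1] Ts; rewrite /stat_lower size_map -ltNge.
    have := @Tn_bounds N lam s N0 l0 _ s1; rewrite sn => /(_ n2).
    by rewrite ler_norml => /andP[h1 _]; lra.
set S := [set iid_prob (pareto lam) n (fun s => Tn s < t) | lam in `]0, +oo[].
have S1 : S (iid_prob (pareto 1) n (fun s => Tn s < t)).
  by exists 1 => //=; rewrite in_itv/= ltr01.
have Slb : lbound S (1 - pr (@geo R N) n (@stat_upper N t)).
  by move=> _ [lam /= + <-]; rewrite in_itv/= andbT => /key /andP[].
have h1 : 1 - pr (@geo R N) n (@stat_upper N t) <= Gn n t.
  by apply: lb_le_inf => //; exists (iid_prob (pareto 1) n (fun s => Tn s < t)).
have h2 : Gn n t <= 1 - pr (@geo R N) n (@stat_lower N t).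
  apply: le_trans (_ : iid_prob (pareto 1) n (fun s => Tn s < t) <= _).
    by apply: ge_inf => //; exists (1 - pr (@geo R N) n (@stat_upper N t)).
  by have /andP[] := key 1 ltr01.
by apply/andP; split; lra.
Qed.

(** The number of types is negligible on the exponential scale. *)
Lemma ln_nat_near (K e : R) : 0 < K -> 0 < e -> \forall n \near \oo, K * ln n.+1%:R <= n%:R * e.
Proof.
move=> K0 e0; pose k := e / (2 * K).
have k0 : 0 < k by rewrite divr_gt0// mulr_gt0.
near=> n.
have nb : 2 * (e / 2 - K * ln k) / e <= n%:R by near: n; exact: nbhs_infty_ger.
have n0 : 0 < n.+1%:R :> R by rewrite ltr0n.
have : ln (n.+1%:R * k) <= n.+1%:R * k by rewrite ltW// ln_sublinear// mulr_gt0.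
rewrite lnM ?posrE// => h.
have {h} : K * ln n.+1%:R <= n.+1%:R * (K * k) - K * ln k by nra.
have -> : K * k = e / 2 by rewrite /k; field; lra.
rewrite ler_pdivrMr// in nb.
by rewrite -natr1; lra.
Unshelve. all: by end_near. Qed.

Lemma tau_close (I : finType) (kap : I -> I -> I -> R) (p q : I -> R) :
  (forall i j k, `|kap i j k| <= 1) -> prob p -> prob q ->
  `|tau kap q - tau kap p| <= 13 * l1 (fun i => q i - p i).
Proof.
move=> kap1 pp qp; have l2 := l1_sub_prob qp pp.
have := tau_expand kap1 pp l2; have l0 := l1_ge0 (fun i => q i - p i).
rewrite (_ : tau kap (fun i => _) = tau kap q); last first.
  by rewrite /tau; congr (_ - _); apply: eq_tri => i; rewrite addrCA subrr addr0.
have : `|\sum_i (q i - p i) * proj kap p i| <= 3 * l1 (fun i => q i - p i).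
  apply: le_trans (ler_norm_sum _ _ _) _; rewrite /l1 mulr_sumr ler_sum// => i _.
  by rewrite normrM mulrC ler_wpM2r// proj_le3.
set L := l1 _ in l0 l2 *.
have : 5 * L ^+ 2 <= 10 * L by nra.
by rewrite !ler_norml => ? /andP[? ?] /andP[? ?]; apply/andP; split; lra.
Qed.

End rate_function.

Section tolerances.
Variable R : realType.
Implicit Types (x y z : R).

Lemma small_tolerance x y z : 0 < x -> 0 < y -> 0 < z -> exists2 e, 0 < e &
  [/\ 4 * e <= 1, 24 * e <= x, 96 * (20 * e) <= y & 4 * e <= z].
Proof.
move=> x0 y0 z0.
pose e := Num.min (1 / 4) (Num.min (x / 24) (Num.min (y / 96 / 20) (z / 4))).
have e1 : e <= 1 / 4 by rewrite ge_min lexx.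
have e2 : e <= x / 24 by rewrite !ge_min lexx ?orbT.
have e3 : e <= y / 96 / 20 by rewrite !ge_min lexx ?orbT.
have e4 : e <= z / 4 by rewrite !ge_min lexx ?orbT.
exists e; first by rewrite !lt_min !divr_gt0.
by split; lra.
Qed.

Lemma small_mesh x y z : 0 < x -> 0 < y -> 0 < z -> exists2 d, 0 < d &
  [/\ 30 * d <= x, 2 * d <= y & 96 * (20 * d) <= z].
Proof.
move=> x0 y0 z0; pose d := Num.min (x / 30) (Num.min (y / 2) (z / 96 / 20)).
have e1 : d <= x / 30 by rewrite ge_min lexx.
have e2 : d <= y / 2 by rewrite !ge_min lexx ?orbT.
have e3 : d <= z / 96 / 20 by rewrite !ge_min lexx ?orbT.
exists d; first by rewrite !lt_min !divr_gt0.
by split; lra.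
Qed.

End tolerances.

Section rate_limit.
Variable R : realType.
Implicit Types (t : R).
Let V : R := 5 / 108.

Let V0 : 0 < V. Proof. by rewrite /V; lra. Qed.

Local Notation a := (V^-1).
Local Notation C := (rate_const V).

Lemma model_near (d : R) : 0 < d -> exists2 N, (0 < N)%N &
  [/\ `|tau (@bkernel R N) (@geo R N)| <= d, `|cvar (@bkernel R N) (@geo R N) - V| <= d &
   forall k, @geo R N k <= expR (- (2 / d))].
Proof.
move=> d0; pose K : R := 336 / d + 2 * expR (2 / d).
have K0 : 0 < 336 / d := divr_gt0 (ltr0Sn R 335) d0.
have E0 : 0 < 2 * expR (2 / d) by rewrite mulr_gt0 ?expR_gt0.
have [N hN] : exists N : nat, K < N%:R.
  by exists (Num.bound K); apply: archi_boundP; rewrite /K; lra.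
have n0 : 0 < N%:R :> R by apply: lt_trans hN; rewrite /K; lra.
have N0 : (0 < N)%N by rewrite ltr0n in n0.
have hd : 336 / N%:R <= d.
  rewrite ler_pdivrMr// mulrC -ler_pdivrMr//; apply: ltW; apply: le_lt_trans hN.
  by rewrite /K; lra.
exists N => //; split.
(* [geo] involves no Pareto parameter, so its limits may be computed at parameter 1. *)
- apply: le_trans (tau_geo ltr01 N0) _; apply: le_trans hd.
  by rewrite ler_pM2r ?invr_gt0//; lra.
- exact: le_trans (cvar_geo ltr01 N0) hd.
- move=> k; apply: le_trans (geo_le R N0 k) _.
  rewrite expRN ler_pdivrMr// mulrC ler_pdivlMr ?expR_gt0//.
  by apply: ltW; apply: le_lt_trans hN; rewrite /K; lra.
Qed.

(** The mesh depends on [eta], and [l] is the infimum of the entropy for that mesh only; the window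
    containing it does not depend on the mesh. *)
Lemma fseq_near t (eta : R) : small_level V t -> 0 < eta -> exists2 l : R,
  a * t ^+ 2 / 2 - C * t ^+ 3 <= l <= a * t ^+ 2 / 2 + C * t ^+ 3 &
  \forall n \near \oo, `|l - fseq t n| <= eta.
Proof.
move=> ts eta0; have [/andP[t0 t1] _ _ _ _] := ts; have V0' := V0.
have k0 : 0 < (V / 288) ^+ 2 / 2 :=
  divr_gt0 (exprn_gt0 2 (divr_gt0 V0 (ltr0Sn R 287))) (ltr0Sn R 1).
have [e e0 [e1 e2 e3 e4]] := small_tolerance k0 V0' eta0.
have t2 : 0 < t ^+ 2 by rewrite exprn_gt0.
have [d d0 [d1 d2 d3]] := small_mesh t2 V0' (mulr_gt0 e0 V0').
have [N N0 [taup cvarp pd]] := model_near d0.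
set p := @geo R N in taup cvarp pd.
set kap := @bkernel R N in taup cvarp.
have pp : prob p := geo_prob R N0.
have p0 k : 0 < p k := geo_gt0 R N0 k.
have p1 : \sum_k p k = 1 := pp.2.
have kap1 i j k : `|kap i j k| <= 1 := bkernel_le1 R i j k.
(* The constraint of the upper bound, relaxed by d to absorb (n - 1)^-1. *)
pose A := [set x : R | exists nu, [/\ prob nu, t - d <= tau kap nu + 6 * fmax nu
  & x = kl nu p]].
have Alb x : A x -> a * t ^+ 2 / 2 - C * t ^+ 3 <= x.
  move=> [nu [nup nut ->]].
  exact: (rate_bound V0 kap1 p0 p1 ts d0 d1 d2 taup cvarp pd nup nut).
have [q0 [q0p q00 q0K q0d q0t]] := rate_attained V0 kap1 p0 p1 ts d0 d1 d2 taup cvarp pd.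
have Aq : A (kl q0 p).
  by exists q0; split => //; have := fmax_ge0 q0; lra.
have hA : has_inf A.
  by split; [exists (kl q0 p)|exists (a * t ^+ 2 / 2 - C * t ^+ 3) => x; exact: Alb].
pose l := inf A.
have lge : a * t ^+ 2 / 2 - C * t ^+ 3 <= l by apply: lb_le_inf => //; exists (kl q0 p).
have Ainf x : A x -> l <= x by move=> Ax; apply: ge_inf => //; case: hA.
have lle : l <= a * t ^+ 2 / 2 + C * t ^+ 3 by apply: le_trans (Ainf _ Aq) q0K.
have [_ [nu [nup nut ->]] nuK] := inf_adherent e0 hA.
have Knu : kl nu p <= a * t ^+ 2 / 2 + C * t ^+ 3 + e.
  by apply: le_trans (ltW nuK) _; rewrite -/l; lra.
have [q [qp qpos qK qd qt]] :=
  rate_near V0 kap1 p0 p1 ts d0 d2 cvarp pd nup nut Knu e0 e1 e2 e3 d3.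
exists l; first by rewrite lge lle.
(* Frequencies within eps of q cost at most 13 |I| eps in [tau] and 6 eps through the largest mass:
   d in all. *)
pose eps := d / (13 * (#|'I_(N ^ 2).+1|%:R) + 6).
have c0 : 0 < 13 * (#|'I_(N ^ 2).+1|%:R) + 6 :> R.
  by rewrite ltr_wpDl// mulr_ge0.
have eps0 : 0 < eps by rewrite divr_gt0.
have tilted := pr_ge_tilted qp pp p0 qpos e0 eps0.
near=> n.
have n2 : (2 <= n)%N by near: n; exact: nbhs_infty_ge.
have n1 : (0 < n)%N := ltnW n2.
have n0 : 0 < n%:R :> R by rewrite ltr0n.
have nd : (n%:R - 1)^-1 <= d.
  have h : d^-1 + 1 <= n%:R by near: n; exact: nbhs_infty_ger.
  have di : 0 < d^-1 by rewrite invr_gt0.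
  by clear -h di d0; rewrite invf_ple ?posrE//; lra.
have /andP[lo up] := Gn_bounds t N0 n2.
have {}up : 1 - Gn n t <= n.+1%:R ^+ #|'I_(N ^ 2).+1| * expR (- n%:R * l).
  apply: le_trans up _; apply: pr_le_card => //.
  move=> c cn; rewrite /stat_upper cn => cu; apply: Ainf; exists (freq R c); split => //.
    by apply: prob_freq; rewrite cn.
  by rewrite -/kap in cu; lra.
have {}lo : expR (- n%:R * (kl q p + e)) <= 1 - Gn n t.
  apply: le_trans lo; have := near tilted n; apply=> // c cn close.
  have fp : prob (freq R c) by apply: prob_freq; rewrite cn.
  have cl : l1 (fun k => freq R c k - q k) <= eps * #|'I_(N ^ 2).+1|%:R.
    rewrite -sum1_card natr_sum mulr_sumr; apply: ler_sum => k _.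
    by rewrite mulr1.
  have fm : fmax (freq R c) <= d + eps.
    apply: fmax_le => [|k]; first by rewrite addr_ge0// ltW.
    by have := close k; rewrite ler_norml => /andP[_]; have := qd k; lra.
  have := tau_close kap1 qp fp; rewrite ler_norml => /andP[h _].
  have he : 13 * (eps * #|'I_(N ^ 2).+1|%:R) + 6 * eps = d.
    by rewrite /eps; field; rewrite gt_eqF.
  by rewrite /stat_lower cn -/kap; lra.
have pos : 0 < 1 - Gn n t by apply: lt_le_trans lo; exact: expR_gt0.
have h1 : - n%:R * (kl q p + e) <= ln (1 - Gn n t).
  by rewrite -ler_expR lnK ?posrE.
have h2 : ln (1 - Gn n t) <= #|'I_(N ^ 2).+1|%:R * ln n.+1%:R - n%:R * l.
  have : ln (1 - Gn n t) <= ln (n.+1%:R ^+ #|'I_(N ^ 2).+1| * expR (- n%:R * l)).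
    by rewrite ler_ln ?posrE// mulr_gt0 ?expR_gt0// exprn_gt0.
  rewrite lnM ?posrE ?expR_gt0 ?exprn_gt0// lnXn// expRK mulr_natl.
  by rewrite mulNr.
have h3 : #|'I_(N ^ 2).+1|%:R * ln n.+1%:R <= n%:R * eta.
  by near: n; apply: ln_nat_near => //; rewrite card_ord ltr0n.
have nf : n%:R * fseq t n = - ln (1 - Gn n t) by rewrite /fseq mulrN mulVKf// gt_eqF.
have f1 : n%:R * fseq t n <= n%:R * (l + eta).
  apply: (@le_trans _ _ (n%:R * (kl q p + e))); first by clear -nf h1; rewrite nf; lra.
  rewrite ler_pM2l//; apply: (@le_trans _ _ (l + 4 * e)); last by clear -e4; lra.
  by clear -nuK qK e0; move: nuK; rewrite -/l; lra.
have f2 : n%:R * (l - eta) <= n%:R * fseq t n by clear -nf h2 h3; rewrite nf; lra.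
move: f1 f2; rewrite !ler_pM2l// => f1 f2.
by clear -f1 f2; rewrite ler_norml; apply/andP; split; lra.
Unshelve. all: by end_near. Qed.

End rate_limit.

Section fT_limit.
Variable R : realType.
Implicit Types (t : R).
Let V : R := 5 / 108.
Local Notation a := (V^-1).
Local Notation C := (rate_const V).

(** For each tolerance the sequence eventually stays near some number, which is a Cauchy criterion
    and needs no candidate for the limit. *)
Lemma fseq_cvg t : small_level V t -> cvgn (fseq t).
Proof.
move=> ts; apply/cauchy_cvgP/cauchy_exP => e e0.
have [l _ near_l] := fseq_near ts (divr_gt0 e0 (ltr0n R 2)).
exists l; near=> n.
rewrite /ball/=; apply: le_lt_trans (_ : _ <= e / 2) _; first by near: n.
by rewrite ltr_pdivrMr// ltr_pMr// ltr1n.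
Unshelve. all: by end_near. Qed.

Lemma fT_approx t : small_level V t -> `|fT t - a * t ^+ 2 / 2| <= C * t ^+ 3.
Proof.
move=> ts; have cv := fseq_cvg ts.
apply/ler_addgt0Pr => e e0.
have [l + near_l] := fseq_near ts e0; rewrite -/V => /andP[l1 l2].
have h1 : l - e <= fT t.
  apply: limr_ge => //; near=> n.
  have : `|l - fseq t n| <= e by near: n.
  by rewrite ler_norml => /andP[_]; lra.
have h2 : fT t <= l + e.
  apply: limr_le => //; near=> n.
  have : `|l - fseq t n| <= e by near: n.
  by rewrite ler_norml => /andP[? _]; lra.
by rewrite ler_norml; apply/andP; split; lra.
Unshelve. all: by end_near. Qed.

End fT_limit.

(** * The limit in probability of the statistic *)

Section limit_in_probability.
Variables (R : realType) (g : R -> R).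
Local Notation mu := (@lebesgue_measure R).
Local Notation D := (`[1%R, +oo[%classic : set R).
Hypothesis ig : mu.-integrable D (EFin \o g).
Hypothesis gd : is_density g.

Definition triple_kernel (s : seq R) : bool := kernel s`_0 s`_1 s`_2.

(** The population counterpart of [tau]. Written with [iid_int], it can be binned by the same
    comparison as the probabilities. *)
Definition limit_value : R :=
  fine (iid_int g 3 (fun s => ((triple_kernel s)%:R : R)%:E)) - 1 / 2.

Variables (alpha : R).
Hypothesis al0 : 0 < alpha.

Section mesh.
Variable N : nat.
Hypothesis N0 : (0 < N)%N.
Local Notation I := 'I_(N ^ 2).+1.
Local Notation bin := (@bin R N alpha).
Local Notation p := (cell bin g).

Let on3 (F : I -> I -> I -> bool) (c : seq I) : R :=
  if c is [:: i; j; k] then (F i j k)%:R else 0.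

Let ex_on3 (F : I -> I -> I -> bool) :
  ex p 3 (on3 F) = \sum_i \sum_j \sum_k p i * p j * p k * (F i j k)%:R.
Proof.
rewrite /=; apply: eq_bigr => i _; rewrite mulr_sumr; apply: eq_bigr => j _.
by rewrite !mulr_sumr; apply: eq_bigr => k _; rewrite !mulrA.
Qed.

Let pp : prob p.
Proof. by apply: prob_cell => //; exact: measurable_bin. Qed.

(** The kernel lies between its binned versions in which undetermined triples count as false ([F1])
    or as true ([F2]). *)
Lemma limit_value_tau : `|limit_value - tau (@bkernel R N) p| <= 5 * fmax p.
Proof.
have mB := measurable_bin N0 al0.
pose F1 (i j k : I) := (dist i j <= k)%N && ~~ undetermined i j k.
pose F2 (i j k : I) := (dist i j <= k)%N || undetermined i j k.
have und := undetermined_le N0 al0 pp (le_fmax p).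
set U := \sum_i _ in und.
have F1E : tri (@bkernel R N) p p p - U <= ex p 3 (on3 F1).
  rewrite ex_on3 /U /tri -sumrB ler_sum// => i _.
  rewrite -sumrB ler_sum// => j _; rewrite -sumrB ler_sum// => k _.
  rewrite -mulrBr; apply: ler_wpM2l; first by rewrite !mulr_ge0 ?prob_ge0.
  by rewrite /bkernel /F1; case: leq; case: undetermined; rewrite /= ?subr0 ?subrr ?sub0r ?oppr_le0.
have F2E : ex p 3 (on3 F2) <= tri (@bkernel R N) p p p + U.
  rewrite ex_on3 /U /tri -big_split ler_sum// => i _ /=.
  rewrite -big_split ler_sum// => j _ /=; rewrite -big_split ler_sum// => k _ /=.
  rewrite -mulrDr; apply: ler_wpM2l; first by rewrite !mulr_ge0 ?prob_ge0.
  by rewrite /bkernel /F2; case: leq; case: undetermined; rewrite /= ?addr0 ?add0r ?lerDl.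
have smp s : sample 3 s -> exists x y z, [/\ s = [:: x; y; z], 1 <= x, 1 <= y & 1 <= z].
  case: s => [|x [|y [|z [|? ?]]]] [] //= _ s1; exists x, y, z.
  by split => //; apply: s1; rewrite !inE eqxx ?orbT.
have g0 := gd.1.
have h1 : ((ex p 3 (on3 F1))%:E <= iid_int g 3 (fun s => ((triple_kernel s)%:R : R)%:E))%E.
  rewrite -(iid_int_bin mB 3 (on3 F1) ig); apply: iid_int_le => // s.
    by move=> /smp[x [y [z [-> *]]]]; rewrite lee_fin ler0n.
  move=> /smp[x [y [z [-> x1 y1 z1]]]]; rewrite lee_fin /triple_kernel /= /F1.
  have := kernel_bin N0 al0 x1 y1 z1; case: undetermined => /=.
    by rewrite andbF ler0n.
  by move=> /(_ isT) ->; rewrite andbT.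
have h2 : (iid_int g 3 (fun s => ((triple_kernel s)%:R : R)%:E) <= (ex p 3 (on3 F2))%:E)%E.
  rewrite -(iid_int_bin mB 3 (on3 F2) ig); apply: iid_int_le => // s.
  move=> /smp[x [y [z [-> x1 y1 z1]]]]; rewrite lee_fin /triple_kernel /= /F2.
  have := kernel_bin N0 al0 x1 y1 z1; case: undetermined => /=.
    by rewrite orbT => _; rewrite lern1 leq_b1.
  by move=> /(_ isT) ->; rewrite orbF.
rewrite /limit_value /tau; move: F1E F2E h1 h2.
move: (ex p 3 (on3 F1)) (ex p 3 (on3 F2)) => E1 E2 F1E F2E; case: (iid_int _ _ _) => [r| |] //=.
rewrite !lee_fin => h1 h2; rewrite ler_norml; apply/andP; split; lra.
Qed.

Lemma iid_prob_far n (b e eps : R) : (2 <= n)%N -> 0 < e ->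
  (forall nu, prob nu -> (forall k, `|nu k - p k| <= e) ->
     `|tau (@bkernel R N) nu - b| + 6 * fmax nu + (n%:R - 1)^-1 <= eps) ->
  0 <= iid_prob g n (fun s => eps < `|Tn s - b|) <= #|{: I}|%:R / (n%:R * e ^+ 2).
Proof.
move=> n2 e0 near_p.
(* The empty event on the left serves to obtain nonnegativity. *)
have /andP[hl h] : pr p n xpred0 <= iid_prob g n (fun s => eps < `|Tn s - b|) <=
    pr p n (fun c => ~~ [forall k, `|freq R c k - p k| <= e]).
  apply: (iid_prob_bounds (measurable_bin N0 al0)) => // s [sn s1] far.
  apply/negP => /forallP close.
  have c0 : (0 < size (map bin s))%N by rewrite size_map sn ltnW.
  have := near_p _ (prob_freq R c0) close.
  have := @Tn_bounds R N alpha s N0 al0 _ s1; rewrite sn => /(_ n2) h1 h2.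
  have := ler_distD (tau (@bkernel R N) (freq R (map bin s))) (Tn s) b.
  by lra.
rewrite (le_trans (pr_ge0 n xpred0 pp) hl)/=; apply: le_trans h _.
by apply: pr_freq_far => //; exact: ltnW.
Qed.

End mesh.

Hypothesis small_cells : forall (d : R), 0 < d ->
  exists2 N, (0 < N)%N & forall k, cell (@bin R N alpha) g k <= d.

Lemma conv_in_prob_limit_value : conv_in_prob g limit_value.
Proof.
move=> eps eps0.
have e40 : 0 < eps / 40 by rewrite divr_gt0.
have [N N0 pd] := small_cells e40.
set p := cell _ g in pd.
have pp : prob p by apply: prob_cell => //; exact: measurable_bin.
have fp : fmax p <= eps / 40 by apply: fmax_le => //; exact: ltW.
have lv := limit_value_tau N0; rewrite -/p in lv.
pose m : R := #|{: 'I_(N ^ 2).+1}|%:R.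
have m0 : 0 <= m by rewrite /m.
pose e := eps / (40 * (13 * m + 6)).
have c0 : 0 < 13 * m + 6 by lra.
have e0 : 0 < e by rewrite divr_gt0// mulr_gt0.
have ee : e * (13 * m + 6) = eps / 40 by rewrite /e; field; rewrite gt_eqF.
apply/cvgrPdist_le => eta eta0; near=> n.
have n2 : (2 <= n)%N by near: n; exact: nbhs_infty_ge.
have n0 : 0 < n%:R :> R by rewrite ltr0n ltnW.
have nd : (n%:R - 1)^-1 <= eps / 40.
  have h : (eps / 40)^-1 + 1 <= n%:R by near: n; exact: nbhs_infty_ger.
  have di : 0 < (eps / 40)^-1 by rewrite invr_gt0.
  by rewrite invf_ple ?posrE//; lra.
have /andP[h0 h1] : 0 <= iid_prob g n (fun s => eps < `|Tn s - limit_value|) <=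
    m / (n%:R * e ^+ 2).
  apply: iid_prob_far => //.
  move=> nu nup close; rewrite -/p in close.
  have l1e : l1 (fun k => nu k - p k) <= e * m.
    rewrite /m -sum1_card natr_sum mulr_sumr /l1 ler_sum// => k _.
    by rewrite mulr1.
  have tc := tau_close (fun i j k => bkernel_le1 R i j k) pp nup.
  have fn : fmax nu <= eps / 40 + e.
    apply: fmax_le => [|k]; first by rewrite addr_ge0// ltW.
    by have := close k; rewrite ler_norml => /andP[_]; have := pd k; lra.
  have := ler_distD (tau (@bkernel R N) p) (tau (@bkernel R N) nu) limit_value.
  rewrite (distrC (tau _ p)); have := mulr_ge0 (ltW e0) m0.
  by lra.
rewrite sub0r normrN ger0_norm//; apply: le_trans h1 _.
have e2 : 0 < e ^+ 2 := exprn_gt0 2 e0.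
rewrite ler_pdivrMr; last exact: mulr_gt0.
have : m / (eta * e ^+ 2) <= n%:R by near: n; exact: nbhs_infty_ger.
rewrite ler_pdivrMr; last exact: mulr_gt0.
by move=> /le_trans; apply; rewrite mulrCA.
Unshelve. all: by end_near. Qed.

End limit_in_probability.

(** * The limit of the statistic under the alternatives *)

Section alternative.
Variables (R : realType) (alpha C D theta : R).
Hypothesis al0 : 0 < alpha.
Local Notation mu := (@lebesgue_measure R).
Local Notation T := (`[1%R, +oo[%classic : set R).
Local Notation g := (galt alpha C D theta).
Local Notation w := (score alpha C (D / alpha)).

Lemma integrable_galt : mu.-integrable T (EFin \o g).
Proof.
have s1 : summable alpha (fun x => 1 + theta * w x).
  apply: tame_summable => //; apply: (tame_le al0 (isT : (1 <= 4)%N)).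
  by apply: tameD => //; [exact: tame_cst|apply: tameZ => //; exact: tame_score].
apply: eq_integrable s1 => // x; rewrite inE/= in_itv/= andbT => x1.
by rewrite galt_score.
Qed.

Lemma mean_abs_score_ge0 : 0 <= mean alpha (fun x => `|w x|).
Proof.
apply: Rintegral_ge0 => x _; apply: mulr_ge0 => //; exact: pareto_ge0.
Qed.

Hypothesis th0 : 0 <= theta.

(** L is fixed first so that theta m2 / L <= d / 2, then N so that (1 + theta L) 2 / N <= d / 2. The
    extra bound [K] lets the same mesh meet a further requirement. *)
Lemma cell_galt_small (d K : R) : 0 < d -> exists2 N, (0 < N)%N /\ K <= N%:R &
  forall k, cell (@bin R N alpha) g k <= d.
Proof.
move=> d0; pose m2 := mean alpha (fun x => w x ^+ 2).
have m20 : 0 <= m2.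
  by apply: Rintegral_ge0 => x _; apply: mulr_ge0; [exact: sqr_ge0|exact: pareto_ge0].
pose L := 2 * theta * m2 / d + 1.
have L0 : 0 < L.
  by rewrite /L ltr_wpDl// divr_ge0 ?(ltW d0)// !mulr_ge0.
have c0 : 0 < 1 + theta * L by rewrite ltr_pwDl// mulr_ge0// ltW.
pose B := `|K| + 4 * (1 + theta * L) / d.
have B0 : 0 < 4 * (1 + theta * L) / d by rewrite divr_gt0// mulr_gt0.
have [N hN] : exists N : nat, B < N%:R.
  by exists (Num.bound B); apply: archi_boundP; rewrite /B addr_ge0// ltW.
have K0 := normr_ge0 K.
have n0 : 0 < N%:R :> R by apply: lt_trans hN; rewrite /B; lra.
have N0 : (0 < N)%N by rewrite ltr0n in n0.
exists N.
  by split => //; have := ler_norm K; rewrite /B in hN; lra.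
move=> k; rewrite cell_galt//.
have hw := wcell_le al0 N0 C (D / alpha) k L0; rewrite -/m2 in hw.
have hg := geo_le R N0 k.
have h1 : theta * wcell alpha C (D / alpha) k <= theta * (L * geo R k + m2 / L).
  by rewrite ler_wpM2l//; apply: le_trans (ler_norm _) hw.
have h2 : theta * (m2 / L) <= d / 2.
  rewrite mulrA ler_pdivrMr// /L mulrDr mulr1.
  rewrite (_ : d / 2 * (2 * theta * m2 / d) = theta * m2); last by field; rewrite gt_eqF.
  by rewrite lerDl divr_ge0// ltW.
have h3 : (1 + theta * L) * geo R k <= d / 2.
  apply: (@le_trans _ _ ((1 + theta * L) * (2 / N%:R))); first by rewrite ler_wpM2l// ltW.
  rewrite mulrA ler_pdivrMr//.
  have : 4 * (1 + theta * L) / d <= N%:R by rewrite /B in hN; lra.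
  by rewrite ler_pdivrMr//; lra.
by lra.
Qed.

Hypothesis gd : is_density g.

Lemma conv_in_prob_galt : conv_in_prob g (limit_value g).
Proof.
apply: (conv_in_prob_limit_value integrable_galt gd al0) => d d0.
by have [N [N0 _] h] := cell_galt_small 0 d0; exists N.
Qed.

(** The left side does not depend on the mesh, so the discretisation errors vanish in the limit;
    there remains the remainder of [tau_expand] for a perturbation of l1 norm at most theta A. *)
Lemma limit_value_galt : theta * mean alpha (fun x => `|w x|) <= 2 ->
  `|limit_value g - theta * (5 * C / 324)| <=
  5 * (theta * mean alpha (fun x => `|w x|)) ^+ 2.
Proof.
have A0 := mean_abs_score_ge0; set A := mean _ _ in A0 * => tA.
have tA0 : 0 <= theta * A by exact: mulr_ge0.
apply/ler_addgt0Pr => e e0.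
have e3 : 0 < e / 15 by rewrite divr_gt0.
have [N [N0 NK] small] := cell_galt_small (28 * (1 + theta * A) / (e / 3)) e3.
have n0 : 0 < N%:R :> R by rewrite ltr0n.
have hN : 28 / N%:R * (1 + theta * A) <= e / 3.
  move: NK; rewrite ler_pdivrMr; last by rewrite divr_gt0.
  by rewrite mulrAC ler_pdivrMr// => /le_trans; apply; rewrite mulrC.
set p := cell _ g in small.
have lv := limit_value_tau integrable_galt gd al0 N0; rewrite -/p in lv.
have fp : fmax p <= e / 15 by apply: fmax_le => //; exact: ltW.
pose u := wcell alpha (N := N) C (D / alpha).
have pE : p =1 (fun k => geo R k + theta * u k).
  by move=> k; rewrite /p cell_galt.
have ul : l1 (fun k => theta * u k) <= theta * A.
  by rewrite l1Z ger0_norm// ler_wpM2l// wcell_l1.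
have kap1 := fun i j k => bkernel_le1 R i j k : `|@bkernel R N i j k| <= 1.
have u2 : l1 (fun k => theta * u k) <= 2 by lra.
have te := tau_expand kap1 (geo_prob R N0) u2.
have tauE : tau (@bkernel R N) p = tau (@bkernel R N) (fun k => geo R k + theta * u k).
  by rewrite /tau; congr (_ - _); apply: eq_tri.
rewrite -tauE in te.
have sE : \sum_k theta * u k * proj (@bkernel R N) (@geo R N) k =
    theta * \sum_k u k * proj (@bkernel R N) (@geo R N) k.
  by rewrite mulr_sumr; apply: eq_bigr => k _; rewrite mulrA.
rewrite sE in te.
have wp := wcell_proj al0 N0 C (D / alpha); rewrite -/u -/A in wp.
have tg := tau_geo al0 N0.
have wp' : `|theta * (\sum_k u k * proj (@bkernel R N) (@geo R N) k) - theta * (5 * C / 324)|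
    <= 28 / N%:R * (theta * A).
  rewrite -mulrBr normrM ger0_norm// mulrCA ler_wpM2l//.
have sq : 5 * l1 (fun k => theta * u k) ^+ 2 <= 5 * (theta * A) ^+ 2.
  by rewrite ler_pM2l// lerXn2r ?nnegrE// l1_ge0.
move: te wp' tg lv hN; rewrite mulrDr mulr1.
set S := theta * \sum_k _; set q := theta * (5 * C / 324); set z := 28 / N%:R * (theta * A).
rewrite !ler_norml => /andP[? ?] /andP[? ?] /andP[? ?] /andP[? ?] ?.
by apply/andP; split; lra.
Qed.

End alternative.

(** * The Kullback-Leibler information *)

Section kullback_leibler.
Variables (R : realType) (alpha C D theta : R).
Hypothesis al0 : 0 < alpha.
Local Notation mu := (@lebesgue_measure R).
Local Notation T := (`[1%R, +oo[%classic : set R).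
Local Notation g := (galt alpha C D theta).
Local Notation E := (D / alpha).
Local Notation w := (score alpha C E).
Local Notation Y := (lscale alpha).
Local Notation mean := (mean alpha).
Local Notation tame := (tame alpha).
Local Notation summable := (summable alpha).
Hypothesis th0 : 0 <= theta.
Hypothesis w_ge : forall x, 1 <= x -> - 2^-1 <= theta * w x.

Let u x := theta * w x.
Let entropy x := (1 + u x) * ln (1 + u x).
Let remainder x := entropy x - u x - u x ^+ 2 / 2.

Let tame_s4 (d : nat) f : (d <= 4)%N -> tame d f -> summable f.
Proof. by move=> d4 tf; apply: tame_summable => //; exact: tame_le tf. Qed.

Let tu : tame 1 u. Proof. by apply: tameZ => //; exact: tame_score. Qed.

Let tu2 : tame 2 (fun x => u x ^+ 2) := tameM tu tu.

Let tu3 : tame 3 (fun x => `|u x| ^+ 3).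
Proof. by have tn := tame_norm tu; exact: tameM tn (tameM tn tn). Qed.

Let remainder_le x : 1 <= x -> `|remainder x| <= `|u x| ^+ 3.
Proof. by move=> x1; exact: xlnx_approx (w_ge x1). Qed.

Let tr : tame 3 remainder.
Proof.
apply: (tame_dom _ tu3) => [|x x1]; last first.
  by rewrite [leRHS]ger0_norm ?remainder_le// exprn_ge0.
have mu1 : measurable_fun T u by case: tu.
have m1 : measurable_fun T (fun x => 1 + u x) by apply: measurable_funD.
apply: measurable_funB.
  apply: measurable_funB => //; apply: measurable_funM => //.
  by apply: measurableT_comp => //; exact: measurable_ln.
apply: measurable_funM => //; apply: measurable_funX => //.
Qed.

Let Kn := mean entropy.
Let M := 1 + theta * E.

Let mean_u : mean u = 0.
Proof.
by rewrite /u meanZ ?mean_score ?mulr0//; exact: tame_s4 (tame_score al0 C E).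
Qed.

Let KnE : Kn = mean remainder + mean (fun x => u x ^+ 2) / 2.
Proof.
have e : mean (fun x => u x ^+ 2) / 2 = mean (fun x => u x + 2^-1 * u x ^+ 2).
  rewrite meanD; last 2 first.
  - exact: tame_s4 tu.
  - by apply: (@tame_s4 2) => //; apply: tameZ.
  rewrite mean_u add0r meanZ; last exact: tame_s4 tu2.
  by rewrite mulrC.
rewrite e -meanD; last 2 first.
- exact: tame_s4 tr.
- apply: (@tame_s4 2) => //; apply: tameD; last exact: tameZ.
  exact: (tame_le al0 (isT : (1 <= 2)%N)).
by apply: eq_mean => x _; rewrite /remainder; field.
Qed.

Let mean_u2 : mean (fun x => u x ^+ 2) = theta ^+ 2 * (5 * C ^+ 2 / 972 + E ^+ 2).
Proof.
rewrite -(mean_score_sqr al0) -meanZ.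
  by apply: eq_mean => x _; rewrite /u exprMn.
exact: tame_s4 (tameM (tame_score al0 C E) (tame_score al0 C E)).
Qed.

Let mean_remainder : `|mean remainder| <= theta ^+ 3 * mean (fun x => `|w x| ^+ 3).
Proof.
have tn := tame_norm (tame_score al0 C E).
rewrite -meanZ; last exact: tame_s4 (tameM tn (tameM tn tn)).
apply: mean_norm_le => //.
- exact: tame_s4 tr.
- by apply: (@tame_s4 3) => //; apply: tameZ => //; exact: tameM tn (tameM tn tn).
- move=> x x1; apply: le_trans (remainder_le x1) _.
  by rewrite /u normrM exprMn (ger0_norm th0).
Qed.

Let mean_Yu : mean (fun x => Y x * (1 + u x)) = M.
Proof.
have tY := tame_lscale al0.
have tYw : tame 2 (fun x => w x * Y x) := tameM (tame_score al0 C E) tY.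
rewrite (@eq_mean _ _ _ (fun x => Y x + theta * (w x * Y x))).
  rewrite meanD; last 2 first.
  - exact: tame_s4 tY.
  - by apply: (@tame_s4 2) => //; exact: tameZ.
  rewrite meanZ; last exact: tame_s4 tYw.
  rewrite mean_score_lscale// (@eq_mean _ _ _ (poly6 alpha 0 1 0 0 0 0)).
    by rewrite mean_poly6// /M; field; rewrite gt_eqF.
  by move=> x _; rewrite /poly6; ring.
by move=> x _; rewrite /u; ring.
Qed.

(** With rho = lam / alpha, the log-ratio is ln (1 + u) - ln rho + (rho - 1) Y, so [lam] enters only
    through rho and the mean [M] of Y under the alternative. *)
Let divergence lam : 0 < lam ->
  Rintegral mu T (fun x => ln (g x / pareto lam x) * g x) =
  Kn - ln (lam / alpha) + (lam / alpha - 1) * M.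
Proof.
move=> l0; set rho := lam / alpha.
have r0 : 0 < rho by rewrite divr_gt0.
have t1u : tame 1 (fun x => 1 + u x) by apply: tameD => //; exact: tame_cst.
have tYu : tame 2 (fun x => Y x * (1 + u x)) := tameM (tame_lscale al0) t1u.
have te : tame 3 entropy.
  have : tame 3 (fun x => remainder x + (u x + 2^-1 * u x ^+ 2)).
    apply: tameD => //; apply: tameD; first exact: (tame_le al0 (isT : (1 <= 3)%N)).
    by apply: tameZ => //; exact: (tame_le al0 (isT : (2 <= 3)%N)).
  by congr (tame _ _); apply/funext => x; rewrite /remainder; field.
have m1u : mean (fun x => 1 + u x) = 1.
  rewrite meanD; last 2 first.
  - exact: (@tame_s4 0 _ isT (tame_cst al0 1 0)).
  - exact: tame_s4 tu.
  rewrite mean_u addr0 (@eq_mean _ _ _ (poly6 alpha 1 0 0 0 0 0)).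
    by rewrite mean_poly6//; field.
  by move=> x _; rewrite /poly6; ring.
transitivity (mean (fun x => entropy x + (- ln rho * (1 + u x) +
    (rho - 1) * (Y x * (1 + u x))))).
  apply: eq_Rintegral => x; rewrite inE/= in_itv/= andbT => x1.
  have x0 : 0 < x by lra.
  have u1 : 0 < 1 + u x by have := w_ge x1; rewrite /u; lra.
  have pg : g x = (1 + u x) * pareto alpha x by rewrite galt_score.
  have p0 : 0 < pareto alpha x by rewrite paretoE// mulr_gt0 ?divr_gt0 ?expR_gt0.
  rewrite pg.
  have -> : (1 + u x) * pareto alpha x / pareto lam x =
      (1 + u x) * (rho^-1 * expR ((rho - 1) * Y x)).
    rewrite !paretoE// (_ : - (lam * ln x) = - (alpha * ln x) - (rho - 1) * Y x).
      rewrite expRD (expRN ((rho - 1) * Y x)) /rho.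
      have e1 := expR_gt0 (- (alpha * ln x)); have e2 := expR_gt0 ((rho - 1) * Y x).
      by field; rewrite !gt_eqF.
    by rewrite /rho /lscale; field; rewrite gt_eqF.
  rewrite lnM ?posrE// ?mulr_gt0 ?invr_gt0 ?expR_gt0//.
  rewrite lnM ?posrE ?invr_gt0 ?expR_gt0// lnV ?posrE// expRK /entropy.
  by ring.
have s1 : summable (fun x => - ln rho * (1 + u x)).
  by apply: (@tame_s4 1) => //; exact: tameZ.
have s2 : summable (fun x => (rho - 1) * (Y x * (1 + u x))).
  by apply: (@tame_s4 2) => //; exact: tameZ.
rewrite meanD; [|exact: tame_s4 te|exact: summableD].
rewrite meanD// meanZ; last exact: tame_s4 t1u.
rewrite meanZ; last exact: tame_s4 tYu.
by rewrite m1u mean_Yu mulr1 addrA.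
Qed.

Hypothesis M_ge : - 2^-1 <= theta * E.

(** The minimum is at rho = 1 / M, by ln x <= x - 1 at x = rho M. *)
Let KL_eq : KL g = Kn + ln M + 1 - M.
Proof.
have M0 : 0 < M by have := M_ge; rewrite /M; lra.
have lb lam : 0 < lam -> Kn + ln M + 1 - M <=
    Kn - ln (lam / alpha) + (lam / alpha - 1) * M.
  move=> l0; have r0 : 0 < lam / alpha by rewrite divr_gt0.
  have := @le_ln1Dx R (lam / alpha * M - 1); rewrite addrCA subrr addr0 => h.
  have {}h : ln (lam / alpha * M) <= lam / alpha * M - 1.
    by apply: h; have := mulr_gt0 r0 M0; lra.
  by rewrite lnM ?posrE// in h; lra.
apply/eqP; rewrite eq_le; apply/andP; split.
- apply: ge_inf.
    exists (Kn + ln M + 1 - M) => _ [lam /= + <-]; rewrite in_itv/= andbT => l0.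
    by rewrite divergence// lb.
  exists (alpha / M) => /=; first by rewrite in_itv/= andbT divr_gt0.
  rewrite divergence ?divr_gt0//.
  have -> : alpha / M / alpha = M^-1 by field; rewrite !gt_eqF.
  by rewrite lnV ?posrE//; field; rewrite gt_eqF.
- apply: lb_le_inf.
    by eexists; exists alpha => //=; rewrite in_itv/= andbT.
  by move=> _ [lam /= + <-]; rewrite in_itv/= andbT => l0; rewrite divergence// lb.
Qed.

(** The quadratic contribution of E to half the mean of u^2 is cancelled by ln M + 1 - M, which
    starts with - (theta E)^2 / 2. *)
Lemma KL_galt : `|KL g - theta ^+ 2 * (5 * C ^+ 2 / 972) / 2| <=
  theta ^+ 3 * (mean (fun x => `|w x| ^+ 3) + 3 * `|E| ^+ 3).
Proof.
have h1 := mean_remainder; have := ln_approx M_ge.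
rewrite KL_eq KnE mean_u2 -/M normrM (ger0_norm th0) exprMn.
move: h1; rewrite !ler_norml => /andP[? ?] /andP[? ?].
by apply/andP; split; rewrite /M; lra.
Qed.

End kullback_leibler.

(** * The efficiency as a ratio of two quadratic expansions *)

Section local_ratio.
Variable R : realType.
Implicit Types (theta : R).

Lemma ratio_cvg1 (f k : R -> R) (q c1 c2 d : R) : 0 < q -> 0 <= c1 -> 0 <= c2 -> 0 < d ->
  (forall theta, 0 < theta < d -> `|f theta - q * theta ^+ 2| <= c1 * theta ^+ 3) ->
  (forall theta, 0 < theta < d -> `|k theta - q * theta ^+ 2| <= c2 * theta ^+ 3) ->
  (fun theta => (2 * f theta) / (2 * k theta)) @ 0^'+ --> (1 : R).
Proof.
move=> q0 c10 c20 d0 hf hk; apply/cvgrPdist_le => e e0; near=> theta.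
have t0 : 0 < theta by near: theta; exact: nbhs_right_gt.
have td : theta < d by near: theta; exact: nbhs_right_lt.
(* This keeps K above q theta^2 / 2; the next bound makes |K - F| at most e times that. *)
have t1 : theta < q / (2 * (c2 + 1)).
  by near: theta; apply: nbhs_right_lt; rewrite divr_gt0// mulr_gt0//; lra.
have t2 : theta < e * q / (2 * (c1 + c2 + 1)).
  by near: theta; apply: nbhs_right_lt; rewrite divr_gt0 ?mulr_gt0//; lra.
rewrite ltr_pdivlMr in t1; last by lra.
rewrite ltr_pdivlMr in t2; last by lra.
have tt : 0 < theta < d by rewrite t0.
have := hf _ tt; have := hk _ tt; set F := f theta; set K := k theta.
have th2 : 0 < theta ^+ 2 by rewrite exprn_gt0.
have e1 : c2 * theta ^+ 3 <= q / 2 * theta ^+ 2.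
  by rewrite exprS mulrA ler_pM2r//; lra.
have e2 : (c1 + c2) * theta ^+ 3 <= e * (q / 2 * theta ^+ 2).
  rewrite exprS mulrA [leRHS]mulrA ler_pM2r//; lra.
rewrite !ler_norml => /andP[k1 k2] /andP[f1 f2].
have Kq : q / 2 * theta ^+ 2 <= K by lra.
have K0 : 0 < K by apply: lt_le_trans Kq; rewrite mulr_gt0// divr_gt0.
have -> : 1 - 2 * F / (2 * K) = (K - F) / K by field; rewrite gt_eqF.
have eK : e * (q / 2 * theta ^+ 2) <= e * K by rewrite ler_pM2l.
apply/andP; split.
  by rewrite ler_pdivlMr//; lra.
by rewrite ler_pdivrMr//; lra.
Unshelve. all: by end_near. Qed.

Lemma small_radius (d0 x A B k t : R) :
  0 < d0 -> 0 <= x -> 0 <= A -> 0 <= B -> 0 < k -> 0 < t ->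
  exists2 d : R, 0 < d & [/\ d <= d0 / 4, d * (2 * (x + 1)) <= 1, d * A <= 2,
    d * B <= k / 2 & 2 * k * d <= t].
Proof.
move=> d00 x0 A0 B0 k0 t0.
exists (Num.min (d0 / 4) (Num.min (2 * (x + 1))^-1 (Num.min (2 / (A + 1))
    (Num.min (k / 2 / (B + 1)) (t / (2 * k)))))).
  by rewrite !lt_min ?invr_gt0 ?divr_gt0 ?mulr_gt0//; do ?[apply/andP; split] => //; lra.
set d := Num.min _ _.
have : d <= d by [].
rewrite {2}/d !le_min => /and5P[-> h1 h2 h3 h4]; split=> //.
- by rewrite -ler_pdivlMr ?div1r//; lra.
(* The unit added to A avoids a division by zero and is removed by a case split on the sign of d. *)
- have dA : d * (A + 1) <= 2 by rewrite -ler_pdivlMr//; lra.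
  have [d0'|d0'] := lerP 0 d; first by lra.
  have : d * A <= 0 by rewrite mulr_le0_ge0// ltW.
  by lra.
- have dB : d * (B + 1) <= k / 2 by rewrite -ler_pdivlMr//; lra.
  have [d0'|d0'] := lerP 0 d; first by lra.
  have : d * B <= 0 by rewrite mulr_le0_ge0// ltW.
  by lra.
- by rewrite mulrC -ler_pdivlMr// mulr_gt0.
Qed.

End local_ratio.

Theorem theorem2 (R : realType) (alpha C D : R) :
  0 < alpha -> 0 < C ->
  (* the family belongs to the class G: densities for theta near 0 *)
  (exists d0 : R, 0 < d0 /\
     forall theta : R, 0 <= theta < d0 -> is_density (galt alpha C D theta)) ->
  (* int_1^oo x^(alpha+1) h^2(x) dx < oo *)
  (\int[@lebesgue_measure R]_(x in `[1%R, +oo[)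
      ((x `^ (alpha + 1)) * (halt alpha C D x) ^+ 2)%:E < +oo)%E ->
  exists d : R, 0 < d /\
  exists bT : R -> R,
    (forall theta : R, 0 < theta < d ->
       conv_in_prob (galt alpha C D theta) (bT theta) /\ cvgn (fseq (bT theta))) /\
    (fun theta : R => (2 * fT (bT theta)) / (2 * KL (galt alpha C D theta)))
      @ 0^'+ --> (1 : R).
Proof.
move=> al0 C0 [d0 [d00 dens]] _.
pose E := D / alpha.
pose w := score alpha C E.
pose A := mean alpha (fun x => `|w x|).
pose A3 := mean alpha (fun x => `|w x| ^+ 3).
have A0 : 0 <= A by exact: mean_abs_score_ge0.
have A30 : 0 <= A3.
  apply: Rintegral_ge0 => x _.
  by apply: mulr_ge0; [exact: exprn_ge0|exact: pareto_ge0].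
pose V : R := 5 / 108.
have V0 : 0 < V by rewrite /V; lra.
have [t0 t00 tsmall] := small_level_near V0.
(* C V / 3, the slope of b_T at 0. *)
pose kappa := 5 * C / 324.
have k0 : 0 < kappa by rewrite /kappa; lra.
pose B := 5 * A ^+ 2.
have B0 : 0 <= B by rewrite mulr_ge0// sqr_ge0.
pose b theta := limit_value (galt alpha C D theta).
have [d dd [dm1 dm2 dm3 dm4 dm5]] : exists2 d : R, 0 < d & [/\ d <= d0 / 4,
    d * (2 * (`|E| + 1)) <= 1, d * A <= 2, d * B <= kappa / 2 & 2 * kappa * d <= t0].
  exact: small_radius.
have small theta : 0 < theta < d -> [/\ is_density (galt alpha C D theta),
    forall x, 1 <= x -> - 2^-1 <= theta * w x, - 2^-1 <= theta * E &
    theta * A <= 2].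
  move=> /andP[th0 thd]; split.
  - by apply: dens; rewrite (ltW th0)/=; lra.
  (* Nonnegativity of the density at parameter d0 / 2 gives w >= - 2 / d0 pointwise, hence theta w
     >= - 1/2 for theta <= d0 / 4. *)
  - move=> x x1; have d20 : 0 < d0 / 2 by rewrite divr_gt0.
    have [+ _] : is_density (galt alpha C D (d0 / 2)) by apply: dens; apply/andP; split; lra.
    move=> /(_ x x1); rewrite galt_score//.
    have p0 : 0 < pareto alpha x.
      by rewrite paretoE// mulr_gt0 ?expR_gt0// divr_gt0//; lra.
    rewrite (pmulr_lge0 _ p0) -/E -/w => h.
    have [w0|w0] := lerP 0 (w x).
      by have := mulr_ge0 (ltW th0) w0; lra.
    have : d0 / 4 * w x <= theta * w x by rewrite ler_wnM2r ?(ltW w0)//; lra.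
    by lra.
  - have : - (theta * `|E|) <= theta * E.
      by rewrite -mulrN ler_pM2l// lerNl -normrN ler_norm.
    have : theta * `|E| <= d * `|E| by rewrite ler_wpM2r// ltW.
    by lra.
  - by apply: le_trans dm3; rewrite ler_wpM2r// ltW.
have bk theta : 0 < theta < d -> `|b theta - theta * kappa| <= B * theta ^+ 2.
  move=> tt; have [gd _ _ tA] := small _ tt; have /andP[th0 _] := tt.
  have := limit_value_galt al0 (ltW th0) gd tA; rewrite -/(b theta) -/kappa -/E -/w -/A.
  by rewrite (_ : B * theta ^+ 2 = 5 * (theta * A) ^+ 2)// /B; ring.
(* The rate was expanded at positive levels only: d B <= kappa / 2 keeps b_T within half of its
   linear part, hence positive. *)
have bsmall theta : 0 < theta < d -> 0 < b theta <= 2 * kappa * theta /\ small_level V (b theta).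
  move=> tt; have := bk _ tt; have /andP[th0 thd] := tt.
  have : theta * B <= kappa / 2 by apply: le_trans dm4; rewrite ler_wpM2r// ltW.
  move=> h; have {h} : B * theta ^+ 2 <= kappa / 2 * theta.
    by rewrite expr2 mulrA ler_pM2r// mulrC.
  have kt : 0 < kappa * theta by rewrite mulr_gt0.
  rewrite ler_norml => h /andP[h1 h2].
  have b0 : 0 < b theta by lra.
  have b1 : b theta <= 2 * kappa * theta by lra.
  split; first by rewrite b0.
  apply: tsmall; rewrite b0/=; apply: le_lt_trans b1 _; apply: lt_le_trans dm5.
  by rewrite ltr_pM2l// mulr_gt0.
exists d; split => //; exists b; split.
  move=> theta tt; have [gd _ _ _] := small _ tt; have /andP[th0 _] := tt; split.
    exact: conv_in_prob_galt (ltW th0) gd.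
  by apply: fseq_cvg; have [_] := bsmall _ tt.
pose a := V^-1.
have a0 : 0 < a by rewrite invr_gt0.
pose Crate := rate_const V.
have Cr0 : 0 < Crate := rate_const_gt0 V0.
pose q := a * kappa ^+ 2 / 2.
have q0 : 0 < q by rewrite divr_gt0// mulr_gt0// exprn_gt0.
have qE theta : theta ^+ 2 * (5 * C ^+ 2 / 972) / 2 = q * theta ^+ 2.
  by rewrite /q /a /V /kappa; field.
apply: (@ratio_cvg1 _ (fun theta => fT (b theta)) (fun theta => KL (galt alpha C D theta))
  q (8 * Crate * kappa ^+ 3 + 3 / 2 * a * B * kappa) (A3 + 3 * `|E| ^+ 3) d) => //.
- have k3 := exprn_ge0 3 (ltW k0); have aB := mulr_ge0 (mulr_ge0 (ltW a0) B0) (ltW k0).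
  have := mulr_ge0 (ltW Cr0) k3; move: aB; clear.
  by lra.
- by rewrite addr_ge0// mulr_ge0// exprn_ge0.
- move=> theta tt; have /andP[th0 thd] := tt.
  have [/andP[b0 b1] bs] := bsmall _ tt.
  have h1 := fT_approx bs; rewrite -/V -/a -/Crate in h1.
  have h2 : Crate * b theta ^+ 3 <= 8 * Crate * kappa ^+ 3 * theta ^+ 3.
    rewrite (_ : 8 * Crate * kappa ^+ 3 * theta ^+ 3 = Crate * (2 * kappa * theta) ^+ 3).
      by rewrite ler_pM2l// lerXn2r// nnegrE ltW// mulr_gt0// mulr_gt0.
    by ring.
  have h3 : `|a * b theta ^+ 2 / 2 - q * theta ^+ 2| <= 3 / 2 * a * B * kappa * theta ^+ 3.
    (* Difference of squares: the first factor is at most B theta^2 by [bk], the second at most 3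
       kappa theta. *)
    have -> : a * b theta ^+ 2 / 2 - q * theta ^+ 2 =
        a / 2 * ((b theta - theta * kappa) * (b theta + theta * kappa)).
      by rewrite /q; field.
    have -> : 3 / 2 * a * B * kappa * theta ^+ 3 =
        a / 2 * (B * theta ^+ 2 * (3 * (kappa * theta))) by field.
    rewrite normrM ger0_norm; last by rewrite divr_ge0// ltW.
    rewrite ler_pM2l ?divr_gt0// normrM; apply: ler_pM => //; first exact: bk.
    have kt : 0 < kappa * theta by rewrite mulr_gt0.
    by rewrite ger0_norm; lra.
  have := ler_distD (a * b theta ^+ 2 / 2) (fT (b theta)) (q * theta ^+ 2).
  by lra.
- move=> theta tt; have [_ h1 h2 _] := small _ tt; have /andP[th0 thd] := tt.
  have := KL_galt al0 (ltW th0) h1 h2; rewrite -/E -/w -/A3 qE.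
  by rewrite [X in _ <= X]mulrC.
Qed.
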